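(* For each $\lambda\in M$, the sequences $G_{n,\lambda}^{\pm}$ converge uniformly on compact subsets of $\mathbb{C}^2$, as $n\to\infty$, to continuous functions $G_\lambda^{\pm}$ satisfying $$d\,G_\lambda^{\pm}=G_{\sigma(\lambda)}^{\pm}\circ H_\lambda^{\pm 1}\quad\text{on }\mathbb{C}^2.$$ Moreover the convergence is independent of $\lambda$ (i.e. uniform in $\lambda\in M$ on each compact subset of $\mathbb{C}^2$). The functions $G_\lambda^{\pm}$ are positive pluriharmonic on $\mathbb{C}^2\setminus K_\lambda^{\pm}$, plurisubharmonic on $\mathbb{C}^2$, and vanish precisely on $K_\lambda^{\pm}$. The correspondence $\lambda\mapsto G_\lambda^{\pm}$ is continuous (for the topology of uniform convergence on compact subsets of $\mathbb{C}^2$). In case $\sigma$ is surjective, $G_\lambda^+$ is locally uniformly H\''older continuous: for each compact $S\subset\mathbb{C}^2$ there exist constants $\tau,C>0$, depending only on $S$ and the map $H$ (in particular not on $\lambda$), such that $$|G_\lambda^+(x,y)-G_\lambda^+(x',y')|\le C\,\|(x,y)-(x',y')\|^{\tau}$$ for all $(x,y),(x',y')\in S$.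
   Context: $M$ is a compact metric space and $\sigma:M\to M$ is continuous. Fix $m\ge1$ and integers $d_1,\dots,d_m\ge2$, and put $d=d_1\cdots d_m$. For $\lambda\in M$ and $1\le j\le m$ let $H_\lambda^{(j)}(x,y)=(y,\,p_{j,\lambda}(y)-a_j(\lambda)x)$ on $\mathbb{C}^2$, where $p_{j,\lambda}$ is a monic polynomial of degree $d_j$ whose coefficients are continuous functions of $\lambda\in M$ and $a_j$ is a continuous nowhere vanishing function on $M$. Let $H_\lambda=H_\lambda^{(m)}\circ\cdots\circ H_\lambda^{(1)}$ and $H:M\times\mathbb{C}^2\to M\times\mathbb{C}^2$, $H(\lambda,x,y)=(\sigma(\lambda),H_\lambda(x,y))$. For $n\ge0$ let $H_\lambda^{\pm n}=H_{\sigma^{n-1}(\lambda)}^{\pm1}\circ\cdots\circ H_{\sigma(\lambda)}^{\pm1}\circ H_\lambda^{\pm1}$ (so in general $H_\lambda^{-n}$ is not the inverse of $H_\lambda^{+n}$). Let $K_\lambda^{\pm}=\{(x,y)\in\mathbb{C}^2:\ \{H_\lambda^{\pm n}(x,y)\}_n\text{ is bounded}\}$. For $n\ge1$ let $$G_{n,\lambda}^{\pm}(x,y)=\frac1{d^n}\log^+\|H_\lambda^{\pm n}(x,y)\|,\qquad \log^+t=\max\{\log t,0\}.$$ *)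

(* Defs.v *)
From HB Require Import structures.
From mathcomp Require Import all_boot all_order all_algebra.
From mathcomp Require Import complex.
From mathcomp Require Import all_classical all_reals all_analysis.
Set Implicit Arguments.
Unset Strict Implicit.
Unset Printing Implicit Defensive.
Import Order.TTheory GRing.Theory Num.Theory.
Import numFieldTopology.Exports numFieldNormedType.Exports.
Local Open Scope classical_set_scope.
Local Open Scope ring_scope.

(* R[i] with the topology of the modulus, as a normed space over itself. *)
HB.instance Definition _ (R : realType) := NormedModule.copy R[i] R[i]^o.

Notation CC R := (R[i] * R[i])%type.

Definition norm2 (R : realType) (z : CC R) : R :=
  Num.sqrt (ComplexField.Normc.normc z.1 ^+ 2 + ComplexField.Normc.normc z.2 ^+ 2).

(* The library's ln satisfies ln 0 = 0, so logp 0 = 0 as it should. *)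
Definition logp (R : realType) (t : R) : R := Num.max (ln t) 0.

Definition henon1 (R : realType) (p : {poly R[i]}) (a : R[i]) (z : CC R) : CC R :=
  (z.2, p.[z.2] - a * z.1).

Definition henon1_inv (R : realType) (p : {poly R[i]}) (a : R[i]) (z : CC R) :
  CC R := ((p.[z.1] - z.2) / a, z.1).

Lemma henon1K (R : realType) (p : {poly R[i]}) (a : R[i]) : a != 0 ->
  cancel (henon1 p a) (henon1_inv p a).
Proof.
move=> a0 [x y]; rewrite /henon1_inv /henon1 /=; congr (_, _).
by rewrite opprB addrC subrK mulrC mulKf.
Qed.

Lemma henon1_invK (R : realType) (p : {poly R[i]}) (a : R[i]) : a != 0 ->
  cancel (henon1_inv p a) (henon1 p a).
Proof.
move=> a0 [x y]; rewrite /henon1_inv /henon1 /=; congr (_, _).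
by rewrite mulrC divfK // opprB addrC subrK.
Qed.

(* The factor of index 0 is applied first. *)
Definition henon (R : realType) (M : Type) (m : nat)
    (p : 'I_m -> M -> {poly R[i]}) (a : 'I_m -> M -> R[i])
    (l : M) (z : CC R) : CC R :=
  foldl (fun w j => henon1 (p j l) (a j l) w) z (enum 'I_m).

Definition henon_inv (R : realType) (M : Type) (m : nat)
    (p : 'I_m -> M -> {poly R[i]}) (a : 'I_m -> M -> R[i])
    (l : M) (z : CC R) : CC R :=
  foldr (fun j w => henon1_inv (p j l) (a j l) w) z (enum 'I_m).

Lemma henonK (R : realType) (M : Type) (m : nat)
    (p : 'I_m -> M -> {poly R[i]}) (a : 'I_m -> M -> R[i]) (l : M) :
  (forall j, a j l != 0) -> cancel (henon p a l) (henon_inv p a l).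
Proof.
move=> a0 z; rewrite /henon /henon_inv; elim: (enum 'I_m) z => //= j s IH z.
by rewrite IH henon1K.
Qed.

Lemma henon_invK (R : realType) (M : Type) (m : nat)
    (p : 'I_m -> M -> {poly R[i]}) (a : 'I_m -> M -> R[i]) (l : M) :
  (forall j, a j l != 0) -> cancel (henon_inv p a l) (henon p a l).
Proof.
move=> a0 z; rewrite /henon /henon_inv; elim: (enum 'I_m) z => //= j s IH z.
by rewrite henon1_invK.
Qed.

(* true encodes the sign + and false the sign -. *)
Definition henon_pm (R : realType) (M : Type) (m : nat)
    (p : 'I_m -> M -> {poly R[i]}) (a : 'I_m -> M -> R[i]) (s : bool) :
    M -> CC R -> CC R :=
  if s then henon p a else henon_inv p a.

(* F (sigma^(n-1) l) o ... o F (sigma l) o F l; for F = henon_inv this is in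
   general not the inverse of the iterate for F = henon. *)
Fixpoint fiber_iter (R : realType) (M : Type) (sigma : M -> M)
    (F : M -> CC R -> CC R) (n : nat) (l : M) (z : CC R) : CC R :=
  if n is n'.+1 then F (iter n' sigma l) (fiber_iter sigma F n' l z) else z.

Definition bounded_orbits (R : realType) (M : Type) (sigma : M -> M)
    (F : M -> CC R -> CC R) (l : M) : set (CC R) :=
  [set z | exists B : R, forall n, norm2 (fiber_iter sigma F n l z) <= B].

Definition green_approx (R : realType) (M : Type) (sigma : M -> M)
    (F : M -> CC R -> CC R) (d : nat) (n : nat) (l : M) (z : CC R) : R :=
  (d%:R ^+ n)^-1 * logp (norm2 (fiber_iter sigma F n l z)).

(* V is R[i] or R[i] * R[i]; differentiation is along the real line through z
   in the direction v. *)
Definition derivable_dir (R : realType) (V : normedModType R[i]) (v : V)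
    (u : V -> R) (z : V) : Prop :=
  derivable (fun t : R => u (z + t%:C%C *: v)) 0 1.

Definition derive_dir (R : realType) (V : normedModType R[i]) (v : V)
    (u : V -> R) (z : V) : R :=
  derive1 (fun t : R => u (z + t%:C%C *: v)) 0.

(* Directional derivatives along all real directions v, in particular along the
   coordinate directions 1 and 'i of each complex coordinate. *)
Definition class_C1 (R : realType) (V : normedModType R[i]) (U : set V)
    (u : V -> R) : Prop :=
  forall v z, U z -> derivable_dir v u z /\ {for z, continuous (derive_dir v u)}.

Definition class_C2 (R : realType) (V : normedModType R[i]) (U : set V)
    (u : V -> R) : Prop :=
  class_C1 U u /\ forall v, class_C1 U (derive_dir v u).

Definition harmonic_on (R : realType) (U : set R[i]) (h : R[i] -> R) : Prop :=
  [/\ open U, class_C2 U h & forall z, U z ->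
    derive_dir (1 : R[i]) (derive_dir (1 : R[i]) h) z +
    derive_dir ('i%C : R[i]) (derive_dir ('i%C : R[i]) h) z = 0].

Definition pluriharmonic_on (R : realType) (U : set (CC R)) (u : CC R -> R) :
    Prop :=
  [/\ open U, class_C2 U u & forall a b : CC R,
    harmonic_on [set w : R[i] | U (a + w *: b)]
      (fun w : R[i] => u (a + w *: b))].

Definition upper_semicontinuous (R : realType) (X : topologicalType)
    (f : X -> \bar R) : Prop :=
  lower_semicontinuous (fun x => - f x)%E.

(* The function that is identically -oo is allowed. *)
Definition subharmonic (R : realType) (h : R[i] -> \bar R) : Prop :=
  [/\ forall z, (h z < +oo)%E, upper_semicontinuous h &
    forall (c : R[i]) (r : R), 0 < r ->
      (h c <= ((2 * pi)^-1)%:E * \int[lebesgue_measure]_(t in `[0%R, (2 * pi)%R])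
        h (c + r%:C%C * (cos t +i* sin t)%C)%R)%E].

Definition plurisubharmonic (R : realType) (u : CC R -> \bar R) : Prop :=
  upper_semicontinuous u /\
  forall a b : CC R, subharmonic (fun w : R[i] => u (a + w *: b)).

(* Main.v *)
Require Import Defs.
From HB Require Import structures.
From mathcomp Require Import all_boot all_order all_algebra.
From mathcomp Require Import complex.
From mathcomp Require Import all_classical all_reals all_analysis.
From mathcomp Require Import ring lra zify.
Set Implicit Arguments.
Unset Strict Implicit.
Unset Printing Implicit Defensive.
Import Order.TTheory GRing.Theory Num.Theory.
Import numFieldTopology.Exports numFieldNormedType.Exports.
Local Open Scope classical_set_scope.
Local Open Scope ring_scope.

(** Only one kind of map has to be studied.  The elementary map
    $(x,y) \mapsto (y, p(y) - ax)$ and, after exchanging the two coordinates, its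
    inverse are both of the form $(x,y) \mapsto (y, P(y) - bx)$ with $\deg P \ge 2$.
    By compactness of the parameter space all the coefficients are bounded, and the
    leading ones are bounded away from $0$, uniformly in the parameter and in the
    sign; [tame] collects the resulting estimates, with two constants $c$ and $C$
    ([uniform_tame]).  Both signs and all parameters are thus covered by an
    arbitrary sequence of tame steps, provided that every bound depends only on $c$
    and $C$; [fiber_iter_orb] makes the translation, $m$ steps being one iterate.

    Let $\rho = 12C/c$, let $(x_k,y_k)$ be an orbit, and let $D_k$ be the product of
    the first $k$ degrees.  The region $|x| \le \max(|y|,\rho)$ is forward invariant,
    and outside it the first coordinate is at least halved by each step, so that
    orbits enter it at a time controlled by the size of the starting point
    ([orb_in_W]).  Inside it a step multiplies $\log\max(|y|,\rho)$ by the degree, up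
    to a bounded error; hence $\log\max(|y_k|,\rho)/D_k$ converges with an error
    $O(2^{-k})$ ([potential_rate]), and the limit is the Green function.  Since
    $\log^+\|(x,y)\|$ and $\log\max(|y|,\rho)$ differ there by a bounded amount, this
    gives the uniform convergence, the functional equation, the zero set
    ([green_gt0], [green_eq0]) and, the potentials being continuous in everything,
    the joint continuity in the parameter and the point ([continuous_green]).

    Hölder continuity ([green_holder]) comes from two competing rates: the distance
    of two orbits relative to their size grows by at most a constant factor at each
    step, whereas the contribution of the steps after the $j$-th one to the Green
    function is $O(2^{-j})$.

    Where the Green function is positive the orbit ends up in $|x| \le |y|$,
    $|y| \ge \rho$, and there it is the limit of $\log|y_k|/D_k$, the real parts of
    holomorphic functions.  The first and second derivatives of these functions
    along real lines are written down explicitly ([dorb], [ddorb]) and shown to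
    converge geometrically ([dlog_step], [ddlog_step]); the limit is then of class
    $C^2$, and its second derivatives in the directions $v$ and $iv$ cancel because
    they come from complex bilinear forms ([green_pluriharmonic]).

    Along a complex line $y_k$ is a polynomial.  For a polynomial $Q$ the submean
    inequality of $\log\max(|Q|,B)$ over the $2^k$-th roots of unity follows from
    the factorization of $A^n - B^n$ ([log_max_submean]).  It passes to the Green
    function by uniform convergence, and from sums over roots of unity to the
    integral over the circle ([green_plurisubharmonic]). *)

(** * Moduli of complex numbers *)

Section Modulus.
Variable R : realType.
Implicit Types x y z : R[i].
Local Notation nc := (@ComplexField.Normc.normc R).

Lemma nc_ge0 z : 0 <= nc z.
Proof. by case: z => a b; rewrite /= sqrtr_ge0. Qed.

Lemma normr_nc z : `|z| = (nc z)%:C%C.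
Proof. by case: z => a b; rewrite normc_def. Qed.

Lemma nc0 : nc 0 = 0.
Proof. exact: ComplexField.Normc.normc0. Qed.

Lemma nc1 : nc 1 = 1.
Proof. exact: ComplexField.Normc.normc1. Qed.

Lemma ncM x y : nc (x * y) = nc x * nc y.
Proof. exact: ComplexField.Normc.normcM. Qed.

Lemma ncV x : nc x^-1 = (nc x)^-1.
Proof. exact: ComplexField.Normc.normcV. Qed.

Lemma ncX x n : nc (x ^+ n) = nc x ^+ n.
Proof. by elim: n => [|n IH]; rewrite ?expr0 ?nc1 // !exprS ncM IH. Qed.

Lemma nc_real (r : R) : nc r%:C%C = `|r|.
Proof. by rewrite /= expr0n /= addr0 sqrtr_sqr. Qed.

Lemma nc_nat n : nc n%:R = n%:R.
Proof. by rewrite -(rmorph_nat (real_complex R)) nc_real normr_nat. Qed.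

Lemma ncN x : nc (- x) = nc x.
Proof. exact: normcN. Qed.

Lemma ncB_sym x y : nc (x - y) = nc (y - x).
Proof. by rewrite -ncN opprB. Qed.

Lemma ncD x y : nc (x + y) <= nc x + nc y.
Proof. exact: le_normcD. Qed.

Lemma ncB x y : nc (x - y) <= nc x + nc y.
Proof. by rewrite -(ncN y) ncD. Qed.

Lemma ncB_ge x y : nc x - nc y <= nc (x - y).
Proof. by rewrite lerBlDr -{1}(subrK y x) ncD. Qed.

Lemma nc_dist x y : `|nc x - nc y| <= nc (x - y).
Proof.
rewrite ler_norml ncB_ge andbT lerNl opprB ncB_sym; exact: ncB_ge.
Qed.

Lemma nc_eq0 x : (nc x == 0) = (x == 0).
Proof.
by apply/eqP/eqP => [/ComplexField.Normc.eq0_normc//|->]; rewrite nc0.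
Qed.

Lemma nc_gt0 x : (0 < nc x) = (x != 0).
Proof. by rewrite lt_neqAle nc_ge0 andbT eq_sym nc_eq0. Qed.

Lemma nc_sum (I : Type) (s : seq I) (Q : pred I) (F : I -> R[i]) :
  nc (\sum_(i <- s | Q i) F i) <= \sum_(i <- s | Q i) nc (F i).
Proof.
elim/big_ind2: _ => // [|x1 x2 y1 y2 h1 h2]; first by rewrite nc0.
exact: le_trans (ncD _ _) (lerD h1 h2).
Qed.

Lemma nc_Re z : `|complex.Re z| <= nc z.
Proof.
by case: z => a b /=; rewrite -sqrtr_sqr ler_wsqrtr // lerDl sqr_ge0.
Qed.

Lemma nc_le_ReIm z : nc z <= `|complex.Re z| + `|complex.Im z|.
Proof.
case: z => a b /=; rewrite -(@ler_pXn2r _ 2) ?nnegrE ?sqrtr_ge0 ?addr_ge0 //.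
rewrite sqr_sqrtr ?addr_ge0 ?sqr_ge0 // sqrrD !real_normK ?num_real //.
have : 0 <= `|a| * `|b| by rewrite mulr_ge0.
rewrite -[_ *+ 2]mulr_natl => h; lra.
Qed.

Lemma nc_sqr z : nc z ^+ 2 = complex.Re z ^+ 2 + complex.Im z ^+ 2.
Proof. by case: z => a b /=; rewrite sqr_sqrtr ?addr_ge0 ?sqr_ge0. Qed.

Lemma le_norm2_fst (z : CC R) : nc z.1 <= norm2 z.
Proof.
rewrite -[nc _]ger0_norm ?nc_ge0 // -sqrtr_sqr ler_wsqrtr //.
by rewrite lerDl sqr_ge0.
Qed.

Lemma le_norm2_snd (z : CC R) : nc z.2 <= norm2 z.
Proof.
rewrite -[nc _]ger0_norm ?nc_ge0 // -sqrtr_sqr ler_wsqrtr //.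
by rewrite lerDr sqr_ge0.
Qed.

Lemma norm2_le (z : CC R) r : nc z.1 <= r -> nc z.2 <= r -> norm2 z <= 2 * r.
Proof.
move=> h1 h2; have r0 : 0 <= r := le_trans (nc_ge0 _) h1.
rewrite -(@ler_pXn2r _ 2) ?nnegrE ?sqrtr_ge0 ?mulr_ge0 //.
rewrite sqr_sqrtr ?addr_ge0 ?sqr_ge0 //.
have /andP[a0 b0] : (0 <= nc z.1) && (0 <= nc z.2) by rewrite !nc_ge0.
nra.
Qed.

Lemma nbhs_ncP z (A : set R[i]) :
  nbhs z A <-> exists2 e : R, 0 < e & forall w, nc (w - z) < e -> A w.
Proof.
split=> [/nbhs_normP[e /= e0 h]|[e e0 h]].
  have [eim ere] : complex.Im e = 0 /\ 0 < complex.Re e.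
    by move: e0; rewrite ltcE /= => /andP[/eqP -> ->].
  exists (complex.Re e) => // w hw; apply: h.
  by rewrite /ball_ /= distrC normr_nc ltcE /= eim eqxx.
apply: (proj2 (nbhs_normP z A)); exists (e%:C)%C; first by rewrite /= ltcE /= eqxx.
by move=> w; rewrite /ball_ /= distrC normr_nc ltcR => /h.
Qed.

(** [R[i]] carries a norm with values in [R[i]]; the next two criteria express its
    convergence, and that of the reals, by inequalities between elements of [R]. *)
Lemma cvg_ncP (T : Type) (F : set_system T) (FF : Filter F) (f : T -> R[i]) z :
  f @ F --> z <-> forall e : R, 0 < e -> \forall t \near F, nc (f t - z) < e.
Proof.
split=> [h e e0|h A /nbhs_ncP[e e0 hA]].
  by apply: (h [set w | nc (w - z) < e]); apply/nbhs_ncP; exists e.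
by apply: filterS (h e e0) => t; apply: hA.
Qed.

Lemma cvg_distP (T : Type) (F : set_system T) (FF : Filter F) (f : T -> R) r :
  f @ F --> r <-> forall e : R, 0 < e -> \forall t \near F, `|f t - r| < e.
Proof.
split=> [/cvgrPdist_lt h e /h|h]; first by apply: filterS => t; rewrite distrC.
by apply/cvgrPdist_lt => e /h; apply: filterS => t; rewrite distrC.
Qed.

Lemma continuous_nc : continuous nc.
Proof.
move=> z; apply/(cvg_distP (nbhs_filter z)) => e e0.
apply/nbhs_ncP; exists e => // w hw.
exact: le_lt_trans (nc_dist _ _) _.
Qed.

Lemma continuous_Re : continuous (@complex.Re R : R[i] -> R).
Proof.
move=> z; apply/(cvg_distP (nbhs_filter z)) => e e0.
apply/nbhs_ncP; exists e => // w hw.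
by rewrite -raddfB; apply: le_lt_trans (nc_Re _) _.
Qed.

End Modulus.

(** * Estimates for one elementary step *)

Section Tame.
Variable R : realType.
Implicit Types (x y b : R[i]) (P Q : {poly R[i]}).
Local Notation nc := (@ComplexField.Normc.normc R).

Lemma nc_horner_le Q n (B r : R) y : (size Q <= n)%N ->
  (forall i, nc Q`_i <= B) -> 1 <= r -> nc y <= r ->
  nc Q.[y] <= n%:R * B * r ^+ n.-1.
Proof.
move=> sQ hB r1 yr; rewrite (horner_coef_wide _ sQ).
apply: le_trans (nc_sum _ _ _) _.
apply: (@le_trans _ _ (\sum_(i < n) B * r ^+ n.-1)).
  apply: ler_sum => i _; rewrite ncM ncX; apply: ler_pM; rewrite ?exprn_ge0 ?nc_ge0 //.
  apply: le_trans (_ : r ^+ i <= _).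
    by rewrite lerXn2r // nnegrE ?nc_ge0 // (le_trans _ r1).
  by rewrite ler_weXn2l //; case: (n) i => [[]//|k i]; rewrite -ltnS ltn_ord.
by rewrite sumr_const card_ord -mulrA mulr_natl.
Qed.

Lemma nc_subX_le x y n (r : R) : nc x <= r -> nc y <= r ->
  nc (x ^+ n - y ^+ n) <= n%:R * r ^+ n.-1 * nc (x - y).
Proof.
move=> xr yr; have r0 : 0 <= r := le_trans (nc_ge0 _) xr.
rewrite subrXX ncM mulrC ler_wpM2r ?nc_ge0 //.
apply: le_trans (nc_sum _ _ _) _.
apply: (@le_trans _ _ (\sum_(i < n) r ^+ n.-1)); last first.
  by rewrite sumr_const card_ord mulr_natl.
apply: ler_sum => -[i /= ilt] _; rewrite ncM !ncX.
have -> : n.-1 = (n.-1 - i + i)%N by rewrite subnK // -ltnS (ltn_predK ilt).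
rewrite exprD addnK.
apply: ler_pM; rewrite ?exprn_ge0 ?nc_ge0 //.
  by rewrite lerXn2r // nnegrE ?nc_ge0.
by rewrite lerXn2r // nnegrE ?nc_ge0.
Qed.

Lemma nc_horner_lip Q n (B r : R) x y : (size Q <= n.+1)%N ->
  (forall i, nc Q`_i <= B) -> 1 <= r -> nc x <= r -> nc y <= r ->
  nc (Q.[x] - Q.[y]) <= n.+1%:R * (B * (n.+1%:R * r ^+ n.-1)) * nc (x - y).
Proof.
move=> sQ hB r1 xr yr; rewrite !(horner_coef_wide _ sQ) -sumrB.
apply: le_trans (nc_sum _ _ _) _.
apply: (@le_trans _ _ (\sum_(i < n.+1)
    B * (n.+1%:R * r ^+ n.-1) * nc (x - y))); last first.
  by rewrite sumr_const card_ord -[leLHS]mulr_natl mulrA.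
apply: ler_sum => i _; rewrite -mulrBr ncM -mulrA.
apply: ler_pM; rewrite ?nc_ge0 //.
apply: le_trans (nc_subX_le _ xr yr) _; rewrite ler_wpM2r ?nc_ge0 //.
apply: ler_pM; rewrite ?ler0n ?exprn_ge0 ?(le_trans _ r1) //.
  by rewrite ler_nat ltnW // ltnS ltnW // ltnS -ltnS.
rewrite ler_weXn2l //; have := ltn_ord i; lia.
Qed.

(** The factor 12 makes a step expand the second coordinate by [12 * C], enough to
    absorb every later constant. *)
Definition escape_radius (c C : R) : R := 12 * C / c.

(** The uniform estimates on one elementary step $(x,y) \mapsto (y, P(y)-bx)$
    that the whole argument rests on. *)
Record tame (c C : R) (d : nat) (P : {poly R[i]}) (b : R[i]) : Prop := Tame {
  tame_gt1 : (2 <= d)%N;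
  tame_deg : d%:R <= C;
  tame_b : nc b <= C;
  tame_low : forall x y, escape_radius c C <= nc y -> nc x <= nc y ->
    c * nc y ^+ d <= nc (P.[y] - b * x);
  tame_up : forall (r : R) x y, 1 <= r -> nc x <= r -> nc y <= r ->
    nc (P.[y] - b * x) <= C * r ^+ d;
  tame_lip : forall (r : R) x y, 1 <= r -> nc x <= r -> nc y <= r ->
    nc (P.[x] - P.[y]) <= C * r ^+ d.-1 * nc (x - y);
  tame_d1 : forall x y, 1 <= nc y -> nc x <= nc y ->
    nc (y * P^`().[y] - d%:R * (P.[y] - b * x)) <= C * nc y ^+ d.-1;
  tame_d2 : forall x y, 1 <= nc y -> nc x <= nc y ->
    nc (y ^+ 2 * P^`()^`().[y] - (d * d.-1)%:R * (P.[y] - b * x))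
    <= C * nc y ^+ d.-1 }.

Lemma nc_b_le (d : nat) (B : R) x y b : (2 <= d)%N -> 1 <= nc y ->
  nc x <= nc y -> nc b <= B -> nc (b * x) <= B * nc y ^+ d.-1.
Proof.
move=> d2 y1 xy bB; rewrite ncM ler_pM ?nc_ge0 //.
by apply: le_trans xy _; rewrite -{1}[nc y]expr1 ler_weXn2l //; lia.
Qed.

(** In [tame_low], [tame_d1] and [tame_d2] the leading terms are split off or cancel;
    what remains is [b * x] and a polynomial of degree less than $d$, with coefficients
    bounded by $d^2B$. *)
Lemma tame_degree (B c0 : R) (N d : nat) P b : 0 < c0 -> c0 <= 1 -> 1 <= B ->
  (2 <= d <= N)%N -> size P = d.+1 -> (forall i, nc P`_i <= B) ->
  c0 <= nc (lead_coef P) -> nc b <= B ->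
  tame (c0 / 2) ((N%:R + 2) ^+ 3 * B) d P b.
Proof.
move=> c00 c01 B1 /andP[d2 dN] sP cP lP bB.
have B0 : 0 <= B by rewrite (le_trans _ B1).
have N2 : 2 <= N%:R :> R by rewrite ler_nat (leq_trans d2).
have dNR : d%:R <= N%:R :> R by rewrite ler_nat.
have d2R : 2 <= d%:R :> R by rewrite ler_nat.
have d1 : d = d.-1.+1 by case: (d) d2.
have NB : N%:R * B >= 2 * B by rewrite ler_wpM2r.
have dB : d%:R * B <= N%:R * B by rewrite ler_wpM2r.
have NNB : N%:R * N%:R * B >= 2 * (N%:R * B).
  by rewrite -mulrA ler_wpM2r // mulr_ge0.
have NNNB : N%:R * N%:R * N%:R * B >= 2 * (N%:R * N%:R * B).
  by rewrite -!mulrA ler_wpM2r // !mulr_ge0.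
have ddB : d%:R * (d%:R * B) <= N%:R * N%:R * B.
  by rewrite mulrA ler_wpM2r // ler_pM.
have dddB : d%:R * (d%:R * (d%:R * B)) <= N%:R * N%:R * N%:R * B.
  by rewrite !mulrA ler_wpM2r // !ler_pM // mulr_ge0.
have N_NB : N%:R <= N%:R * B by rewrite ler_peMr.
set C := (_ ^+ 3 * B).
have CE : C = N%:R * N%:R * N%:R * B + 6 * (N%:R * N%:R * B) + 12 * (N%:R * B)
   + 8 * B by rewrite /C; ring.
clearbody C.
split => //.
- by rewrite CE; apply: le_trans dNR _; lra.
- by rewrite CE; apply: le_trans bB _; lra.
- move=> x y hy xy; have C0 : 0 < C by rewrite CE; lra.
  have hyc : 24 * C <= c0 * nc y.
    move: hy; rewrite /escape_radius invf_div mulrA ler_pdivrMr //; lra.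
  have y1 : 1 <= nc y.
    have C1 : 1 <= C by rewrite CE; lra.
    have : c0 * nc y <= nc y by rewrite ler_piMl ?nc_ge0.
    lra.
  (* On [nc y >= rho] the leading term is at least twice the sum of the others. *)
  pose Q := P - (lead_coef P) *: 'X^d.
  have sQ : (size Q <= d)%N.
    apply/leq_sizeP => j hj; rewrite coefB coefZ coefXn.
    have [->|jd] := eqVneq j d; first by rewrite /lead_coef sP /= mulr1 subrr.
    by rewrite mulr0 subr0 nth_default // sP ltn_neqAle eq_sym jd.
  have cQ i : nc Q`_i <= B.
    rewrite coefB coefZ coefXn; have [->|jd] := eqVneq i d.
      by rewrite /lead_coef sP /= mulr1 subrr nc0.
    by rewrite mulr0 subr0.
  have hQ := nc_horner_le sQ cQ y1 (lexx _).
  have hb := nc_b_le d2 y1 xy bB.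
  have -> : P.[y] - b * x = lead_coef P * y ^+ d - (- (Q.[y] - b * x)).
    by rewrite /Q hornerD hornerN hornerZ hornerXn; ring.
  apply: le_trans (ncB_ge _ _); rewrite ncN.
  have := ncB Q.[y] (b * x); rewrite (ncM (lead_coef P)) ncX.
  have -> : nc y ^+ d = nc y * nc y ^+ d.-1 by rewrite {1}d1 exprS.
  set Y := nc y ^+ d.-1 in hQ hb *.
  have Y0 : 0 <= Y by rewrite exprn_ge0 ?nc_ge0.
  have hL : c0 * (nc y * Y) <= nc (lead_coef P) * (nc y * Y).
    by rewrite ler_wpM2r // mulr_ge0 ?nc_ge0.
  have h5 : 0 <= C * Y by rewrite mulr_ge0 // ltW.
  have h3 : 24 * C * Y <= c0 * nc y * Y by rewrite ler_wpM2r.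
  have h4 : d%:R * B * Y + B * Y <= C * Y.
    by rewrite -mulrDl ler_wpM2r // CE; lra.
  lra.
- move=> r x y r1 xr yr; have r0 : 0 <= r by rewrite (le_trans _ r1).
  apply: le_trans (ncB _ _) _.
  have := nc_horner_le (eq_leq sP) cP r1 yr; rewrite /= => h.
  have h2 : nc (b * x) <= B * r ^+ d.
    rewrite ncM ler_pM ?nc_ge0 //; apply: le_trans xr _.
    by rewrite -{1}[r]expr1 ler_weXn2l // ltnW.
  apply: le_trans (lerD h h2) _; rewrite -mulrDl ler_wpM2r ?exprn_ge0 // CE.
  rewrite -natr1 mulrDl mul1r; lra.
- move=> r x y r1 xr yr; have r0 : 0 <= r by rewrite (le_trans _ r1).
  have := nc_horner_lip (eq_leq sP) cP r1 xr yr; move=> h.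
  apply: le_trans h _; rewrite ler_wpM2r ?nc_ge0 // !mulrA ler_wpM2r ?exprn_ge0 //.
  rewrite CE -natr1; lra.
- move=> x y y1 xy; pose Q := 'X * P^`() - d%:R *: P.
  have coQ i : Q`_i = (i%:R - d%:R) * P`_i.
    rewrite coefB coefZ mulrC coefMX mulrBl; congr (_ - _).
    by case: i => [|i] /=; rewrite ?mul0r // coef_deriv mulr_natl.
  have sQ : (size Q <= d)%N.
    apply/leq_sizeP => j; rewrite leq_eqVlt coQ => /orP[/eqP ->|jd].
      by rewrite subrr mul0r.
    by rewrite [P`_j]nth_default ?mulr0 // sP.
  have cQ i : nc Q`_i <= d%:R * B.
    have [di|id] := leqP d i.
      by rewrite nth_default ?nc0 ?mulr_ge0 //; apply: leq_trans di.
    rewrite coQ ncM ncB_sym -natrB ?nc_nat ?(ltnW id) //.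
    by rewrite ler_pM ?ler0n ?nc_ge0 // ler_nat leq_subr.
  have hQ := nc_horner_le sQ cQ y1 (lexx _).
  have hb := nc_b_le d2 y1 xy bB.
  have -> : y * P^`().[y] - d%:R * (P.[y] - b * x) = Q.[y] + d%:R * (b * x).
    by rewrite /Q hornerD hornerN hornerZ hornerM hornerX; ring.
  apply: le_trans (ncD _ _) _; rewrite (ncM d%:R) nc_nat.
  have Y0 : 0 <= nc y ^+ d.-1 by rewrite exprn_ge0 ?nc_ge0.
  apply: le_trans (lerD hQ (ler_wpM2l (ler0n _ d) hb)) _.
  by rewrite (mulrA _ B) -mulrDl ler_wpM2r // CE; lra.
- move=> x y y1 xy; pose Q := 'X^2 * P^`()^`() - (d * d.-1)%:R *: P.
  have coQ i : Q`_i = ((i * i.-1)%:R - (d * d.-1)%:R) * P`_i.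
    rewrite coefB coefZ mulrC coefMXn mulrBl; congr (_ - _).
    case: i => [|[|i]]; rewrite ?muln0 ?mul0n ?mul0r //= !subSS subn0.
    by rewrite !coef_deriv -mulrnA mulr_natl mulnC.
  have sQ : (size Q <= d)%N.
    apply/leq_sizeP => j; rewrite leq_eqVlt coQ => /orP[/eqP ->|jd].
      by rewrite subrr mul0r.
    by rewrite [P`_j]nth_default ?mulr0 // sP.
  have cQ i : nc Q`_i <= d%:R * (d%:R * B).
    have [di|id] := leqP d i.
      by rewrite nth_default ?nc0 ?mulr_ge0 //; apply: leq_trans di.
    have ii : (i * i.-1 <= d * d.-1)%N by rewrite leq_mul ?(ltnW id) // -subn1 -[d.-1]subn1 leq_sub2r // ltnW.
    rewrite coQ ncM ncB_sym -natrB ?nc_nat // mulrA.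
    rewrite ler_pM ?ler0n ?nc_ge0 // -natrM ler_nat.
    by apply: leq_trans (leq_subr _ _) _; rewrite leq_mul2l leq_pred orbT.
  have hQ := nc_horner_le sQ cQ y1 (lexx _).
  have hb := nc_b_le d2 y1 xy bB.
  have -> : y ^+ 2 * P^`()^`().[y] - (d * d.-1)%:R * (P.[y] - b * x)
    = Q.[y] + (d * d.-1)%:R * (b * x).
    by rewrite /Q hornerD hornerN hornerZ hornerM hornerXn; ring.
  apply: le_trans (ncD _ _) _; rewrite (ncM (_ * _)%:R) nc_nat.
  have Y0 : 0 <= nc y ^+ d.-1 by rewrite exprn_ge0 ?nc_ge0.
  apply: le_trans (lerD hQ (ler_wpM2l (ler0n _ _) hb)) _.
  have hd : (d * d.-1)%:R <= d%:R * d%:R :> R.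
    by rewrite -natrM ler_nat leq_mul2l leq_pred orbT.
  have hdB : (d * d.-1)%:R * B <= d%:R * d%:R * B by rewrite ler_wpM2r.
  by rewrite (mulrA _ B) -mulrDl ler_wpM2r // CE; lra.
Qed.

End Tame.

(** * Convergence at a geometric rate *)

Section GeometricRate.
Variable R : realType.
Implicit Types (u : nat -> R) (A : R) (k : nat).

Lemma half_powS A k : A / 2 ^+ k.+1 = A / 2 ^+ k / 2.
Proof. by rewrite exprS invfM (mulrC 2^-1) mulrA. Qed.

Lemma div_pow2_ge0 A k : 0 <= A -> 0 <= A / 2 ^+ k.
Proof. by move=> A0; rewrite divr_ge0 // exprn_ge0. Qed.

Lemma cvg_pow2 A : (fun k => A / 2 ^+ k) @ \oo --> (0 : R).
Proof.
have -> : (fun k => A / 2 ^+ k) = geometric A (2^-1).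
  by apply/funext => k; rewrite /geometric /= exprVn.
by apply: cvg_geometric; rewrite ger0_norm ?invr_ge0 // invf_lt1 // ltr1n.
Qed.

Lemma pow2_small A e : 0 < e -> exists k0, forall k, (k0 <= k)%N -> A / 2 ^+ k < e.
Proof.
move=> e0.
have [k0 _ h] := proj1 (cvg_distP eventually_filter _ _) (cvg_pow2 A) e e0.
exists k0 => k hk; have := h k hk.
by rewrite subr0 => /(le_lt_trans (ler_norm _)).
Qed.

Lemma geo_cauchy u A k0 :
  (forall k, (k0 <= k)%N -> `|u k.+1 - u k| <= A / 2 ^+ k.+1) ->
  forall k n, (k0 <= k)%N -> `|u (k + n)%N - u k| <= A / 2 ^+ k - A / 2 ^+ (k + n).
Proof.
move=> h k n hk; elim: n => [|n IH]; first by rewrite addn0 !subrr normr0.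
rewrite addnS; have := h (k + n)%N (leq_trans hk (leq_addr _ _)).
rewrite half_powS => h1.
have := ler_normD (u (k + n).+1 - u (k + n)%N) (u (k + n)%N - u k).
rewrite addrA subrK; lra.
Qed.

Lemma geo_cvg u A k0 :
  (forall k, (k0 <= k)%N -> `|u k.+1 - u k| <= A / 2 ^+ k.+1) -> cvgn u.
Proof.
move=> h; have A0 : 0 <= A.
  have := le_trans (normr_ge0 _) (h k0 (leqnn _)).
  by rewrite pmulr_lge0 // invr_gt0 exprn_gt0.
apply/cauchy_cvgP/cauchy_ballP => e e0.
have e20 : 0 < e / 2 by rewrite divr_gt0.
have [k1 hk1] := pow2_small A e20.
pose k := maxn k0 k1.
have hk k' : (k <= k')%N -> `|u k' - u k| < e / 2.
  move=> kk'; rewrite -(subnKC kk').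
  apply: le_lt_trans (geo_cauchy h _ (leq_maxl _ _)) _.
  have := hk1 k (leq_maxr _ _).
  have := div_pow2_ge0 (k + (k' - k)) A0; lra.
exists ([set x | `|x - u k| < e / 2], [set x | `|x - u k| < e / 2]).
  by split; exists k.
move=> [x y] /= [hx hy]; rewrite /ball /=.
have := ler_normD (x - u k) (u k - y).
rewrite addrA subrK [`|u k - y|]distrC => h1.
by apply: (le_lt_trans h1); rewrite [e]splitr ltrD.
Qed.

Lemma geo_lim u A k0 :
  (forall k, (k0 <= k)%N -> `|u k.+1 - u k| <= A / 2 ^+ k.+1) ->
  forall k, (k0 <= k)%N -> `|limn u - u k| <= A / 2 ^+ k.
Proof.
move=> h k hk; have A0 : 0 <= A.
  have := le_trans (normr_ge0 _) (h k0 (leqnn _)).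
  by rewrite pmulr_lge0 // invr_gt0 exprn_gt0.
have cu := geo_cvg h.
have bnd : \forall n \near \oo, `|u n - u k| <= A / 2 ^+ k.
  exists k => // n /= kn; rewrite -(subnKC kn).
  apply: le_trans (geo_cauchy h _ hk) _.
  by rewrite gerBl div_pow2_ge0.
have c2 : (fun n => `|u n - u k|) @ \oo --> `|limn u - u k|.
  by apply: cvg_norm; apply: cvgB => //; exact: cvg_cst.
by rewrite -(cvg_lim (@Rhausdorff R) c2); apply: limr_le bnd; exact: cvgP c2.
Qed.

End GeometricRate.

(** * Escape of orbits and the Green function *)

Section Orbit.
Variable R : realType.
Implicit Types (x y b : R[i]) (P : {poly R[i]}) (z : CC R).
Local Notation nc := (@ComplexField.Normc.normc R).

Lemma ln_le (a b : R) : 0 < a -> a <= b -> ln a <= ln b.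
Proof. by move=> a0 ab; rewrite ler_ln ?posrE // (lt_le_trans a0). Qed.

Fixpoint orb (P : nat -> {poly R[i]}) (b : nat -> R[i]) k z : CC R :=
  if k is k'.+1 then henon1 (P k') (b k') (orb P b k' z) else z.

Lemma orbS_fst (P : nat -> {poly R[i]}) (b : nat -> R[i]) k z : (orb P b k.+1 z).1 = (orb P b k z).2.
Proof. by []. Qed.

Definition degprod (d : nat -> nat) k : R := \prod_(i < k) (d i)%:R.

Lemma degprodS d k : degprod d k.+1 = degprod d k * (d k)%:R.
Proof. by rewrite /degprod big_ord_recr. Qed.

Lemma degprod0 d : degprod d 0 = 1.
Proof. by rewrite /degprod big_ord0. Qed.

Section Constants.
Variables (c C : R).
Hypotheses (c_gt0 : 0 < c) (c_le1 : c <= 1) (C_ge1 : 1 <= C).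
Local Notation rho := (escape_radius c C).

(** [in_W] is the complement of the region $|x| > \max(|y|,\rho)$ which orbits can only
    leave; inside [in_W], [size2 c C z] measures the size of the whole point. *)
Definition size2 z : R := Num.max (nc z.2) rho.
Definition in_W z : bool := nc z.1 <= size2 z.

Lemma c_rho : c * rho = 12 * C.
Proof. by rewrite /escape_radius mulrC divfK ?gt_eqF. Qed.

Lemma rho_ge12 : 12 <= rho.
Proof.
by rewrite /escape_radius ler_pdivlMr //; have := (c_le1, C_ge1) => -[]; lra.
Qed.

Lemma rho_gt0 : 0 < rho.
Proof. by have := rho_ge12; lra. Qed.

Lemma size2_ge z : rho <= size2 z.
Proof. by rewrite /size2 le_max lexx orbT. Qed.

Lemma size2_ge1 z : 1 <= size2 z.
Proof. by have := size2_ge z; have := rho_ge12; lra. Qed.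

Lemma size2_gt0 z : 0 < size2 z.
Proof. by have := size2_ge1 z; lra. Qed.

Lemma size2_snd z : nc z.2 <= size2 z.
Proof. by rewrite /size2 le_max lexx. Qed.

Section Step.
Variables (d : nat) (P : {poly R[i]}) (b : R[i]).
Hypothesis T : tame c C d P b.

Lemma tame_expand x y : rho <= nc y -> nc x <= nc y ->
  12 * C * nc y <= nc (P.[y] - b * x).
Proof.
move=> hy xy; apply: le_trans (tame_low T hy xy).
rewrite -c_rho -mulrA ler_pM2l //.
have y1 : 1 <= nc y by have := rho_ge12; lra.
apply: (@le_trans _ _ (nc y ^+ 2)).
  by rewrite expr2 ler_wpM2r // (le_trans _ y1).
by rewrite ler_weXn2l // (tame_gt1 T).
Qed.

(** A large $y$ sent to something smaller than $|y|$ requires cancellation between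
    $P(y)$ and $bx$, hence a large $x$. *)
Lemma tame_exit x y : rho < nc y -> nc (P.[y] - b * x) < nc y ->
  2 * nc y <= nc x.
Proof.
move=> hy hxy; have y0 : 0 < nc y by have := rho_gt0; lra.
have : 12 * C * nc y <= nc P.[y].
  have := @tame_expand 0 y (ltW hy); rewrite nc0 mulr0 subr0; apply; exact: ltW.
have := ncB (P.[y] - b * x) (- (b * x)); rewrite opprK subrK ncN ncM.
have : nc b * nc x <= C * nc x by rewrite ler_wpM2r ?nc_ge0 // (tame_b T).
have : nc y <= C * nc y by rewrite ler_peMl // ltW.
move=> h1 h2 h3 h4; rewrite -(@ler_pM2l _ C) ?(lt_le_trans _ C_ge1) //; lra.
Qed.

Lemma size2_step z : in_W z -> size2 z <= size2 (henon1 P b z).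
Proof.
case: z => x y; rewrite /in_W /size2 /= => hW.
have [yr|ry] := leP (nc y) rho; first by rewrite le_max lexx orbT.
rewrite le_max; apply/orP; left.
have xy : nc x <= nc y by move: hW; rewrite max_l // ltW.
have := tame_expand (ltW ry) xy.
have : nc y <= C * nc y by rewrite ler_peMl // nc_ge0.
have := nc_ge0 y; lra.
Qed.

Lemma in_W_step z : in_W z -> in_W (henon1 P b z).
Proof.
by move=> /size2_step; rewrite /in_W; apply: le_trans; exact: size2_snd.
Qed.

Definition osc_bound : R := ln C - ln c + C * ln rho.

Lemma osc_bound_ge0 : 0 <= osc_bound.
Proof.
have h1 : 0 <= ln C by rewrite ln_ge0.
have h2 : ln c <= 0 by rewrite ln_le0.
have h3 : 0 <= C * ln rho.
  by rewrite mulr_ge0 ?ln_ge0 ?(le_trans _ C_ge1) //; have := rho_ge12; lra.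
rewrite /osc_bound; lra.
Qed.

Lemma size2_low z : in_W z -> rho <= nc z.2 ->
  c * size2 z ^+ d <= size2 (henon1 P b z).
Proof.
case: z => x y; rewrite /in_W /= => hW hy.
have e : size2 (x, y) = nc y by rewrite /size2 /= max_l.
rewrite e in hW *; apply: le_trans (tame_low T hy hW) _.
by rewrite /size2 /= le_max lexx.
Qed.

Lemma size2_up z : in_W z -> size2 (henon1 P b z) <= C * size2 z ^+ d.
Proof.
move=> hW; rewrite {1}/size2 /= ge_max (tame_up T (size2_ge1 _) hW (size2_snd _)).
have h1 : rho <= size2 z ^+ d.
  apply: le_trans (size2_ge z) _; rewrite -{1}[size2 z]expr1.
  by rewrite ler_weXn2l ?size2_ge1 // ltnW // (tame_gt1 T).
apply: le_trans h1 _; rewrite ler_peMl // exprn_ge0 //.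
exact: le_trans (size2_ge1 z).
Qed.

Lemma ln_size2_step z : in_W z ->
  `|ln (size2 (henon1 P b z)) - d%:R * ln (size2 z)| <= osc_bound.
Proof.
move=> hW; have s0 := size2_gt0 z.
have sd0 : 0 < size2 z ^+ d by rewrite exprn_gt0.
have C0 : 0 < C by rewrite (lt_le_trans _ C_ge1).
have h1 : 0 <= ln C by rewrite ln_ge0.
have h2 : ln c <= 0 by rewrite ln_le0.
have lr : 0 <= ln rho by rewrite ln_ge0 //; have := rho_ge12; lra.
have h3 : d%:R * ln rho <= C * ln rho by rewrite ler_wpM2r // (tame_deg T).
have h4 : 0 <= d%:R * ln rho by rewrite mulr_ge0.
rewrite ler_norml /osc_bound; apply/andP; split; last first.
  have := ln_le (size2_gt0 _) (size2_up hW).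
  by rewrite lnM ?posrE // lnXn // -mulr_natl; lra.
have [hr|hr] := leP rho (nc z.2).
  have := ln_le _ (size2_low hW hr); rewrite lnM ?posrE // lnXn // -mulr_natl.
  by rewrite mulr_gt0 // => /(_ isT); lra.
have -> : size2 z = rho by rewrite /size2 max_r // ltW.
have := ln_le rho_gt0 (size2_ge (henon1 P b z)); lra.
Qed.

(** Multiplying the size by $c$ turns the lower bound $c|y|^d$ into an inequality
    without error term, so that [ln (c * size2)] divided by the degrees increases. *)
Lemma ln_csize2_step z : in_W z -> rho <= nc z.2 ->
  d%:R * ln (c * size2 z) <= ln (c * size2 (henon1 P b z)).
Proof.
move=> hW hr; have s0 := size2_gt0 z.
rewrite mulr_natl -lnXn ?mulr_gt0 //; apply: ln_le; rewrite ?exprn_gt0 ?mulr_gt0 //.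
rewrite exprMn.
apply: (@le_trans _ _ (c * (c * size2 z ^+ d))); last first.
  by rewrite ler_pM2l // size2_low.
rewrite mulrA ler_wpM2r ?exprn_ge0 ?(ltW s0) // -expr2.
by rewrite ler_wiXn2l ?(ltW c_gt0) // (tame_gt1 T).
Qed.

End Step.

Section Seq.
Variables (d : nat -> nat) (P : nat -> {poly R[i]}) (b : nat -> R[i]).
Hypothesis T : forall k, tame c C (d k) (P k) (b k).
Local Notation o := (orb P b).
Local Notation D := (degprod d).

Lemma pow2_le_degprod k : 2 ^+ k <= D k.
Proof.
elim: k => [|k IH]; first by rewrite expr0 degprod0.
rewrite exprSr degprodS ler_pM ?exprn_ge0 // ler_nat.
exact: tame_gt1 (T k).
Qed.

Lemma degprod_gt0 k : 0 < D k.
Proof. by apply: lt_le_trans (pow2_le_degprod k); rewrite exprn_gt0. Qed.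

Lemma div_degprod_le (A : R) k : 0 <= A -> A / D k <= A / 2 ^+ k.
Proof.
move=> A0; rewrite ler_wpM2l // lef_pV2 ?posrE ?degprod_gt0 ?exprn_gt0 //.
exact: pow2_le_degprod.
Qed.

(** As long as the orbit has not entered [in_W], its first coordinate is halved at
    each step; it would eventually be smaller than [rho], a contradiction. *)
Lemma notW_shrink k z : ~~ in_W (o k z) -> 2 ^+ k * nc (o k z).1 <= nc z.1.
Proof.
elim: k => [|k IH]; first by rewrite expr0 mul1r.
move=> nW; have nWk : ~~ in_W (o k z).
  by apply: contra nW => /(in_W_step (T k)).
apply: le_trans (IH nWk); rewrite exprSr -mulrA ler_pM2l ?exprn_gt0 //.
move: nW; rewrite /in_W /size2 -ltNge gt_max orbS_fst => /andP[h1 h2].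
exact: (tame_exit (T k) h2 h1).
Qed.

Lemma orb_in_W z k0 k : nc z.1 <= 2 ^+ k0 -> (k0 <= k)%N -> in_W (o k z).
Proof.
move=> hz hk; apply: contraT => nW.
have h1 := notW_shrink nW.
have h2 : rho < nc (o k z).1.
  by move: nW; rewrite /in_W /size2 -ltNge gt_max => /andP[].
have h3 : (2 : R) ^+ k0 <= 2 ^+ k by rewrite ler_weXn2l // ler1n.
have h4 : 2 ^+ k < 2 ^+ k * nc (o k z).1.
  by rewrite ltr_pMr ?exprn_gt0 //; have := rho_ge12; lra.
lra.
Qed.

Lemma in_W_orb z k j : in_W (o k z) -> (k <= j)%N -> in_W (o j z).
Proof.
move=> hW /subnKC <-; elim: (_ - _)%N => [|n IH]; first by rewrite addn0.
by rewrite addnS; exact: (in_W_step (T _) IH).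
Qed.

Definition potential k z : R := ln (size2 (o k z)) / D k.

Definition green z : R := limn (fun k => potential k z).

Lemma potential_step k z : in_W (o k z) ->
  `|potential k.+1 z - potential k z| <= osc_bound / 2 ^+ k.+1.
Proof.
move=> hW; apply: le_trans (div_degprod_le k.+1 osc_bound_ge0).
have D1 := degprod_gt0 k; have D2 := degprod_gt0 k.+1.
have dk : (d k)%:R != 0 :> R by rewrite pnatr_eq0 -lt0n ltnW // (tame_gt1 (T k)).
have -> : potential k.+1 z - potential k z =
    (ln (size2 (o k.+1 z)) - (d k)%:R * ln (size2 (o k z))) / D k.+1.
  by rewrite /potential degprodS; field; rewrite dk gt_eqF.
rewrite normrM (@ger0_norm _ (D k.+1)^-1) ?invr_ge0 ?(ltW D2) //.
rewrite ler_wpM2r ?invr_ge0 ?(ltW D2) //.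
exact: ln_size2_step.
Qed.

(** The error at each step is at most [osc_bound] divided by the product of degrees,
    which is at least a power of 2; the bound depends on [c] and [C] only. *)
Lemma potential_rate z k0 : in_W (o k0 z) -> forall k, (k0 <= k)%N ->
  `|green z - potential k z| <= osc_bound / 2 ^+ k.
Proof.
move=> hW; apply: geo_lim => k hk.
by apply: potential_step; exact: in_W_orb hk.
Qed.

Lemma potential_ge0 k z : 0 <= potential k z.
Proof.
by rewrite divr_ge0 ?ln_ge0 ?size2_ge1 // ltW // degprod_gt0.
Qed.

Lemma eventually_W z : exists k0, in_W (o k0 z).
Proof.
have [k0 hk] := @pow2_small R (nc z.1) 1 ltr01; exists k0.
apply: (@orb_in_W z k0 k0) => //; have := hk k0 (leqnn _).
by rewrite ltr_pdivrMr ?exprn_gt0 // mul1r => /ltW.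
Qed.

Lemma potential_cvg z : (fun k => potential k z) @ \oo --> green z.
Proof.
have [k0 hW] := eventually_W z; apply: (geo_cvg (k0 := k0)) => k hk.
by apply: potential_step; exact: in_W_orb hk.
Qed.

Lemma green_ge0 z : 0 <= green z.
Proof.
apply: (limr_ge (cvgP _ (@potential_cvg z))); apply: nearW => k.
exact: potential_ge0.
Qed.

(** Once the second coordinate has reached [rho] inside [in_W], the increasing
    quantity of [ln_csize2_step] bounds the potential from below by a positive
    constant. *)
Lemma green_gt0 z k : in_W (o k z) -> rho <= nc (o k z).2 -> 0 < green z.
Proof.
move=> hW hr.
pose v j := ln (c * size2 (o j z)) / D j.
have vk : 0 < v k.
  rewrite divr_gt0 ?degprod_gt0 // ln_gt0 //.
  have : c * rho <= c * size2 (o k z) by rewrite ler_pM2l // size2_ge.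
  by rewrite c_rho; have := C_ge1; lra.
have hrj n : rho <= nc (o (k + n) z).2.
  elim: n => [|n IH]; first by rewrite addn0.
  have hWn : in_W (o (k + n)%N z) by rewrite (in_W_orb hW) // leq_addr.
  rewrite addnS; have := size2_step (T (k + n)) hWn; rewrite {1}/size2 max_l //.
  move: hWn; rewrite /in_W {1}/size2 max_l // => xy.
  have := tame_expand (T (k + n)) IH xy; rewrite /= => h1 _.
  apply: le_trans h1; apply: le_trans IH _.
  by rewrite ler_peMl ?nc_ge0 //; have := C_ge1; lra.
have vmon n : v k <= v (k + n)%N.
  elim: n => [|n IH]; first by rewrite addn0.
  apply: le_trans IH _; rewrite addnS /v.
  have hWn : in_W (o (k + n)%N z) by rewrite (in_W_orb hW) // leq_addr.
  have := ln_csize2_step (T (k + n)) hWn (hrj n).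
  rewrite degprodS invfM mulrA ler_pdivlMr ?ltr0n ?(ltnW (tame_gt1 (T _))) //.
  move=> h; rewrite mulrAC ler_wpM2r ?invr_ge0 ?(ltW (degprod_gt0 _)) //.
  by rewrite mulrC.
apply: (lt_le_trans vk); apply: (limr_ge (cvgP _ (@potential_cvg z))).
exists k => // j /= /subnKC <-; apply: (le_trans (vmon (j - k)%N)).
rewrite /v /potential.
rewrite ler_wpM2r ?invr_ge0 ?(ltW (degprod_gt0 _)) // ln_le ?mulr_gt0 ?size2_gt0 //.
by rewrite ler_piMl // ltW // size2_gt0.
Qed.

(** A subsequence of bounded size suffices, because the potential is within
    $O(2^{-k})$ of its limit. *)
Lemma green_eq0 z (B : R) : (forall k0, exists2 k, (k0 <= k)%N & size2 (o k z) <= B) ->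
  green z = 0.
Proof.
move=> hB; apply/eqP; rewrite eq_le green_ge0 andbT; apply/ler_addgt0Pr => e e0.
rewrite add0r.
have [k1 hW] := eventually_W z.
have [k2 h2] := pow2_small (osc_bound + ln B) e0.
have [k hk sB] := hB (maxn k1 k2).
have lnB : 0 <= ln (size2 (o k z)) <= ln B.
  by rewrite ln_ge0 ?size2_ge1 //= ln_le // size2_gt0.
have h3 := potential_rate hW (leq_trans (leq_maxl _ _) hk).
have h4 : potential k z <= ln B / 2 ^+ k.
  apply: le_trans (div_degprod_le _ _); last by lra.
  rewrite ler_wpM2r ?invr_ge0 ?(ltW (degprod_gt0 _)) //; lra.
have := h2 k (leq_trans (leq_maxr _ _) hk).
rewrite mulrDl; have := ler_norm (green z - potential k z); lra.
Qed.

(** Inside [in_W] the maximum of the norm and 1 lies between $\max(|y|,\rho)/\rho$ and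
    $2\max(|y|,\rho)$. *)
Lemma potential_logp k z : in_W (o k z) ->
  `|(D k)^-1 * logp (norm2 (o k z)) - potential k z| <= 2 * ln rho / 2 ^+ k.
Proof.
have r12 := rho_ge12; have lr : 0 <= ln rho by rewrite ln_ge0 //; lra.
move=> hW; apply: le_trans (div_degprod_le k _); last by lra.
rewrite mulrC -mulrBl normrM (@ger0_norm _ (D k)^-1) ?invr_ge0 ?(ltW (degprod_gt0 _)) //.
rewrite ler_wpM2r ?invr_ge0 ?(ltW (degprod_gt0 _)) //.
set w := o k z; have s1 := size2_ge1 w; have s0 := size2_gt0 w.
have n0 : 0 <= norm2 w by rewrite sqrtr_ge0.
have l1 : 0 <= ln (size2 w) by rewrite ln_ge0.
have l2 : ln 2 <= ln rho by apply: ln_le => //; lra.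
have up : logp (norm2 w) <= ln 2 + ln (size2 w).
  rewrite /logp ge_max; apply/andP; split; last first.
    by rewrite addr_ge0 // ln_ge0 ?ler1n.
  have [->|nn] := eqVneq (norm2 w) 0.
    rewrite ln0 //; have : 0 <= ln 2 :> R by rewrite ln_ge0 ?ler1n.
    lra.
  rewrite -lnM ?posrE //; apply: ln_le; first by rewrite lt_neqAle eq_sym nn.
  by apply: norm2_le => //; exact: size2_snd.
have lo : ln (size2 w) <= ln rho + logp (norm2 w).
  rewrite /size2; have [yr|ry] := leP (nc w.2) rho.
    by rewrite lerDl /logp le_max lexx orbT.
  have h : ln (nc w.2) <= logp (norm2 w).
    rewrite /logp le_max ln_le ?le_norm2_snd //; lra.
  lra.
rewrite ler_norml; lra.
Qed.

End Seq.
End Constants.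
End Orbit.

(** * Hölder continuity of the Green function *)

Section Holder.
Variable R : realType.
Implicit Types (x y b : R[i]) (P : {poly R[i]}) (z w : CC R).
Local Notation nc := (@ComplexField.Normc.normc R).
Variables (c C : R).
Hypotheses (c_gt0 : 0 < c) (c_le1 : c <= 1) (C_ge1 : 1 <= C).
Local Notation rho := (escape_radius c C).

(** A bound for all the degrees, as tameness implies [d <= C]. *)
Definition degree_cap : nat := (Num.truncn C).+1.

(** The factor by which one step can increase the distance of two points relative to
    the larger of their sizes ([dist_step]). *)
Definition stretch : R := 2 * C * (rho ^+ degree_cap / c).

Fixpoint orb_bound (r : R) k : R :=
  if k is k'.+1 then C * orb_bound r k' ^+ degree_cap else r.

Fixpoint orb_lip (r : R) k : R :=
  if k is k'.+1 then (C * orb_bound r k' ^+ degree_cap + C) * orb_lip r k' else 1.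

Lemma orb_bound_ge1 r k : 1 <= r -> 1 <= orb_bound r k.
Proof.
move=> r1; elim: k => //= k IH.
by rewrite -[1]mulr1 ler_pM ?ler01 // exprn_ege1.
Qed.

Lemma orb_lip_ge1 r k : 1 <= r -> 1 <= orb_lip r k.
Proof.
move=> r1; elim: k => //= k IH; rewrite -[1]mulr1 ler_pM ?ler01 //.
have : 0 <= C * orb_bound r k ^+ degree_cap.
  rewrite mulr_ge0 ?exprn_ge0 ?(le_trans ler01) //; exact: orb_bound_ge1.
have := C_ge1; lra.
Qed.

Lemma rho_ge1 : 1 <= rho.
Proof. by have := rho_ge12 c_gt0 c_le1 C_ge1; lra. Qed.

Lemma stretch_ge2 : 2 <= stretch.
Proof.
have h : 1 <= rho ^+ degree_cap / c.
  by rewrite ler_pdivlMr // mul1r (le_trans c_le1) // exprn_ege1 // rho_ge1.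
have h2 : 1 <= C * (rho ^+ degree_cap / c) by rewrite -[1]mulr1 ler_pM.
by rewrite /stretch -mulrA; lra.
Qed.

Section Step.
Variables (d : nat) (P : {poly R[i]}) (b : R[i]).
Hypothesis T : tame c C d P b.

Lemma tame_degree_cap : (d <= degree_cap)%N.
Proof.
have C0 : 0 <= C by rewrite (le_trans ler01).
have /andP[_ h] := truncn_itv C0.
by rewrite /degree_cap -(ler_nat R) (le_trans (tame_deg T)) // ltW.
Qed.

(** The converse of [size2_up]: for small $y$ the $d$-th power of the size is bounded
    by a constant, and sizes are at least 1. *)
Lemma size2_pow_le z : in_W c C z ->
  size2 c C z ^+ d <= rho ^+ degree_cap / c * size2 c C (henon1 P b z).
Proof.
have r1 := rho_ge1.
have rN : 1 <= rho ^+ degree_cap by rewrite exprn_ege1.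
move=> hW; have s1 := size2_ge1 c_gt0 c_le1 C_ge1 (henon1 P b z).
have [hr|hr] := leP rho (nc z.2).
  have := size2_low T hW hr; rewrite mulrAC -mulrA.
  rewrite -ler_pdivlMl // mulrC => h; apply: (le_trans h).
  by rewrite mulrA ler_wpM2r ?invr_ge0 ?(ltW c_gt0) // ler_peMl // (le_trans ler01).
have -> : size2 c C z = rho by rewrite /size2 max_r // ltW.
apply: (@le_trans _ _ (rho ^+ degree_cap)).
  by rewrite ler_weXn2l // tame_degree_cap.
rewrite -mulrA ler_peMr ?(le_trans ler01) // mulrC ler_pdivlMr // mul1r.
exact: le_trans c_le1 s1.
Qed.

Lemma dist_step z w (t : R) : in_W c C z -> in_W c C w ->
  nc (z.1 - w.1) <= t * Num.max (size2 c C z) (size2 c C w) ->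
  nc (z.2 - w.2) <= t * Num.max (size2 c C z) (size2 c C w) ->
  nc (P.[z.2] - b * z.1 - (P.[w.2] - b * w.1)) <=
  stretch * t * Num.max (size2 c C (henon1 P b z)) (size2 c C (henon1 P b w)).
Proof.
move=> Wz Ww; set mu := Num.max (size2 c C z) _; set mu' := Num.max _ _ => h1 h2.
have mu1 : 1 <= mu by rewrite le_max size2_ge1.
have mu0 : 0 <= mu by rewrite (le_trans ler01).
have C0 : 0 <= C by rewrite (le_trans ler01).
have t0 : 0 <= t.
  have := le_trans (nc_ge0 _) h1; rewrite pmulr_lge0 //; exact: lt_le_trans mu1.
have mud : mu ^+ d <= rho ^+ degree_cap / c * mu'.
  have rc : 0 <= rho ^+ degree_cap / c.
    by rewrite divr_ge0 ?(ltW c_gt0) // exprn_ge0 // (le_trans ler01 rho_ge1).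
  rewrite /mu; have [_|_] := leP (size2 c C z) (size2 c C w).
    apply: (le_trans (size2_pow_le Ww)).
    by rewrite ler_wpM2l // /mu' le_max lexx orbT.
  apply: (le_trans (size2_pow_le Wz)).
  by rewrite ler_wpM2l // /mu' le_max lexx.
have -> : P.[z.2] - b * z.1 - (P.[w.2] - b * w.1) =
   (P.[z.2] - P.[w.2]) - b * (z.1 - w.1) by ring.
apply: (le_trans (ncB _ _)); rewrite ncM.
have hz : nc z.2 <= mu by rewrite (le_trans (size2_snd c C z)) // le_max lexx.
have hw : nc w.2 <= mu by rewrite (le_trans (size2_snd c C w)) // le_max lexx orbT.
have e1 := tame_lip T mu1 hz hw.
have e2 : C * mu ^+ d.-1 * nc (z.2 - w.2) <= C * t * mu ^+ d.
  have -> : C * t * mu ^+ d = C * mu ^+ d.-1 * (t * mu).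
    by rewrite -{1}(prednK (ltnW (tame_gt1 T))) exprS; ring.
  by rewrite ler_wpM2l // mulr_ge0 // exprn_ge0.
have e3 : nc b * nc (z.1 - w.1) <= C * (t * mu ^+ d).
  rewrite ler_pM ?nc_ge0 ?(tame_b T) //; apply: (le_trans h1).
  rewrite ler_wpM2l // -{1}[mu]expr1 ler_weXn2l // ltnW //; exact: tame_gt1 T.
have e4 : 2 * C * t * mu ^+ d <= 2 * C * t * (rho ^+ degree_cap / c * mu').
  by rewrite ler_wpM2l // !mulr_ge0.
have -> : stretch * t * mu' = 2 * C * t * (rho ^+ degree_cap / c * mu').
  by rewrite /stretch; ring.
apply: le_trans e4; rewrite !mulrA in e3 *; lra.
Qed.

Lemma henon1_bound z r : 1 <= r -> nc z.1 <= r -> nc z.2 <= r ->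
  nc (henon1 P b z).1 <= C * r ^+ degree_cap /\
  nc (henon1 P b z).2 <= C * r ^+ degree_cap.
Proof.
move=> r1 h1 h2; have r0 : 0 <= r := le_trans ler01 r1.
have hd : r ^+ d <= r ^+ degree_cap by rewrite ler_weXn2l // tame_degree_cap.
have C0 : 0 <= C by rewrite (le_trans ler01).
split => /=; last by rewrite (le_trans (tame_up T r1 h1 h2)) // ler_wpM2l.
apply: (le_trans h2); rewrite -[leLHS]mul1r ler_pM //.
by rewrite -{1}[r]expr1 ler_weXn2l.
Qed.

Lemma henon1_lip z w r t : 1 <= r -> nc z.1 <= r -> nc z.2 <= r ->
  nc w.1 <= r -> nc w.2 <= r -> nc (z.1 - w.1) <= t -> nc (z.2 - w.2) <= t ->
  nc ((henon1 P b z).1 - (henon1 P b w).1) <= (C * r ^+ degree_cap + C) * t /\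
  nc ((henon1 P b z).2 - (henon1 P b w).2) <= (C * r ^+ degree_cap + C) * t.
Proof.
move=> r1 z1 z2 w1 w2 t1 t2; have r0 : 0 <= r := le_trans ler01 r1.
have t0 : 0 <= t := le_trans (nc_ge0 _) t1.
have C0 : 0 <= C by rewrite (le_trans ler01).
have X0 : 0 <= C * r ^+ degree_cap by rewrite mulr_ge0 ?exprn_ge0.
split => /=.
  by apply: (le_trans t2); rewrite ler_peMl //; have := C_ge1; lra.
have -> : P.[z.2] - b * z.1 - (P.[w.2] - b * w.1) =
   (P.[z.2] - P.[w.2]) - b * (z.1 - w.1) by ring.
apply: (le_trans (ncB _ _)); rewrite ncM mulrDl; apply: lerD; last first.
  by rewrite ler_pM ?nc_ge0 // (tame_b T).
apply: (le_trans (tame_lip T r1 z2 w2)).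
rewrite ler_pM ?nc_ge0 ?mulr_ge0 ?exprn_ge0 // ler_wpM2l // ler_weXn2l //.
by rewrite (leq_trans (leq_pred _)) // tame_degree_cap.
Qed.

End Step.

Lemma size2_dist z w : `|size2 c C z - size2 c C w| <= nc (z.2 - w.2).
Proof.
apply: le_trans (nc_dist _ _); rewrite /size2.
have [h1|h1] := leP (nc z.2) rho; have [h2|h2] := leP (nc w.2) rho.
- by rewrite subrr normr0.
- rewrite ler_norml !ler_normr; apply/andP; split; last by apply/orP; right; lra.
  by rewrite lerNl ler_normr; apply/orP; right; lra.
- rewrite ler_norml; apply/andP; split; last by rewrite ler_normr; apply/orP; left; lra.
  by rewrite lerNl ler_normr; apply/orP; left; lra.
- by [].
Qed.

Lemma ln_size2_dist z w (t : R) : t <= 1 / 2 ->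
  nc (z.2 - w.2) <= t * Num.max (size2 c C z) (size2 c C w) ->
  `|ln (size2 c C z) - ln (size2 c C w)| <= 2 * t.
Proof.
have gt0 v : 0 < size2 c C v by apply: size2_gt0.
have key v v' : t <= 1 / 2 -> size2 c C v' <= size2 c C v ->
    nc (v.2 - v'.2) <= t * size2 c C v ->
    `|ln (size2 c C v) - ln (size2 c C v')| <= 2 * t.
  move=> t2 hv hd; have s0 := gt0 v; have s0' := gt0 v'.
  have hs := le_trans (ler_norm _) (le_trans (size2_dist v v') hd).
  have ts : t * size2 c C v <= 1 / 2 * size2 c C v by rewrite ler_wpM2r // ltW.
  have t0 : 0 <= t by have := le_trans (nc_ge0 _) hd; rewrite pmulr_lge0.
  have tt : t * size2 c C v <= t * (2 * size2 c C v').
    by rewrite ler_wpM2l //; lra.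
  rewrite ger0_norm; last by rewrite subr_ge0 ln_le.
  rewrite -ln_div ?posrE //.
  have -> : size2 c C v / size2 c C v' = 1 + (size2 c C v - size2 c C v') / size2 c C v'.
    by field; rewrite gt_eqF.
  have q : (size2 c C v - size2 c C v') / size2 c C v' <= 2 * t.
    by rewrite ler_pdivrMr //; lra.
  apply: le_trans q; apply: le_ln1Dx; apply: (@lt_le_trans _ _ 0); first by lra.
  by rewrite divr_ge0 ?(ltW s0') // subr_ge0.
move=> t2; have [h|h] := leP (size2 c C z) (size2 c C w) => hd.
  by rewrite distrC; apply: key => //; rewrite ncB_sym.
by apply: key => //; exact: ltW.
Qed.

Section Seq.
Variables (d : nat -> nat) (P : nat -> {poly R[i]}) (b : nat -> R[i]).
Hypothesis T : forall k, tame c C (d k) (P k) (b k).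
Local Notation o := (orb P b).
Local Notation D := (degprod R d).
Local Notation green := (green c C d P b).
Local Notation potential := (potential c C d P b).

Lemma orb_bounded r z k : 1 <= r -> nc z.1 <= r -> nc z.2 <= r ->
  nc (o k z).1 <= orb_bound r k /\ nc (o k z).2 <= orb_bound r k.
Proof.
move=> r1 h1 h2; elim: k => [|k [IH1 IH2]] //.
exact: (henon1_bound (T k) (orb_bound_ge1 k r1) IH1 IH2).
Qed.

Lemma orb_lipschitz r t z w k : 1 <= r -> nc z.1 <= r -> nc z.2 <= r ->
  nc w.1 <= r -> nc w.2 <= r -> nc (z.1 - w.1) <= t -> nc (z.2 - w.2) <= t ->
  nc ((o k z).1 - (o k w).1) <= orb_lip r k * t /\
  nc ((o k z).2 - (o k w).2) <= orb_lip r k * t.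
Proof.
move=> r1 z1 z2 w1 w2 t1 t2; elim: k => [|k [IH1 IH2]]; first by rewrite /= !mul1r.
have [a1 a2] := orb_bounded k r1 z1 z2; have [b1 b2] := orb_bounded k r1 w1 w2.
have := henon1_lip (T k) (orb_bound_ge1 k r1) a1 a2 b1 b2 IH1 IH2.
by rewrite mulrA.
Qed.

Lemma orb_stretch z w k0 t : in_W c C (o k0 z) -> in_W c C (o k0 w) -> 0 <= t ->
  nc ((o k0 z).1 - (o k0 w).1) <= t -> nc ((o k0 z).2 - (o k0 w).2) <= t ->
  forall j, let mu := Num.max (size2 c C (o (k0 + j) z)) (size2 c C (o (k0 + j) w)) in
  nc ((o (k0 + j) z).1 - (o (k0 + j) w).1) <= stretch ^+ j * t * mu /\
  nc ((o (k0 + j) z).2 - (o (k0 + j) w).2) <= stretch ^+ j * t * mu.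
Proof.
move=> Wz Ww t0 h1 h2; elim=> [|j /= [IH1 IH2]].
  rewrite /= addn0 expr0 mul1r.
  have mu1 : 1 <= Num.max (size2 c C (o k0 z)) (size2 c C (o k0 w)).
    by rewrite le_max size2_ge1.
  by split; [apply: (le_trans h1)|apply: (le_trans h2)]; rewrite ler_peMr.
have Wzj := in_W_orb c_gt0 c_le1 C_ge1 T Wz (leq_addr j k0).
have Wwj := in_W_orb c_gt0 c_le1 C_ge1 T Ww (leq_addr j k0).
have -> : stretch ^+ j.+1 * t = stretch * (stretch ^+ j * t) by rewrite exprS mulrA.
rewrite addnS; split; last exact: (dist_step (T _) Wzj Wwj IH1 IH2).
have sz := size2_step c_gt0 c_le1 C_ge1 (T (k0 + j)) Wzj.
have sw := size2_step c_gt0 c_le1 C_ge1 (T (k0 + j)) Wwj.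
apply: (le_trans IH2) => /=.
have tj : 0 <= stretch ^+ j * t.
  by rewrite mulr_ge0 // exprn_ge0 //; have := stretch_ge2; lra.
apply: ler_pM => //; first by rewrite le_max ltW // size2_gt0.
  by rewrite ler_peMl //; have := stretch_ge2; lra.
rewrite ge_max; apply/andP; split.
  by apply: (le_trans sz); rewrite le_max lexx.
by apply: (le_trans sw); rewrite le_max lexx orbT.
Qed.

Lemma green_dist z w k0 t j : in_W c C (o k0 z) -> in_W c C (o k0 w) -> 0 <= t ->
  nc ((o k0 z).1 - (o k0 w).1) <= t -> nc ((o k0 z).2 - (o k0 w).2) <= t ->
  stretch ^+ j * t <= 1 / 2 ->
  `|green z - green w| <= (2 * osc_bound c C + 1) / 2 ^+ j.
Proof.
move=> Wz Ww t0 h1 h2 hj.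
have [_ hd] := orb_stretch Wz Ww t0 h1 h2 j.
have hln := ln_size2_dist hj hd.
have hp : `|potential (k0 + j) z - potential (k0 + j) w| <= 1 / 2 ^+ (k0 + j).
  apply: le_trans (div_degprod_le T _ _); last by lra.
  have D0 := degprod_gt0 T (k0 + j).
  rewrite /potential -mulrBl normrM [X in _ * X]ger0_norm ?invr_ge0 ?(ltW D0) //.
  rewrite ler_wpM2r ?invr_ge0 ?(ltW D0) //; lra.
have osc0 := osc_bound_ge0 c_gt0 c_le1 C_ge1.
have hz := potential_rate c_gt0 c_le1 C_ge1 T Wz (leq_addr j k0).
have hw := potential_rate c_gt0 c_le1 C_ge1 T Ww (leq_addr j k0).
have h2j : (2 * osc_bound c C + 1) / 2 ^+ (k0 + j) <= (2 * osc_bound c C + 1) / 2 ^+ j.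
  rewrite ler_wpM2l ?lef_pV2 ?posrE ?exprn_gt0 //; first by lra.
  by rewrite ler_weXn2l ?leq_addl // ler1n.
apply: le_trans h2j.
have -> : green z - green w = (green z - potential (k0 + j) z) +
  (potential (k0 + j) z - potential (k0 + j) w) - (green w - potential (k0 + j) w) by ring.
apply: (le_trans (ler_normB _ _)); have := ler_normD (green z - potential (k0 + j) z)
  (potential (k0 + j) z - potential (k0 + j) w).
rewrite mulrDl; lra.
Qed.

(** A bound that is uniform over all sequences of tame steps; it settles the Hölder
    inequality for points whose orbits are already far apart. *)
Lemma green_le r z k0 : 1 <= r -> r <= 2 ^+ k0 -> nc z.1 <= r -> nc z.2 <= r ->
  green z <= ln (Num.max (orb_bound r k0) rho) + osc_bound c C.
Proof.
move=> r1 rk h1 h2; have osc0 := osc_bound_ge0 c_gt0 c_le1 C_ge1.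
have Wz := orb_in_W c_gt0 c_le1 C_ge1 T (le_trans h1 rk) (leqnn k0).
have := potential_rate c_gt0 c_le1 C_ge1 T Wz (leqnn k0).
move=> /(le_trans (ler_norm _)).
have [_ hb] := orb_bounded k0 r1 h1 h2.
have hs : ln (size2 c C (o k0 z)) <= ln (Num.max (orb_bound r k0) rho).
  apply: ln_le; first exact: size2_gt0.
  by rewrite /size2 ge_max !le_max hb lexx orbT.
have l0 : 0 <= ln (size2 c C (o k0 z)) by rewrite ln_ge0 // size2_ge1.
have le1 (A : R) : 0 <= A -> A / 2 ^+ k0 <= A.
  by move=> A0; rewrite ler_pdivrMr ?exprn_gt0 // ler_peMr // exprn_ege1 // ler1n.
have hp : potential k0 z <= ln (size2 c C (o k0 z)).
  exact: le_trans (div_degprod_le T _ l0) (le1 _ l0).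
have := le1 _ osc0; lra.
Qed.

End Seq.

(** The last index for which [green_dist] applies. *)
Lemma stretch_index t : 0 < t -> t <= 1 / 2 ->
  exists j, stretch ^+ j * t <= 1 / 2 < stretch ^+ j.+1 * t.
Proof.
move=> t0 t2; have s2 := stretch_ge2.
have [k0 hk] := pow2_small 1 t0.
have ex : exists j, 1 / 2 < stretch ^+ j.+1 * t.
  exists k0; have := hk k0 (leqnn _); rewrite ltr_pdivrMr ?exprn_gt0 // => h.
  have : (2 : R) ^+ k0 <= stretch ^+ k0.+1.
    apply: (@le_trans _ _ (2 ^+ k0.+1)); first by rewrite ler_weXn2l // ler1n.
    by rewrite lerXn2r ?nnegrE //; lra.
  move=> h3; have : 2 ^+ k0 * t <= stretch ^+ k0.+1 * t by rewrite ler_wpM2r // ltW.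
  rewrite mulrC; lra.
exists (ex_minn ex); case: ex_minnP => [[|j] -> hmin]; rewrite andbT.
  by rewrite expr0 mul1r.
by rewrite leNgt; apply/negP => /hmin; rewrite ltnn.
Qed.

(** Two orbits may be compared for as many steps [j] as their relative distance,
    multiplied by at most a constant at each step, stays small; what follows
    contributes only a multiple of $2^{-j}$.  Choosing the largest such [j] trades
    the exponential separation against this exponential gain. *)
Lemma green_holder r : exists tau A : R, [/\ 0 < tau, 0 < A &
  forall (d : nat -> nat) (P : nat -> {poly R[i]}) (b : nat -> R[i]),
  (forall k, tame c C (d k) (P k) (b k)) ->
  forall z w t, nc z.1 <= r -> nc z.2 <= r -> nc w.1 <= r -> nc w.2 <= r ->
  0 < t -> nc (z.1 - w.1) <= t -> nc (z.2 - w.2) <= t ->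
  `|green c C d P b z - green c C d P b w| <= A * t `^ tau].
Proof.
pose r1 := Num.max r 1; have r1_1 : 1 <= r1 by rewrite le_max lexx orbT.
have rr1 : r <= r1 by rewrite le_max lexx.
have [k0 /(_ k0 (leqnn _))] := @pow2_small R r1 1 ltr01.
rewrite ltr_pdivrMr ?exprn_gt0 // mul1r => /ltW rk.
have s2 := stretch_ge2; have s0 : 0 < stretch by lra.
have lns : 0 < ln stretch by rewrite ln_gt0 //; lra.
have ln2 : 0 < ln 2 :> R by rewrite ln_gt0 // ltr1n.
(* This exponent turns the ratio [stretch] of distances into the ratio 2 of errors. *)
pose tau := ln 2 / ln stretch; have tau0 : 0 < tau by rewrite divr_gt0.
have osc0 := osc_bound_ge0 c_gt0 c_le1 C_ge1.
pose K := 2 * (2 * osc_bound c C + 1) +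
  (ln (Num.max (orb_bound r1 k0) rho) + osc_bound c C).
have lnm : 0 <= ln (Num.max (orb_bound r1 k0) rho).
  by rewrite ln_ge0 // le_max orb_bound_ge1.
pose L := 2 * orb_lip r1 k0.
have L0 : 0 < L by have := orb_lip_ge1 k0 r1_1; rewrite /L; lra.
exists tau, (K * L `^ tau); split => //.
  by rewrite mulr_gt0 ?powR_gt0 // /K; lra.
move=> d P b T z w t z1 z2 w1 w2 t0 h1 h2.
have {}z1 := le_trans z1 rr1; have {}z2 := le_trans z2 rr1.
have {}w1 := le_trans w1 rr1; have {}w2 := le_trans w2 rr1.
rewrite -mulrA -powRM ?(ltW L0) ?(ltW t0) //.
have [e1 e2] := orb_lipschitz T k0 r1_1 z1 z2 w1 w2 h1 h2.
set t' := orb_lip r1 k0 * t in e1 e2.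
have -> : L * t = 2 * t' by rewrite /L /t' mulrA.
have t'0 : 0 < t' by rewrite mulr_gt0 // (lt_le_trans ltr01) // orb_lip_ge1.
have [tbig|tsmall] := ltP (1 / 2) t'.
  have p1 : 1 <= (2 * t') `^ tau.
    apply: (@le_trans _ _ (1 `^ tau)); first by rewrite powR1.
    rewrite ge0_ler_powR ?nnegrE ?(ltW tau0) //; lra.
  have gz := green_le T r1_1 rk z1 z2; have gw := green_le T r1_1 rk w1 w2.
  have gz0 := green_ge0 c_gt0 c_le1 C_ge1 T z.
  have gw0 := green_ge0 c_gt0 c_le1 C_ge1 T w.
  have : K <= K * (2 * t') `^ tau by rewrite ler_peMr // /K; lra.
  by rewrite ler_norml {1}/K; lra.
have [j /andP[j1 j2]] := stretch_index t'0 tsmall.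
have Wz := orb_in_W c_gt0 c_le1 C_ge1 T (le_trans z1 rk) (leqnn k0).
have Ww := orb_in_W c_gt0 c_le1 C_ge1 T (le_trans w1 rk) (leqnn k0).
apply: (le_trans (green_dist T Wz Ww (ltW t'0) e1 e2 j1)).
have pj : 1 / 2 ^+ j.+1 <= (2 * t') `^ tau.
  have -> : 1 / 2 ^+ j.+1 = (1 / stretch ^+ j.+1) `^ tau.
    rewrite -[LHS]lnK ?posrE ?divr_gt0 ?exprn_gt0 //.
    rewrite -[RHS]lnK ?posrE ?powR_gt0 ?divr_gt0 ?exprn_gt0 //.
    rewrite ln_powR !ln_div ?posrE ?exprn_gt0 // ln1 !lnXn // !sub0r mulrN.
    by rewrite /tau mulrnAr divfK // gt_eqF.
  rewrite ge0_ler_powR ?nnegrE ?(ltW tau0) ?divr_ge0 ?exprn_ge0 ?(ltW s0) //.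
    by rewrite mulr_ge0 // ltW.
  rewrite ler_pdivrMr ?exprn_gt0 //; lra.
have -> : (2 * osc_bound c C + 1) / 2 ^+ j =
   2 * (2 * osc_bound c C + 1) * (1 / 2 ^+ j.+1).
  by rewrite exprS; field; rewrite expf_neq0.
apply: ler_pM => //; rewrite ?divr_ge0 ?exprn_ge0 //; first by lra.
by rewrite /K; lra.
Qed.

End Holder.

(** * Submean inequalities over circles *)

Section Submean.
Variable R : realType.
Implicit Types (z w : R[i]) (r t e : R).
Local Notation nc := (@ComplexField.Normc.normc R).

Definition cis t : R[i] := (cos t +i* sin t)%C.

Lemma cisD s t : cis (s + t) = cis s * cis t.
Proof. by apply/eqP; rewrite eq_complex /= cosD sinD eqxx /= addrC. Qed.

Lemma cis0 : cis 0 = 1.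
Proof. by rewrite /cis cos0 sin0. Qed.

Lemma cis_pi : cis pi = -1.
Proof. by rewrite /cis cospi sinpi; apply/eqP; rewrite eq_complex /= oppr0 !eqxx. Qed.

Lemma nc_cis t : nc (cis t) = 1.
Proof. by rewrite /= cos2Dsin2 sqrtr1. Qed.

Definition dyadic_angle k j : R := 2 * pi * j%:R / 2 ^+ k.

Lemma dyadic_angle_half k j : cis (dyadic_angle k.+1 j) ^+ 2 = cis (dyadic_angle k j).
Proof.
rewrite expr2 -cisD; congr cis; rewrite /dyadic_angle exprS; field.
by rewrite expf_neq0.
Qed.

Lemma dyadic_angle_opp k j :
  cis (dyadic_angle k.+1 (2 ^ k + j)) = - cis (dyadic_angle k.+1 j).
Proof.
rewrite -mulN1r -cis_pi -cisD; congr cis.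
by rewrite /dyadic_angle natrD natrX exprS; field; rewrite expf_neq0.
Qed.

(** Pairing opposite roots of unity, $(A-Bw)(A+Bw)=A^2-B^2w^2$, turns the product
    over the roots of order $2^{k+1}$ into the one of order $2^k$. *)
Lemma prod_dyadic k (A B : R[i]) :
  \prod_(j < 2 ^ k) (A - B * cis (dyadic_angle k j)) = A ^+ (2 ^ k) - B ^+ (2 ^ k).
Proof.
elim: k A B => [|k IH] A B.
  by rewrite expn0 big_ord1 /dyadic_angle mulr0 mul0r cis0 mulr1 !expr1.
rewrite expnS mul2n -addnn big_split_ord /= -big_split /=.
rewrite addnn -mul2n !exprM -IH; apply: eq_bigr => j _.
rewrite dyadic_angle_opp -(dyadic_angle_half k); ring.
Qed.

Definition circle_mean k (h : R[i] -> R) z r : R :=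
  (\sum_(j < 2 ^ k) h (z + r%:C%C * cis (dyadic_angle k j))) / 2 ^+ k.

Lemma le_circle_mean k (h g : R[i] -> R) z r e :
  (forall t, h (z + r%:C%C * cis t) <= g (z + r%:C%C * cis t) + e) ->
  circle_mean k h z r <= circle_mean k g z r + e.
Proof.
move=> hg; have p0 : 0 < (2 : R) ^+ k by rewrite exprn_gt0.
rewrite /circle_mean ler_pdivrMr // mulrDl divfK ?gt_eqF //.
apply: le_trans (_ : _ <= \sum_(j < 2 ^ k)
    (g (z + r%:C%C * cis (dyadic_angle k j)) + e)) _; first by apply: ler_sum.
by rewrite big_split /= sumr_const card_ord -[e *+ _]mulr_natr natrX.
Qed.

Lemma pow_dyadic_small (q : R) : 0 <= q -> q < 1 ->
  exists k0, forall k, (k0 <= k)%N -> q ^+ (2 ^ k) <= 1 / 2.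
Proof.
move=> q0 q1; have qn : `|q| < 1 by rewrite ger0_norm.
have h2 : 0 < 1 / 2 :> R by rewrite divr_gt0.
have [k0 _ h] := proj1 (cvg_distP eventually_filter _ _) (cvg_expr qn) _ h2.
exists k0 => k hk; have := h (2 ^ k)%N (leq_trans hk (ltnW (ltn_expl k (ltnSn 1)))).
by rewrite /= subr0 ger0_norm ?exprn_ge0 // => /ltW.
Qed.

(** By [prod_dyadic] the product on the right is $|a^n - (-r)^n|$ with $n = 2^k$ and
    $|a| \ne r$, which is at least half of $\max(|a|,r)^n$ for large $n$. *)
Lemma root_factor_mean z (rho : R[i]) r : 0 < r -> nc (z - rho) != r ->
  exists k0, forall k, (k0 <= k)%N -> nc (z - rho) ^+ (2 ^ k) <=
    2 * \prod_(j < 2 ^ k) nc (z + r%:C%C * cis (dyadic_angle k j) - rho).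
Proof.
move=> r0 ar; set a := nc (z - rho) in ar *.
have a0 : 0 <= a by exact: nc_ge0.
have prodE k : \prod_(j < 2 ^ k) nc (z + r%:C%C * cis (dyadic_angle k j) - rho) =
    nc ((z - rho) ^+ (2 ^ k) - (- r%:C%C) ^+ (2 ^ k)).
  rewrite -prod_dyadic (big_morph nc (@ncM R) (nc1 R)).
  by apply: eq_bigr => j _; congr nc; ring.
have nr k : nc ((- r%:C%C) ^+ (2 ^ k)) = r ^+ (2 ^ k).
  by rewrite ncX ncN nc_real gtr0_norm.
have [ra|ar'] := ltP r a.
  have q0 : 0 <= r / a by rewrite divr_ge0 // ltW.
  have q1 : r / a < 1 by rewrite ltr_pdivrMr ?mul1r // (lt_trans r0).
  have [k0 hk0] := pow_dyadic_small q0 q1; exists k0 => k hk; rewrite prodE.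
  have := ncB_ge ((z - rho) ^+ (2 ^ k)) ((- r%:C%C) ^+ (2 ^ k)).
  rewrite nr ncX -/a; have := hk0 k hk.
  have an0 : 0 < a ^+ (2 ^ k) by rewrite exprn_gt0 // (lt_trans r0).
  rewrite expr_div_n ler_pdivrMr //; lra.
have {ar ar'} ar : a < r by rewrite lt_neqAle ar.
have q0 : 0 <= a / r by rewrite divr_ge0 // ltW.
have q1 : a / r < 1 by rewrite ltr_pdivrMr ?mul1r.
have [k0 hk0] := pow_dyadic_small q0 q1; exists k0 => k hk; rewrite prodE.
have := ncB_ge ((- r%:C%C) ^+ (2 ^ k)) ((z - rho) ^+ (2 ^ k)).
rewrite nr ncB_sym ncX -/a; have := hk0 k hk.
have rn0 : 0 < r ^+ (2 ^ k) by rewrite exprn_gt0.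
have an0 : 0 <= a ^+ (2 ^ k) by rewrite exprn_ge0.
rewrite expr_div_n ler_pdivrMr //; lra.
Qed.

Lemma roots_mean z (s : seq R[i]) r : 0 < r -> {in s, forall rho, nc (z - rho) != r} ->
  exists k0, forall k, (k0 <= k)%N ->
    nc (\prod_(rho <- s) (z - rho)) ^+ (2 ^ k) <=
    2 ^+ size s * \prod_(j < 2 ^ k)
      nc (\prod_(rho <- s) (z + r%:C%C * cis (dyadic_angle k j) - rho)).
Proof.
move=> r0; elim: s => [|rho s IH] hs.
  exists 0%N => k _; rewrite big_nil nc1 expr1n expr0 mul1r big1 // => j _.
  by rewrite big_nil nc1.
have [k1 h1] := root_factor_mean r0 (hs rho (mem_head _ _)).
have [k2 h2] := IH (fun x xs => hs x (mem_behead (s := rho :: s) xs)).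
exists (maxn k1 k2) => k; rewrite geq_max => /andP[/h1 {}h1 /h2 {}h2].
rewrite big_cons ncM exprMn exprS.
under [X in _ <= _ * X]eq_bigr do rewrite big_cons ncM.
rewrite big_split /= mulrACA; apply: ler_pM => //; rewrite exprn_ge0 ?nc_ge0 //.
Qed.

Lemma avoid_seq (s : seq R) (u v : R) : u < v ->
  exists x, [/\ u < x, x < v & x \notin s].
Proof.
move=> uv; suff [u' [v' [h1 h2 h3 h4]]] : exists u' v', [/\ u <= u', u' < v', v' <= v &
    forall x, x \in s -> ~~ (u' < x < v')].
  exists ((u' + v') / 2); split; try lra.
  apply/negP => /h4; rewrite negb_and -!leNgt => /orP[]; lra.
elim: s => [|x s [u' [v' [h1 h2 h3 h4]]]]; first by exists u, v.
have [/andP[hx1 hx2]|hx] := boolP (u' < x < v').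
  exists x, v'; split => //; first lra.
  move=> y; rewrite inE => /orP[/eqP->|ys]; first by rewrite ltxx.
  by apply: contra (h4 y ys) => /andP[/(lt_trans hx1) -> ->].
exists u', v'; split => // y; rewrite inE => /orP[/eqP->//|]; exact: h4.
Qed.

(** The radius is perturbed so that no zero of the polynomial lies on the circle. *)
Lemma log_max_submean (Q : {poly R[i]}) (B : R) z r e : 0 < B -> 0 < r -> 0 < e ->
  exists r', [/\ r < r', r' < r + e & exists k0, forall k, (k0 <= k)%N ->
    ln (Num.max (nc Q.[z]) B) <=
    circle_mean k (fun w => ln (Num.max (nc Q.[w]) B)) z r' + e].
Proof.
move=> B0 r0 e0; have [QB|BQ] := leP (nc Q.[z]) B.
  exists (r + e / 2); split; try lra; exists 0%N => k _.
  have p0 : 0 < (2 : R) ^+ k by rewrite exprn_gt0.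
  rewrite -lerBlDr ler_pdivlMr //.
  apply: (@le_trans _ _ (\sum_(j < 2 ^ k) ln B)).
    rewrite sumr_const card_ord -[ln B *+ _]mulr_natr natrX ler_wpM2r ?(ltW p0) //; lra.
  by apply: ler_sum => j _; apply: ln_le => //; rewrite le_max lexx orbT.
have [s Qs] := closed_field_poly_normal Q.
have Qv w : Q.[w] = lead_coef Q * \prod_(rho <- s) (w - rho).
  rewrite {1}Qs hornerZ horner_prod; congr (_ * _).
  by apply: eq_bigr => x _; rewrite hornerXsubC.
have [r' [h1 h2 hr']] := @avoid_seq [seq nc (z - rho) | rho <- s] r (r + e) ltac:(lra).
have hs : {in s, forall rho, nc (z - rho) != r'}.
  by move=> x xs; apply: contra hr' => /eqP <-; apply/mapP; exists x.
have r'0 : 0 < r' by lra.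
exists r'; split => //.
have [k1 hk1] := roots_mean r'0 hs.
have [k2 hk2] := pow2_small ((size s)%:R * ln 2) e0.
exists (maxn k1 k2) => k; rewrite geq_max => /andP[/hk1 {}hk1 /hk2 {}hk2].
have p0 : 0 < (2 : R) ^+ k by rewrite exprn_gt0.
have Q0 : 0 < nc Q.[z] by rewrite (lt_trans B0).
have m0 w : 0 < Num.max (nc Q.[w]) B by rewrite lt_max B0 orbT.
have key : nc Q.[z] ^+ (2 ^ k) <= 2 ^+ size s * \prod_(j < 2 ^ k)
    Num.max (nc Q.[z + r'%:C%C * cis (dyadic_angle k j)]) B.
  apply: (@le_trans _ _ (2 ^+ size s * \prod_(j < 2 ^ k)
    nc Q.[z + r'%:C%C * cis (dyadic_angle k j)])); last first.
    rewrite ler_wpM2l ?exprn_ge0 //; apply: ler_prod => j _.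
    by rewrite nc_ge0 le_max lexx.
  rewrite Qv ncM exprMn.
  under [X in _ <= _ * X]eq_bigr do rewrite Qv ncM.
  by rewrite big_split /= prodr_const card_ord mulrCA ler_wpM2l // exprn_ge0 // nc_ge0.
have pm0 : 0 < \prod_(j < 2 ^ k) Num.max (nc Q.[z + r'%:C%C * cis (dyadic_angle k j)]) B.
  by apply: prodr_gt0 => j _.
have lnprod : ln (\prod_(j < 2 ^ k) Num.max (nc Q.[z + r'%:C%C * cis (dyadic_angle k j)]) B)
  = \sum_(j < 2 ^ k) ln (Num.max (nc Q.[z + r'%:C%C * cis (dyadic_angle k j)]) B).
  suff [_ ->] : 0 < \prod_(j < 2 ^ k) Num.max (nc Q.[z + r'%:C%C * cis (dyadic_angle k j)]) B
    /\ ln (\prod_(j < 2 ^ k) Num.max (nc Q.[z + r'%:C%C * cis (dyadic_angle k j)]) B)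
    = \sum_(j < 2 ^ k) ln (Num.max (nc Q.[z + r'%:C%C * cis (dyadic_angle k j)]) B) by [].
  elim/big_rec2: _ => [|j y1 y2 _ [y10 IH]]; first by rewrite ln1.
  by rewrite mulr_gt0 // lnM ?posrE // IH.
have := ln_le (exprn_gt0 (2 ^ k) Q0) key.
have -> : ln (nc Q.[z] ^+ (2 ^ k)) = 2 ^+ k * ln (nc Q.[z]).
  by rewrite lnXn // -[LHS]mulr_natl natrX.
rewrite lnM ?posrE ?exprn_gt0 // lnprod (lnXn _ (ltr0Sn _ 1)) -[ln 2 *+ _]mulr_natl => h.
move: hk2; rewrite ltr_pdivrMr // => hk2.
rewrite /circle_mean -(@ler_pM2l _ (2 ^+ k)) // mulrDr mulrCA divff ?gt_eqF // mulr1.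
lra.
Qed.

(** Uniformity on discs serves to compare means over nearby circles, and Riemann sums
    with integrals. *)
Definition disc_unif_cont (h : R[i] -> R) : Prop := forall r e, 0 < e -> exists2 dl, 0 < dl &
  forall w w', nc w <= r -> nc w' <= r -> nc (w - w') <= dl -> `|h w - h w'| <= e.

(** The submean inequality up to [e], with the mean over the $2^k$-th roots of unity
    for large [k]; the freedom in the radius is that of [log_max_submean]. *)
Definition dyadic_submean (h : R[i] -> R) : Prop := forall z r e, 0 < r -> 0 < e ->
  exists r', [/\ r < r', r' < r + e & exists k0, forall k, (k0 <= k)%N ->
    h z <= circle_mean k h z r' + e].

Lemma cos_lip s t : `|cos s - cos t| <= `|s - t|.
Proof.
wlog st : s t / s <= t.
  move=> H; have [/H//|/ltW/H] := leP s t.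
  by rewrite distrC [in X in _ <= X]distrC.
have [x _ hx] := MVT_segment st (fun x _ => is_derive_cos x)
  (continuous_subspaceT (@continuous_cos R)).
by rewrite distrC hx normrM normrN [in X in _ <= X]distrC ler_piMl // sin_max.
Qed.

Lemma sin_lip s t : `|sin s - sin t| <= `|s - t|.
Proof.
wlog st : s t / s <= t.
  move=> H; have [/H//|/ltW/H] := leP s t.
  by rewrite distrC [in X in _ <= X]distrC.
have [x _ hx] := MVT_segment st (fun x _ => is_derive_sin x)
  (continuous_subspaceT (@continuous_sin R)).
by rewrite distrC hx normrM [in X in _ <= X]distrC ler_piMl // cos_max.
Qed.

Lemma cis_lip s t : nc (cis s - cis t) <= 2 * `|s - t|.
Proof.
apply: (le_trans (nc_le_ReIm _)) => /=.
have := cos_lip s t; have := sin_lip s t; lra.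
Qed.

Lemma circle_continuous z r : 0 < r -> continuous (fun t => z + r%:C%C * cis t).
Proof.
move=> r0 t; apply/(cvg_ncP (nbhs_filter t)) => e2 e20.
have e30 : 0 < r^-1 * (2^-1 * e2) by rewrite !mulr_gt0 ?invr_gt0.
apply: filterS (proj1 (cvg_distP (nbhs_filter t) id t) cvg_id _ e30) => t' h1; rewrite opprD addrACA subrr add0r -mulrBr ncM nc_real gtr0_norm //.
move: h1; rewrite ltr_pdivlMl // ltr_pdivlMl // => h; apply: le_lt_trans h; rewrite mulrCA ler_pM2l //.
exact: cis_lip.
Qed.

Lemma riemann_sum_le (f : R -> R) (dl e : R) n : continuous f -> 0 <= dl ->
  (forall j t, (j < n)%N -> j%:R * dl <= t <= j.+1%:R * dl -> f (j%:R * dl) <= f t + e) ->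
  \sum_(j < n) (f (j%:R * dl) - e) * dl <=
  \int[lebesgue_measure]_(t in `[0, n%:R * dl]) f t.
Proof.
move=> cf dl0.
have itg (g : R -> R) u v : continuous g -> lebesgue_measure.-integrable `[u, v] (EFin \o g).
  move=> cg; apply: continuous_compact_integrable; first exact: segment_compact.
  exact: continuous_subspaceT.
have itgo (g : R -> R) u v : continuous g -> lebesgue_measure.-integrable `]u, v] (EFin \o g).
  move=> cg; apply: (integrableS _ _ _ (itg g u v cg)); try exact: measurable_itv.
  by apply: subset_itvr; rewrite bnd_simp.
elim: n => [|n IH] h.
  by rewrite big_ord0 mul0r set_itv1 Rintegral_set1.
rewrite big_ord_recr /=.
have nn : n%:R * dl <= n.+1%:R * dl by rewrite ler_wpM2r // ler_nat.
have n0 : 0 <= n%:R * dl by rewrite mulr_ge0.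
have := @Rintegral_itvB R f (BLeft 0) (BRight (n.+1%:R * dl)) (n%:R * dl) (itg _ _ _ cf).
rewrite !bnd_simp => /(_ n0 nn) /eqP; rewrite subr_eq => /eqP ->.
rewrite addrC lerD //; last first.
  by apply: IH => j t jn; apply: h; exact: ltnW.
have mI : measurable (`](n%:R * dl), (n.+1%:R * dl)] : set R) by exact: measurable_itv.
have -> : (f (n%:R * dl) - e) * dl =
    \int[lebesgue_measure]_(t in `](n%:R * dl), (n.+1%:R * dl)]) (f (n%:R * dl) - e).
  rewrite Rintegral_cst //; congr (_ * _).
  rewrite /= lebesgue_measure_itv /= lte_fin.
  case: ltP => hlt; first by rewrite -EFinD /= -mulrBl -natrB // subSnn mul1r.
  apply/eqP; rewrite /= eq_le dl0 andbT; move: hlt; rewrite -natr1 mulrDl mul1r; lra.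
apply: le_Rintegral => //.
- by apply: itgo => ?; exact: cvg_cst.
- exact: itgo.
- move=> t; rewrite /= in_itv /= => /andP[t1 t2].
  by rewrite lerBlDr; apply: h => //; rewrite (ltW t1) t2.
Qed.

(** Continuity replaces the radius of the dyadic mean by the given one and the mean,
    a Riemann sum, by the integral. *)
Lemma dyadic_submean_integral (h : R[i] -> R) z r : disc_unif_cont h -> continuous h -> dyadic_submean h -> 0 < r ->
  2 * pi * h z <= \int[lebesgue_measure]_(t in `[0%R, (2 * pi)%R])
    h (z + r%:C%C * cis t).
Proof.
move=> lh ch dh r0; have pi0 : 0 < pi :> R := pi_gt0 R.
apply/ler_addgt0Pr => e0 e00.
(* Three errors [e] over an interval of length [2 * pi]. *)
pose e := e0 / (6 * pi); have e0' : 0 < e by rewrite divr_gt0 // mulr_gt0.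
have [dl dl0 hdl] := lh (nc z + r + 1) e e0'.
pose e1 := Num.min e (Num.min dl 1).
have e10 : 0 < e1 by rewrite !lt_min e0' dl0 ltr01.
have [r' [r1 r2 [k1 hk1]]] := dh z r e1 r0 e10.
have rr' : r' - r <= dl /\ r' - r <= 1.
  have : r' - r < e1 by lra.
  by rewrite !lt_min => /and3P[_ /ltW -> /ltW ->].
have [k2 hk2] := pow2_small (2 * pi * 2 * r) dl0.
pose k := maxn k1 k2.
have {}hk1 := hk1 k (leq_maxl _ _); have {}hk2 := hk2 k (leq_maxr _ _).
have p0 : 0 < (2 : R) ^+ k by rewrite exprn_gt0.
have e1e : e1 <= e by rewrite ge_min lexx.
pose f t := h (z + r%:C%C * cis t).
have bd u t : 0 < u -> u <= r + 1 -> nc (z + u%:C%C * cis t) <= nc z + r + 1.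
  move=> u0 u1; apply: (le_trans (ncD _ _)).
  by rewrite ncM nc_cis mulr1 nc_real gtr0_norm //; lra.
have cf : continuous f.
  move=> t; apply: (@continuous_comp _ _ _ (fun t => z + r%:C%C * cis t) h).
    exact: circle_continuous.
  exact: ch.
pose step : R := 2 * pi / 2 ^+ k.
have st0 : 0 < step by rewrite divr_gt0 // mulr_gt0.
have angE j : dyadic_angle k j = j%:R * step.
  by rewrite /dyadic_angle /step; field; rewrite gt_eqF.
have R1 := @riemann_sum_le f step e (2 ^ k) cf (ltW st0).
have total : (2 ^ k)%:R * step = 2 * pi.
  by rewrite natrX /step; field; rewrite gt_eqF.
rewrite total in R1.
have osc j t : (j < 2 ^ k)%N -> j%:R * step <= t <= j.+1%:R * step ->
    f (j%:R * step) <= f t + e.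
  move=> _ /andP[t1 t2]; rewrite -lerBlDl; apply: (le_trans (ler_norm _)).
  apply: hdl; try (apply: bd => //; lra).
  rewrite opprD addrACA subrr add0r -mulrBr ncM nc_real gtr0_norm //.
  apply: (le_trans (ler_wpM2l (ltW r0) (cis_lip _ _))).
  have d1 : `|j%:R * step - t| <= step.
    by rewrite distrC ger0_norm; move: t2; rewrite -natr1 mulrDl mul1r; lra.
  have : r * (2 * `|j%:R * step - t|) <= r * (2 * step).
    by rewrite ler_pM2l // ler_pM2l.
  move: hk2; rewrite /step; lra.
have {}R1 := R1 osc.
have S1 : circle_mean k h z r' * 2 ^+ k <= \sum_(j < 2 ^ k) (f (j%:R * step) + e).
  rewrite /circle_mean divfK ?gt_eqF //; apply: ler_sum => j _; rewrite angE /f.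
  rewrite -lerBlDl; apply: (le_trans (ler_norm _)); apply: hdl.
  - by apply: bd; lra.
  - by apply: bd; lra.
  rewrite opprD addrACA subrr add0r -mulrBl -rmorphB ncM nc_cis mulr1 nc_real.
  by rewrite gtr0_norm; lra.
have E1 : \sum_(j < 2 ^ k) (f (j%:R * step) + e) =
   \sum_(j < 2 ^ k) f (j%:R * step) + 2 ^+ k * e.
  by rewrite big_split /= sumr_const card_ord -[e *+ _]mulr_natl natrX.
have E2 : \sum_(j < 2 ^ k) (f (j%:R * step) - e) * step =
   (\sum_(j < 2 ^ k) f (j%:R * step)) * step - 2 * pi * e.
  rewrite -mulr_suml big_split /= sumr_const card_ord -[_ *+ _]mulr_natl natrX.
  by rewrite mulrDl mulrN mulNr mulrAC -natrX total.
rewrite E1 in S1; rewrite E2 in R1.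
set S := \sum_(j < 2 ^ k) f (j%:R * step) in S1 R1.
have : 2 * pi * h z <= 2 * pi * (circle_mean k h z r' + e).
  by rewrite ler_pM2l ?mulr_gt0 //; lra.
have : circle_mean k h z r' * 2 ^+ k * step <= (S + 2 ^+ k * e) * step.
  by rewrite ler_pM2r.
have -> : circle_mean k h z r' * 2 ^+ k * step = 2 * pi * circle_mean k h z r'.
  by rewrite /step; field; rewrite gt_eqF.
have -> : (S + 2 ^+ k * e) * step = S * step + 2 * pi * e.
  by rewrite /step; field; rewrite gt_eqF.
have -> : e0 = 6 * pi * e by rewrite /e mulrC divfK // gt_eqF // mulr_gt0.
rewrite -/f; lra.
Qed.

Lemma continuous_usc (X : topologicalType) (h : X -> R) : continuous h ->
  upper_semicontinuous (EFin \o h).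
Proof.
move=> ch z a; rewrite /= lte_fin => az.
have lt0 : 0 < - h z - a by lra.
exists [set w | `|h w - h z| < - h z - a].
  exact: (proj1 (cvg_distP (nbhs_filter z) h (h z)) (ch z) _ lt0).
by move=> w /= ; rewrite ltr_norml lte_fin => /andP[_]; lra.
Qed.

Lemma disc_unif_cont_continuous (h : R[i] -> R) : disc_unif_cont h -> continuous h.
Proof.
move=> lh z; apply/(cvg_distP (nbhs_filter z)) => e e0.
have e2 : 0 < e / 2 by rewrite divr_gt0.
have [dl dl0 hdl] := lh (nc z + 1) _ e2.
apply/nbhs_ncP; exists (Num.min dl 1); first by rewrite lt_min dl0 ltr01.
move=> w; rewrite lt_min => /andP[w1 w2].
have wz : nc w <= nc z + 1.
  by rewrite -[w](subrK z) addrC (le_trans (ncD _ _)) // lerD2l ltW.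
apply: (@le_lt_trans _ _ (e / 2)); last lra.
by apply: hdl => //; [rewrite lerDl|exact: ltW].
Qed.

Lemma dyadic_submean_subharmonic (h : R[i] -> R) : disc_unif_cont h -> dyadic_submean h -> subharmonic (EFin \o h).
Proof.
move=> lh dh; have ch := disc_unif_cont_continuous lh.
split=> [z||z r r0]; [by rewrite ltry|exact: continuous_usc|].
have cf : continuous (fun t => h (z + r%:C%C * cis t)).
  move=> t; apply: (@continuous_comp _ _ _ (fun t => z + r%:C%C * cis t) h).
    exact: circle_continuous.
  exact: ch.
have pi0 : 0 < pi :> R := pi_gt0 R.
have := dyadic_submean_integral z lh ch dh r0.
have itg : lebesgue_measure.-integrable `[0, 2 * pi]
    (EFin \o (fun t => h (z + r%:C%C * cis t))).
  apply: continuous_compact_integrable; first exact: segment_compact.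
  exact: continuous_subspaceT.
have fin : (\int[lebesgue_measure]_(t in `[0%R, (2 * pi)%R])
    (h (z + r%:C%C * cis t)%R)%:E)%E \is a fin_num.
  by apply: integrable_fin_num => //.
rewrite /Rintegral => hh; rewrite /= -(fineK fin) -EFinM lee_fin ler_pdivlMl ?mulr_gt0 //.
Qed.

End Submean.

(** * Real derivatives of complex expressions *)

Section Calculus.
Variable R : realType.
Implicit Types (f g : R -> R[i]) (t : R) (z w v : R[i]).
Local Notation nc := (@ComplexField.Normc.normc R).

(** Stated by components, [R[i]] being a normed space over itself and not over [R]. *)
Definition cderiv f t z : Prop :=
  is_derive t 1 (fun s => complex.Re (f s)) (complex.Re z) /\
  is_derive t 1 (fun s => complex.Im (f s)) (complex.Im z).

Lemma is_derive_eq' (h : R -> R) t (l l' : R) : is_derive t 1 h l -> l = l' ->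
  is_derive t 1 h l'.
Proof. by move=> + <-. Qed.

Lemma deriveD_fun (f g : R -> R) t (a b : R) : is_derive t 1 f a ->
  is_derive t 1 g b -> is_derive t 1 (fun s => f s + g s) (a + b).
Proof. by move=> hf hg; exact: is_deriveD. Qed.

Lemma deriveN_fun (f : R -> R) t (a : R) : is_derive t 1 f a ->
  is_derive t 1 (fun s => - f s) (- a).
Proof. by move=> hf; exact: is_deriveN. Qed.

Lemma deriveM_fun (f g : R -> R) t (a b : R) : is_derive t 1 f a ->
  is_derive t 1 g b -> is_derive t 1 (fun s => f s * g s) (a * g t + f t * b).
Proof.
move=> hf hg; apply: (is_derive_eq' (is_deriveM hf hg)).
by rewrite /GRing.scale /= addrC (mulrC a).
Qed.

Lemma deriveV_fun (f : R -> R) t (a : R) : f t != 0 -> is_derive t 1 f a ->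
  is_derive t 1 (fun s => (f s)^-1) (- (a / f t ^+ 2)).
Proof.
move=> f0 hf; apply: (is_derive_eq' (is_deriveV f0 hf)).
by rewrite /GRing.scale /= mulNr mulrC.
Qed.

Lemma deriveln_fun (f : R -> R) t (a : R) : 0 < f t -> is_derive t 1 f a ->
  is_derive t 1 (fun s => ln (f s)) (a / f t).
Proof.
move=> f0 hf; have hln : is_derive (f t) 1 (@ln R) (f t)^-1 by exact: is_derive1_ln.
apply: (is_derive_eq' (is_derive1_comp hln hf)).
by rewrite mulrC.
Qed.

Lemma derive_cst_fun (c t : R) : is_derive t 1 (fun=> c) 0.
Proof. exact: is_derive_cst. Qed.

Lemma cderiv_cst z t : cderiv (fun=> z) t 0.
Proof. by split; exact: is_derive_cst. Qed.

Lemma cderiv_line z v t : cderiv (fun s => z + s%:C%C * v) t v.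
Proof.
have did : is_derive t 1 (fun s : R => s) 1 by exact: is_derive_id.
case: z v => [z1 z2] [v1 v2]; split => /=.
  have h := deriveD_fun (derive_cst_fun z1 t)
    (deriveD_fun (deriveM_fun did (derive_cst_fun v1 t)) (derive_cst_fun (- (0 * v2)) t)).
  by apply: (is_derive_eq' h); rewrite mulr0 !addr0 add0r mul1r.
have h := deriveD_fun (derive_cst_fun z2 t)
  (deriveD_fun (deriveM_fun did (derive_cst_fun v2 t)) (derive_cst_fun (0 * v1) t)).
by apply: (is_derive_eq' h); rewrite mulr0 !addr0 add0r mul1r.
Qed.

Lemma cderivD f g t z w : cderiv f t z -> cderiv g t w ->
  cderiv (fun s => f s + g s) t (z + w).
Proof.
move=> [f1 f2] [g1 g2]; split.
  have -> : (fun s => complex.Re (f s + g s)) =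
     (fun s => complex.Re (f s)) + (fun s => complex.Re (g s)).
    by apply/funext => s; rewrite raddfD.
  by rewrite raddfD; exact: is_deriveD.
have -> : (fun s => complex.Im (f s + g s)) =
   (fun s => complex.Im (f s)) + (fun s => complex.Im (g s)).
  by apply/funext => s; rewrite raddfD.
by rewrite raddfD; exact: is_deriveD.
Qed.

Lemma cReM z w : complex.Re (z * w) =
  complex.Re z * complex.Re w - complex.Im z * complex.Im w.
Proof. by case: z w => [? ?] [? ?]. Qed.

Lemma cImM z w : complex.Im (z * w) =
  complex.Re z * complex.Im w + complex.Im z * complex.Re w.
Proof. by case: z w => [? ?] [? ?]. Qed.

Lemma cderivM f g t z w : cderiv f t z -> cderiv g t w ->
  cderiv (fun s => f s * g s) t (z * g t + f t * w).
Proof.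
move=> [f1 f2] [g1 g2]; split.
  under eq_fun do rewrite cReM.
  apply: (is_derive_eq' (deriveD_fun (deriveM_fun f1 g1) (deriveN_fun (deriveM_fun f2 g2)))).
  rewrite (raddfD (@complex.Re R)) /= !cReM; ring.
under eq_fun do rewrite cImM.
apply: (is_derive_eq' (deriveD_fun (deriveM_fun f1 g2) (deriveM_fun f2 g1))).
rewrite (raddfD (@complex.Im R)) /= !cImM; ring.
Qed.

Lemma cderivZ f t z w : cderiv f t z -> cderiv (fun s => w * f s) t (w * z).
Proof.
by move=> hf; have := cderivM (cderiv_cst w t) hf; rewrite mul0r add0r.
Qed.

Lemma cderivB f g t z w : cderiv f t z -> cderiv g t w ->
  cderiv (fun s => f s - g s) t (z - w).
Proof.
move=> hf hg; have := cderivD hf (cderivZ (-1) hg); rewrite mulN1r.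
by under eq_fun do rewrite mulN1r.
Qed.

Lemma cderiv_horner (p : {poly R[i]}) f t z : cderiv f t z ->
  cderiv (fun s => p.[f s]) t (p^`().[f t] * z).
Proof.
move=> hf; elim/poly_ind: p => [|p a IH].
  rewrite deriv0 horner0 mul0r; under eq_fun do rewrite horner0.
  exact: cderiv_cst.
rewrite derivD derivC addr0 derivM derivX mulr1.
have := cderivD (cderivM IH hf) (cderiv_cst a t); rewrite addr0.
have -> : (fun s => p.[f s] * f s + a) = (fun s => (p * 'X + a%:P).[f s]).
  by apply/funext => s; rewrite hornerMXaddC.
by rewrite hornerD hornerMX mulrDl mulrAC.
Qed.

Lemma cReV z : complex.Re z^-1 = complex.Re z / (complex.Re z ^+ 2 + complex.Im z ^+ 2).
Proof. by case: z. Qed.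

Lemma cImV z : complex.Im z^-1 = - (complex.Im z / (complex.Re z ^+ 2 + complex.Im z ^+ 2)).
Proof. by case: z. Qed.

Lemma sqr_ReIm_neq0 z : z != 0 -> complex.Re z ^+ 2 + complex.Im z ^+ 2 != 0.
Proof. by move=> z0; rewrite -nc_sqr sqrf_eq0 nc_eq0. Qed.

Lemma ln_nc z : ln (nc z) = 2^-1 * ln (complex.Re z ^+ 2 + complex.Im z ^+ 2).
Proof.
rewrite -nc_sqr; have [->|z0] := eqVneq z 0.
  by rewrite nc0 expr0n /= ln0 // mulr0.
by rewrite lnXn ?nc_gt0 // -[ln _ *+ 2]mulr_natl mulrA mulVf ?mul1r // pnatr_eq0.
Qed.

(** The real part of the logarithmic derivative, without a choice of logarithm:
    $\log|f|$ is half the logarithm of a sum of two squares. *)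
Lemma is_derive_ln_nc f t z : cderiv f t z -> f t != 0 ->
  is_derive t 1 (fun s => ln (nc (f s))) (complex.Re (z / f t)).
Proof.
move=> [f1 f2] f0; have N0 := sqr_ReIm_neq0 f0.
have Np : 0 < complex.Re (f t) ^+ 2 + complex.Im (f t) ^+ 2.
  by rewrite lt_neqAle eq_sym N0 addr_ge0 ?sqr_ge0.
under eq_fun do rewrite ln_nc !expr2.
rewrite !expr2 in Np.
have dsum := deriveD_fun (deriveM_fun f1 f1) (deriveM_fun f2 f2).
have hln := @deriveln_fun (fun s => complex.Re (f s) * complex.Re (f s) +
  complex.Im (f s) * complex.Im (f s)) t _ Np dsum.
apply: (is_derive_eq' (deriveM_fun (derive_cst_fun _ _) hln)).
by rewrite cReM cReV cImV -!expr2; field.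
Qed.

Lemma cderivV f t z : f t != 0 -> cderiv f t z ->
  cderiv (fun s => (f s)^-1) t (- (z / f t ^+ 2)).
Proof.
move=> f0 [f1 f2]; have N0 := sqr_ReIm_neq0 f0.
pose h s := complex.Re (f s) * complex.Re (f s) + complex.Im (f s) * complex.Im (f s).
have ht : h t = complex.Re (f t) ^+ 2 + complex.Im (f t) ^+ 2 by rewrite /h !expr2.
have h0 : h t != 0 by rewrite ht.
have dV := deriveV_fun h0 (deriveD_fun (deriveM_fun f1 f1) (deriveM_fun f2 f2)).
have e2 : f t ^- 2 = (f t)^-1 * (f t)^-1 by rewrite -exprVn expr2.
split.
  have -> : (fun s => complex.Re (f s)^-1) = (fun s => complex.Re (f s) * (h s)^-1).
    by apply/funext => s; rewrite cReV /h !expr2.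
  apply: (is_derive_eq' (deriveM_fun f1 dV)).
  rewrite e2 (raddfN (@complex.Re R)) /= !(cReM, cImM) !cReV !cImV ht; field; exact: N0.
have -> : (fun s => complex.Im (f s)^-1) = (fun s => - (complex.Im (f s) * (h s)^-1)).
  by apply/funext => s; rewrite cImV /h !expr2.
apply: (is_derive_eq' (deriveN_fun (deriveM_fun f2 dV))).
rewrite e2 (raddfN (@complex.Im R)) /= !(cReM, cImM) !cReV !cImV ht; field; exact: N0.
Qed.

Lemma is_derive_Re_div f g t z w (c : R) : cderiv f t z -> cderiv g t w -> g t != 0 ->
  is_derive t 1 (fun s => complex.Re (f s / g s) / c)
    (complex.Re (z / g t - f t * w / g t ^+ 2) / c).
Proof.
move=> hf hg g0; have [h1 _] := cderivM hf (cderivV g0 hg).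
apply: (is_derive_eq' (deriveM_fun h1 (derive_cst_fun c^-1 t))).
by rewrite mulr0 addr0 mulrN mulrA.
Qed.

(** A limit of differentiable functions whose derivatives converge uniformly: the
    mean value theorem is applied to each function before passing to the limit. *)
Lemma is_derive_limit (f f' : nat -> R -> R) (F F' : R -> R) (dl A : R) k0 : 0 < dl ->
  (forall k s, (k0 <= k)%N -> `|s| < dl -> is_derive s (1 : R) (f k) (f' k s)) ->
  (forall s, `|s| < dl -> (fun k => f k s) @ \oo --> F s) ->
  (forall k s, (k0 <= k)%N -> `|s| < dl -> `|F' s - f' k s| <= A / 2 ^+ k) ->
  (forall k, (k0 <= k)%N -> {for 0, continuous (f' k)}) ->
  is_derive (0 : R) (1 : R) F (F' 0).
Proof.
move=> dl0 hd hF hF' hc.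
suff hlim : (fun h => h^-1 *: ((F \o shift 0) (h *: (1 : R)) - F 0)) @ 0^' --> F' 0.
  by split; [exact: cvgP hlim|exact: (cvg_lim (@Rhausdorff R) hlim)].
apply/(cvg_distP _) => e e0.
have e4 : 0 < e / 5 by rewrite divr_gt0.
have [k1 hk1] := pow2_small A e4.
pose k := maxn k0 k1; have kk0 : (k0 <= k)%N := leq_maxl _ _.
have Ak := hk1 k (leq_maxr _ _).
have A0 : 0 <= A.
  have := le_trans (normr_ge0 _) (hF' k0 0 (leqnn _) _); rewrite normr0 => /(_ dl0).
  by rewrite pmulr_lge0 // invr_gt0 exprn_gt0.
have := proj1 (cvg_distP (nbhs_filter (0 : R)) _ _) (hc k kk0) _ e4.
rewrite -nbhs_nearE => /nbhs_ballP[d1 /= d10 hd1].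
rewrite near_withinE; apply/nbhs_ballP; exists (Num.min dl d1) => /=.
  by rewrite lt_min dl0.
move=> h; rewrite /ball /= sub0r normrN lt_min => /andP[hdl hd1'] h0.
rewrite /= addr0 /GRing.scale /= mulr1.
have h0' : 0 < `|h| by rewrite normr_gt0.
suff key : `|F h - F 0 - F' 0 * h| <= 4 * (e / 5) * `|h|.
  have -> : h^-1 * (F h - F 0) - F' 0 = h^-1 * (F h - F 0 - F' 0 * h) by field.
  rewrite normrM normfV mulrC ltr_pdivrMr //; apply: (le_lt_trans key).
  by rewrite ltr_pM2r //; lra.
have lim1 : (fun j => `|f j h - f j 0 - F' 0 * h|) @ \oo --> `|F h - F 0 - F' 0 * h|.
  apply: cvg_norm; apply: cvgB; last exact: cvg_cst.
  by apply: cvgB; apply: hF => //; rewrite normr0.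
rewrite -(cvg_lim (@Rhausdorff R) lim1); apply: limr_le; first exact: cvgP lim1.
exists k => // j /= kj.
have k0j : (k0 <= j)%N := leq_trans kk0 kj.
have [xi xih hxi] : exists2 xi, `|xi| <= `|h| & f j h - f j 0 = f' j xi * h.
  have dj s : `|s| <= `|h| -> is_derive s (1 : R) (f j) (f' j s).
    by move=> sh; apply: hd => //; exact: le_lt_trans hdl.
  have cj (u v' : R) : (forall s : R, u <= s <= v' -> `|s| <= `|h|) ->
      {within `[u, v'], continuous (f j)}.
    move=> huv; apply: derivable_within_continuous => s.
    rewrite in_itv /= => /huv sh; have [] := dj s sh; exact.
  have [h_gt0|h_lt0] := leP 0 h.
    have hh s : 0 <= s <= h -> `|s| <= `|h|.
      by move=> /andP[s0 sh]; rewrite !ger0_norm.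
    have dh s : s \in `]0, h[%R -> is_derive s (1 : R) (f j) (f' j s).
      rewrite in_itv /= => /andP[/ltW s0 /ltW sh].
      by apply: dj; apply: hh; rewrite s0.
    have [x xin hx] := MVT_segment h_gt0 dh (cj _ _ hh).
    exists x; last by rewrite hx subr0.
    by apply: hh; move: xin; rewrite in_itv.
  have hh s : h <= s <= 0 -> `|s| <= `|h|.
    by move=> /andP[sh s0]; rewrite !ler0_norm ?(ltW h_lt0) // lerN2.
  have dh s : s \in `]h, 0[%R -> is_derive s (1 : R) (f j) (f' j s).
    rewrite in_itv /= => /andP[/ltW s0 /ltW sh].
    by apply: dj; apply: hh; rewrite s0.
  have [x xin hx] := MVT_segment (ltW h_lt0) dh (cj _ _ hh).
  exists x; first by apply: hh; move: xin; rewrite in_itv.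
  by rewrite -[LHS]opprB hx sub0r mulrN opprK.
rewrite hxi -mulrBl normrM ler_wpM2r //.
have xdl : `|xi| < dl by exact: le_lt_trans hdl.
have A1 : A / 2 ^+ j <= A / 2 ^+ k.
  by rewrite ler_wpM2l // lef_pV2 ?posrE ?exprn_gt0 // ler_weXn2l // ler1n.
have b1 := hF' j xi k0j xdl; have b2 := hF' k xi kk0 xdl.
have b3 := hF' k 0 kk0; rewrite normr0 in b3; have {}b3 := b3 dl0.
have b4 : `|f' k xi - f' k 0| < e / 5.
  by apply: hd1; rewrite /ball /= sub0r normrN; exact: le_lt_trans hd1'.
move: b1 b2 b3 b4; rewrite !ler_norml !ltr_norml => /andP[? ?] /andP[? ?] /andP[? ?] /andP[? ?].
apply/andP; split; lra.
Qed.

End Calculus.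

Section Pluriharmonic.
Variable R : realType.

Lemma line_continuous (V : normedModType R[i]) (z v : V) (s : R) :
  {for s, continuous (fun t : R => z + t%:C%C *: v)}.
Proof.
apply: cvgD; first exact: cvg_cst.
apply: cvgZr_tmp.
apply/(cvg_ncP (nbhs_filter s)) => e e0.
apply: filterS (proj1 (cvg_distP (nbhs_filter s) id s) cvg_id _ e0) => t.
by rewrite -rmorphB nc_real.
Qed.

Lemma near_line (V : normedModType R[i]) (U : set V) (z v : V) : open U -> U z ->
  \forall t \near (0 : R), U (z + t%:C%C *: v).
Proof.
move=> oU Uz; have := @line_continuous V z v 0.
rewrite /prop_for /continuous_at => /(_ U); apply.
by rewrite rmorph0 scale0r addr0; exact: open_nbhs_nbhs.
Qed.

Lemma derive_dir_val (V : normedModType R[i]) (v : V) (u : V -> R) z (l : R) :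
  is_derive (0 : R) 1 (fun t : R => u (z + t%:C%C *: v)) l ->
  derivable_dir v u z /\ derive_dir v u z = l.
Proof. by move=> [h1 h2]; split => //; rewrite /derive_dir derive1E. Qed.

(** [phi v] and [psi v w] are the directional derivatives, given as total functions, so
    that differentiability and continuity only have to be known on [U]. *)
Lemma class_C1_of_data (V : normedModType R[i]) (U : set V) (u : V -> R)
    (phi : V -> V -> R) : open U ->
  (forall v z, U z -> is_derive (0 : R) 1 (fun t : R => u (z + t%:C%C *: v)) (phi v z)) ->
  (forall v z, U z -> {for z, continuous (phi v)}) ->
  class_C1 U u.
Proof.
move=> oU hd hc v z Uz; have [h1 h2] := @derive_dir_val V v u z _ (hd v z Uz).
split; first exact: h1.
have Unear : \forall w \near z, derive_dir v u w = phi v w.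
  apply: filterS (open_nbhs_nbhs (conj oU Uz)) => w Uw.
  by have [] := @derive_dir_val V v u w _ (hd v w Uw).
rewrite /prop_for /continuous_at h2; apply: cvg_trans (hc v z Uz).
by apply: near_eq_cvg; apply: filterS Unear => w ->.
Qed.

Lemma is_derive_near_eq (f g : R -> R) (l : R) :
  (\forall t \near (0 : R), f t = g t) -> is_derive (0 : R) (1 : R) g l ->
  is_derive (0 : R) (1 : R) f l.
Proof.
by move=> fg hg; apply: near_eq_is_derive hg; apply: filterS fg => t ->.
Qed.

Lemma class_C2_of_data (V : normedModType R[i]) (U : set V) (u : V -> R)
    (phi : V -> V -> R) (psi : V -> V -> V -> R) : open U ->
  (forall v z, U z -> is_derive (0 : R) 1 (fun t : R => u (z + t%:C%C *: v)) (phi v z)) ->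
  (forall v z, U z -> {for z, continuous (phi v)}) ->
  (forall v w z, U z ->
     is_derive (0 : R) 1 (fun t : R => phi v (z + t%:C%C *: w)) (psi v w z)) ->
  (forall v w z, U z -> {for z, continuous (psi v w)}) ->
  class_C2 U u /\
  (forall v w z, U z -> derive_dir w (derive_dir v u) z = psi v w z).
Proof.
move=> oU hd hc hd2 hc2.
have hd2' v w z : U z ->
    is_derive (0 : R) 1 (fun t : R => derive_dir v u (z + t%:C%C *: w)) (psi v w z).
  move=> Uz; apply: is_derive_near_eq (hd2 v w z Uz).
  apply: filterS (near_line w oU Uz) => t Ut.
  by have [] := @derive_dir_val V v u _ _ (hd v _ Ut).
split; first split.
- exact: (@class_C1_of_data V U u phi oU hd hc).
- by move=> v; exact: (@class_C1_of_data V U (derive_dir v u) (psi v) oU (hd2' v) (hc2 v)).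
- by move=> v w z Uz; have [] := @derive_dir_val V w (derive_dir v u) z _ (hd2' v w z Uz).
Qed.

Lemma complex_line_continuous (V : normedModType R[i]) (a b : V) :
  continuous (fun w : R[i] => a + w *: b).
Proof.
move=> w; have Fw : Filter (nbhs w) := nbhs_filter w.
apply: (@cvgD _ _ _ (nbhs w) Fw (cst a) (fun w => w *: b)); first exact: cvg_cst.
by apply: cvgZr_tmp; exact: cvg_id.
Qed.

(** The second derivatives of a real part of a holomorphic function are the real
    parts of a complex bilinear form, so that those in the directions $v$ and $iv$
    cancel. *)
Lemma pluriharmonic_of_data (U : set (CC R)) (u : CC R -> R)
    (phi : CC R -> CC R -> R) (psi : CC R -> CC R -> CC R -> R) : open U ->
  (forall v z, U z -> is_derive (0 : R) 1 (fun t : R => u (z + t%:C%C *: v)) (phi v z)) ->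
  (forall v z, U z -> {for z, continuous (phi v)}) ->
  (forall v w z, U z ->
     is_derive (0 : R) 1 (fun t : R => phi v (z + t%:C%C *: w)) (psi v w z)) ->
  (forall v w z, U z -> {for z, continuous (psi v w)}) ->
  (forall v z, U z -> psi ('i%C *: v) ('i%C *: v) z = - psi v v z) ->
  pluriharmonic_on U u.
Proof.
move=> oU hd hc hd2 hc2 hi; split => //.
  by case: (@class_C2_of_data (CC R) U u phi psi oU hd hc hd2 hc2).
move=> a b; pose L (w : R[i]) := a + w *: b.
have Lline z v (t : R) : L (z + t%:C%C *: v) = L z + t%:C%C *: (v *: b).
  by rewrite /L scalerDl addrA scalerA.
have cL : continuous L := @complex_line_continuous _ a b.
have oU' : open [set w : R[i] | U (a + w *: b)].
  by apply: (open_comp (f := L)) => // w _; exact: cL.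
pose phi' (v z : R[i]) := phi (v *: b) (L z).
pose psi' (v w z : R[i]) := psi (v *: b) (w *: b) (L z).
pose U' : set R[i] := [set w : R[i] | U (a + w *: b)].
have A1 (v z : R[i]) : U' z ->
    is_derive (0 : R) 1 (fun t : R => (u \o L) (z + t%:C%C *: v)) (phi' v z).
  move=> Uz; have := hd (v *: b) (L z) Uz.
  by under [X in is_derive _ _ X]eq_fun do rewrite -Lline.
have A2 (v z : R[i]) : U' z -> {for z, continuous (phi' v)}.
  by move=> Uz; apply: (@continuous_comp _ _ _ L); [exact: cL|exact: hc].
have A3 (v w z : R[i]) : U' z ->
    is_derive (0 : R) 1 (fun t : R => phi' v (z + t%:C%C *: w)) (psi' v w z).
  move=> Uz; have := hd2 (v *: b) (w *: b) (L z) Uz.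
  by under [X in is_derive _ _ X]eq_fun do rewrite -Lline.
have A4 (v w z : R[i]) : U' z -> {for z, continuous (psi' v w)}.
  by move=> Uz; apply: (@continuous_comp _ _ _ L); [exact: cL|exact: hc2].
have [h1 h2] := @class_C2_of_data R[i] U' (u \o L) phi' psi' oU' A1 A2 A3 A4.
split; [exact: oU'|exact: h1|move=> z Uz].
rewrite (h2 1 1 z Uz) (h2 'i%C 'i%C z Uz) /psi' scale1r hi //; exact: subrr.
Qed.

End Pluriharmonic.

(** * Derivatives of orbits in the region of escape *)

Section OrbitDerivatives.
Variable R : realType.
Implicit Types (x y b : R[i]) (z v w q : CC R).
Local Notation nc := (@ComplexField.Normc.normc R).

(** The derivatives of the orbit with respect to the starting point: [dorb] is the
    first one, in the direction [v], and [ddorb] the second one, in the directions [v]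
    and [w].  The last argument of [ddorb] starts the recursion: it is 0 at time 0, but
    not after a shift of time. *)
Fixpoint dorb (P : nat -> {poly R[i]}) (b : nat -> R[i]) k z v : CC R :=
  if k is k'.+1 then
    let y := (orb P b k' z).2 in let u := dorb P b k' z v in
    (u.2, (P k')^`().[y] * u.2 - b k' * u.1)
  else v.

Fixpoint ddorb (P : nat -> {poly R[i]}) (b : nat -> R[i]) k z v w q : CC R :=
  if k is k'.+1 then
    let y := (orb P b k' z).2 in let u := ddorb P b k' z v w q in
    (u.2, (P k')^`()^`().[y] * (dorb P b k' z v).2 * (dorb P b k' z w).2 +
          (P k')^`().[y] * u.2 - b k' * u.1)
  else q.

Section Derive.
Variables (P : nat -> {poly R[i]}) (b : nat -> R[i]).
Local Notation o := (orb P b).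
Local Notation do := (dorb P b).
Local Notation ddo := (ddorb P b).

Lemma cderiv_orb z v k (t : R) :
  cderiv (fun s : R => (o k (z + s%:C%C *: v)).1) t (do k (z + t%:C%C *: v) v).1 /\
  cderiv (fun s : R => (o k (z + s%:C%C *: v)).2) t (do k (z + t%:C%C *: v) v).2.
Proof.
elim: k => [|k [IH1 IH2]]; first by split; exact: cderiv_line.
split; first exact: IH2.
apply: cderivB; last exact: cderivZ.
exact: cderiv_horner.
Qed.

Lemma cderiv_dorb z v w k (t : R) :
  cderiv (fun s : R => (do k (z + s%:C%C *: w) v).1) t
    (ddo k (z + t%:C%C *: w) v w 0).1 /\
  cderiv (fun s : R => (do k (z + s%:C%C *: w) v).2) t
    (ddo k (z + t%:C%C *: w) v w 0).2.
Proof.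
elim: k => [|k [IH1 IH2]]; first by split; exact: cderiv_cst.
split; first exact: IH2.
apply: cderivB; last exact: cderivZ.
have := cderivM (cderiv_horner (P k)^`() (cderiv_orb z w k t).2) IH2.
by rewrite mulrAC.
Qed.

Lemma scale_fst (a : R[i]) z : (a *: z).1 = a * z.1.
Proof. by []. Qed.

Lemma scale_snd (a : R[i]) z : (a *: z).2 = a * z.2.
Proof. by []. Qed.

Lemma scale_pair (a x y : R[i]) : a *: ((x, y) : CC R) = (a * x, a * y).
Proof. by []. Qed.

Lemma dorb_scale (a : R[i]) z v k : do k z (a *: v) = a *: do k z v.
Proof.
elim: k => //= k ->; rewrite scale_pair !scale_fst !scale_snd; congr (_, _).
ring.
Qed.

Lemma ddorb_scale (a a' : R[i]) z v w k :
  ddo k z (a *: v) (a' *: w) 0 = (a * a') *: ddo k z v w 0.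
Proof.
elim: k => [|k IH] /=; first by rewrite scaler0.
rewrite IH !dorb_scale scale_pair !scale_fst !scale_snd; congr (_, _).
ring.
Qed.

Definition log_approx (D : R) k z : R := ln (nc (o k z).2) / D.

Definition dlog_approx (D : R) k v z : R :=
  complex.Re ((do k z v).2 / (o k z).2) / D.

Definition ddlog_approx (D : R) k v w z : R :=
  complex.Re ((ddo k z v w 0).2 / (o k z).2 -
    (do k z v).2 * (do k z w).2 / (o k z).2 ^+ 2) / D.

Lemma is_derive_log_approx D k z v (t : R) : (o k (z + t%:C%C *: v)).2 != 0 ->
  is_derive t (1 : R) (fun s : R => log_approx D k (z + s%:C%C *: v))
    (dlog_approx D k v (z + t%:C%C *: v)).
Proof.
move=> h0; have h := is_derive_ln_nc (cderiv_orb z v k t).2 h0.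
apply: (is_derive_eq' (deriveM_fun h (derive_cst_fun D^-1 t))).
by rewrite mulr0 addr0.
Qed.

Lemma is_derive_dlog_approx D k z v w (t : R) : (o k (z + t%:C%C *: w)).2 != 0 ->
  is_derive t (1 : R) (fun s : R => dlog_approx D k v (z + s%:C%C *: w))
    (ddlog_approx D k v w (z + t%:C%C *: w)).
Proof.
exact: (is_derive_Re_div D (cderiv_dorb z v w k t).2 (cderiv_orb z w k t).2).
Qed.

(** Both terms are bilinear over the complex numbers, and $i \cdot i = -1$. *)
Lemma ddlog_approx_i D k v z :
  ddlog_approx D k ('i%C *: v) ('i%C *: v) z = - ddlog_approx D k v v z.
Proof.
rewrite /ddlog_approx ddorb_scale !dorb_scale !scale_snd.
set Q := (ddo k z v v 0).2; set V := (do k z v).2; set Y := (o k z).2.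
have -> : 'i%C * 'i%C * Q / Y - 'i%C * V * ('i%C * V) / Y ^+ 2 =
    - (Q / Y - V * V / Y ^+ 2).
  have ii : 'i%C * 'i%C = -1 :> R[i] by rewrite -expr2 sqr_i.
  have -> : 'i%C * V * ('i%C * V) = 'i%C * 'i%C * (V * V) by ring.
  by rewrite ii; ring.
by rewrite (raddfN (@complex.Re R)) /= mulNr.
Qed.

End Derive.

Section Continuity.
Context {T : Type} {F : set_system T} {FF : Filter F}.
Implicit Types (f g : T -> R[i]).

Lemma cvg_addc f g x y : f @ F --> x -> g @ F --> y -> (fun t => f t + g t) @ F --> x + y.
Proof.
move=> /cvg_ncP hf /cvg_ncP hg; apply/cvg_ncP => e e0.
have e2 : 0 < e / 2 by rewrite divr_gt0.
apply: filterS2 (hf _ e2) (hg _ e2) => t h1 h2.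
by rewrite opprD addrACA (le_lt_trans (ncD _ _)) // [e]splitr ltrD.
Qed.

Lemma cvg_mulc f g x y : f @ F --> x -> g @ F --> y -> (fun t => f t * g t) @ F --> x * y.
Proof.
move=> /cvg_ncP hf /cvg_ncP hg; apply/cvg_ncP => e e0.
have X0 : 0 < nc x + 1 by rewrite ltr_wpDl ?nc_ge0.
have Y0 : 0 < nc y + 1 by rewrite ltr_wpDl ?nc_ge0.
have e1 : 0 < e / 2 / (nc x + 1) by rewrite !divr_gt0.
have e2 : 0 < e / 2 / (nc y + 1) by rewrite !divr_gt0.
have f1 : \forall t \near F, nc (f t - x) < 1 /\ nc (f t - x) < e / 2 / (nc y + 1).
  by apply: filterS2 (hf _ ltr01) (hf _ e2) => t; split.
apply: filterS2 f1 (hg _ e1) => t [h1 h2] h3.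
have -> : f t * g t - x * y = f t * (g t - y) + y * (f t - x) by ring.
apply: (le_lt_trans (ncD _ _)); rewrite !ncM [e]splitr.
have fb : nc (f t) <= nc x + 1.
  by rewrite -[f t](subrK x) addrC (le_trans (ncD _ _)) // lerD2l ltW.
have t1 : nc (f t) * nc (g t - y) < e / 2.
  apply: (@le_lt_trans _ _ ((nc x + 1) * nc (g t - y))).
    by rewrite ler_wpM2r ?nc_ge0.
  by rewrite mulrC -ltr_pdivlMr.
have t2 : nc y * nc (f t - x) < e / 2.
  apply: (@le_lt_trans _ _ ((nc y + 1) * nc (f t - x))).
    by rewrite ler_wpM2r ?nc_ge0 // lerDl.
  by rewrite mulrC -ltr_pdivlMr.
exact: ltrD.
Qed.

Lemma cvg_oppc f x : f @ F --> x -> (fun t => - f t) @ F --> - x.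
Proof. by move=> hf; exact: cvgN. Qed.

Lemma cvg_subc f g x y : f @ F --> x -> g @ F --> y -> (fun t => f t - g t) @ F --> x - y.
Proof. by move=> hf hg; exact: cvg_addc hf (cvg_oppc hg). Qed.

Lemma cvg_invc f x : x != 0 -> f @ F --> x -> (fun t => (f t)^-1) @ F --> x^-1.
Proof. by move=> x0 hf; exact: cvgV. Qed.

Lemma cvg_cstc x : (fun=> x) @ F --> x.
Proof. exact: cvg_cst. Qed.

Lemma cvg_powc f x n : f @ F --> x -> (fun t => f t ^+ n) @ F --> x ^+ n.
Proof.
move=> hf; elim: n => [|n IH].
  by under eq_fun do rewrite expr0; rewrite expr0; exact: cvg_cstc.
by under eq_fun do rewrite exprS; rewrite exprS; exact: cvg_mulc.
Qed.

Lemma cvg_hornerc n (p : T -> {poly R[i]}) (p0 : {poly R[i]}) f y :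
  (forall t, (size (p t) <= n)%N) -> (size p0 <= n)%N ->
  (forall i, (fun t => (p t)`_i) @ F --> p0`_i) -> f @ F --> y ->
  (fun t => (p t).[f t]) @ F --> p0.[y].
Proof.
move=> sp sp0 hp hf; rewrite (horner_coef_wide _ sp0).
under eq_fun do rewrite (horner_coef_wide _ (sp _)).
elim: n {sp sp0} => [|n IH].
  have -> : (fun t => \sum_(i < 0) (p t)`_i * f t ^+ i) = (fun=> 0).
    by apply/funext => t; rewrite big_ord0.
  by rewrite big_ord0; exact: cvg_cstc.
have -> : (fun t => \sum_(i < n.+1) (p t)`_i * f t ^+ i) =
    (fun t => \sum_(i < n) (p t)`_i * f t ^+ i + (p t)`_n * f t ^+ n).
  by apply/funext => t; rewrite big_ord_recr.
rewrite big_ord_recr /=.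
have h := cvg_addc IH (cvg_mulc (hp n) (cvg_powc (n := n) hf)).
exact h.
Qed.

Lemma cvg_horner_cst (p : {poly R[i]}) f y : f @ F --> y ->
  (fun t => p.[f t]) @ F --> p.[y].
Proof.
move=> hf; apply: (@cvg_hornerc (size p) (fun=> p) p f y _ _ _ hf) => [t||i].
- exact: leqnn.
- exact: leqnn.
- exact: cvg_cstc.
Qed.

End Continuity.

Section OrbContinuous.
Variables (P : nat -> {poly R[i]}) (b : nat -> R[i]) (z0 : CC R).
Local Notation o := (orb P b).
Local Notation do := (dorb P b).
Local Notation ddo := (ddorb P b).

Let Fz : Filter (nbhs z0) := nbhs_filter z0.
Local Notation addz := (@cvg_addc (CC R) (nbhs z0) Fz _ _ _ _).
Local Notation subz := (@cvg_subc (CC R) (nbhs z0) Fz _ _ _ _).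
Local Notation mulz := (@cvg_mulc (CC R) (nbhs z0) Fz _ _ _ _).
Local Notation invz := (@cvg_invc (CC R) (nbhs z0) Fz _ _).
Local Notation cstz x := (@cvg_cstc (CC R) (nbhs z0) Fz x).
Local Notation powz n := (@cvg_powc (CC R) (nbhs z0) Fz _ _ n).
Local Notation hornerz p := (@cvg_horner_cst (CC R) (nbhs z0) Fz p _ _).

Lemma cvg_orb k : ((fun z => (o k z).1) @ z0 --> (o k z0).1) /\
  ((fun z => (o k z).2) @ z0 --> (o k z0).2).
Proof.
elim: k => [|k [IH1 IH2]]; first by split; [exact: cvg_fst|exact: cvg_snd].
split; first exact: IH2.
have h := subz (hornerz (P k) IH2) (mulz (cstz (b k)) IH1).
exact h.
Qed.

Lemma cvg_dorb k v : ((fun z => (do k z v).1) @ z0 --> (do k z0 v).1) /\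
  ((fun z => (do k z v).2) @ z0 --> (do k z0 v).2).
Proof.
elim: k => [|k [IH1 IH2]]; first by split; exact: (cstz _).
split; first exact: IH2.
have ho := hornerz (P k)^`() (cvg_orb k).2.
have h := subz (mulz ho IH2) (mulz (cstz (b k)) IH1).
exact h.
Qed.

Lemma cvg_ddorb k v w : ((fun z => (ddo k z v w 0).1) @ z0 --> (ddo k z0 v w 0).1) /\
  ((fun z => (ddo k z v w 0).2) @ z0 --> (ddo k z0 v w 0).2).
Proof.
have ho j := (cvg_orb j).2; have hd j u := (cvg_dorb j u).2.
elim: k => [|k [IH1 IH2]]; first by split; exact: (cstz _).
split; first exact: IH2.
have h1 := mulz (mulz (hornerz (P k)^`()^`() (ho k)) (hd k v)) (hd k w).
have h2 := mulz (hornerz ((P k)^`()) (ho k)) IH2.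
have h := subz (addz h1 h2) (mulz (cstz (b k)) IH1).
exact h.
Qed.

Lemma cvg_Re (f : CC R -> R[i]) x : f @ z0 --> x ->
  (fun z => complex.Re (f z)) @ z0 --> complex.Re x.
Proof. by move=> hf; apply: (continuous_cvg _ (@continuous_Re R x)). Qed.

Lemma continuous_dlog_approx D k v : (o k z0).2 != 0 ->
  {for z0, continuous (dlog_approx P b D k v)}.
Proof.
move=> h0; apply: (@cvgM _ _ _ Fz); last exact: cvg_cst.
apply: cvg_Re.
have h := mulz (cvg_dorb k v).2 (invz h0 (cvg_orb k).2).
exact h.
Qed.

Lemma continuous_ddlog_approx D k v w : (o k z0).2 != 0 ->
  {for z0, continuous (ddlog_approx P b D k v w)}.
Proof.
move=> h0; have ho := (cvg_orb k).2; have hd u := (cvg_dorb k u).2.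
apply: (@cvgM _ _ _ Fz); last exact: cvg_cst.
apply: cvg_Re; have h02 : (o k z0).2 ^+ 2 != 0 by rewrite expf_neq0.
have h := subz (mulz (cvg_ddorb k v w).2 (invz h0 ho))
  (mulz (mulz (hd v) (hd w)) (invz h02 (powz 2%N ho))).
exact h.
Qed.

End OrbContinuous.

Section Constants.
Variables (c C : R).
Hypotheses (c_gt0 : 0 < c) (c_le1 : c <= 1) (C_ge1 : 1 <= C).
Local Notation rho := (escape_radius c C).

(** The region of escape, where the leading term dominates and every step expands. *)
Definition in_V z : bool := (nc z.1 <= nc z.2) && (rho <= nc z.2).

Section Step.
Variables (d : nat) (P : {poly R[i]}) (b : R[i]).
Hypothesis T : tame c C d P b.
Variable z : CC R.
Hypothesis Vz : in_V z.
Local Notation y := z.2.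
Local Notation y' := (henon1 P b z).2.

(** The relative size of the terms of lower degree in one step. *)
Definition step_error : R := C / c / nc y.

Lemma in_V_gt0 : 0 < nc y.
Proof. by have /andP[_] := Vz; have := rho_gt0 c_gt0 c_le1 C_ge1; lra. Qed.

Lemma in_V_growth : 2 * d%:R * nc y <= nc y'.
Proof.
have /andP[xy ry] := Vz; have := tame_expand c_gt0 c_le1 C_ge1 T ry xy.
apply: le_trans; rewrite ler_wpM2r ?nc_ge0 //.
by have := tame_deg T; have := C_ge1; lra.
Qed.

Lemma le_nc_step : nc y <= nc y'.
Proof.
apply: le_trans in_V_growth; rewrite ler_peMl ?nc_ge0 //.
have : 2 <= d%:R :> R by rewrite ler_nat (tame_gt1 T).
lra.
Qed.

Lemma in_V_step : in_V (henon1 P b z).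
Proof.
rewrite /in_V; have /andP[_ ry] := Vz.
by rewrite (le_trans ry le_nc_step) andbT; exact: le_nc_step.
Qed.

Lemma step_error_ge0 : 0 <= step_error.
Proof.
by rewrite !divr_ge0 ?nc_ge0 ?(ltW c_gt0) // (le_trans ler01).
Qed.

Lemma step_error_pow : C * nc y ^+ d.-1 <= step_error * nc y'.
Proof.
have /andP[xy ry] := Vz; have y0 := in_V_gt0.
have h : c * nc y ^+ d <= nc y' := tame_low T ry xy.
have -> : C * nc y ^+ d.-1 = step_error * (c * nc y ^+ d).
  rewrite /step_error -{2}(prednK (ltnW (tame_gt1 T))) exprS; field.
  by rewrite !gt_eqF.
by rewrite ler_wpM2l // step_error_ge0.
Qed.

Lemma in_V_ge1 : 1 <= nc y.
Proof. by have /andP[_] := Vz; have := rho_ge12 c_gt0 c_le1 C_ge1; lra. Qed.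

Lemma step_error_lin : C * nc y <= step_error * nc y'.
Proof.
apply: le_trans step_error_pow; rewrite ler_wpM2l ?(le_trans ler01) //.
rewrite -{1}[nc y]expr1 ler_weXn2l ?in_V_ge1 //.
by have := tame_gt1 T; case: (d) => [|[]].
Qed.

Lemma nc_quot_le v (a : R) : nc v.2 <= a * nc y -> nc (v.2 / y) <= a.
Proof. by move=> h; rewrite ncM ncV ler_pdivrMr // in_V_gt0. Qed.

(** On the leading term alone the logarithmic derivative $v_2/y$ would be multiplied
    exactly by the degree. *)
Lemma first_order v (a : R) : nc v.1 <= a * nc y -> nc v.2 <= a * nc y ->
  nc ((P^`().[y] * v.2 - b * v.1) / y' - d%:R * (v.2 / y)) <= 2 * step_error * a.
Proof.
move=> h1 h2; have /andP[xy ry] := Vz; have y0 := in_V_gt0.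
have y'0 : 0 < nc y' := lt_le_trans y0 le_nc_step.
have yn : y != 0 by rewrite -nc_gt0.
have yn' : y' != 0 by rewrite -nc_gt0.
have a0 : 0 <= a by have := le_trans (nc_ge0 _) h1; rewrite pmulr_lge0.
have -> : (P^`().[y] * v.2 - b * v.1) / y' - d%:R * (v.2 / y) =
  ((y * P^`().[y] - d%:R * y') * (v.2 / y) - b * v.1) / y'.
  by field; rewrite yn yn'.
rewrite ncM ncV ler_pdivrMr //; apply: (le_trans (ncB _ _)).
rewrite (ncM _ (v.2 / y)) (ncM b).
have e1 := tame_d1 T in_V_ge1 xy.
have e2 := nc_quot_le h2.
have t1 : nc (y * P^`().[y] - d%:R * y') * nc (v.2 / y) <= step_error * nc y' * a.
  by rewrite ler_pM ?nc_ge0 // (le_trans e1 step_error_pow).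
have t2 : nc b * nc v.1 <= step_error * nc y' * a.
  apply: (@le_trans _ _ (C * (a * nc y))).
    by rewrite ler_pM ?nc_ge0 // (tame_b T).
  by rewrite mulrCA mulrC ler_wpM2r // step_error_lin.
apply: (le_trans (lerD t1 t2)); lra.
Qed.

(** For $y \mapsto y^d$ the quotient $q_2/y$ becomes $d(d-1)(v_2/y)(w_2/y) + d\,q_2/y$;
    the deviation is again a multiple of [step_error]. *)
Lemma second_order v w q (a B : R) : a ^+ 2 <= B ->
  nc v.2 <= a * nc y -> nc w.2 <= a * nc y ->
  nc q.1 <= B * nc y -> nc q.2 <= B * nc y ->
  nc ((P^`()^`().[y] * v.2 * w.2 + P^`().[y] * q.2 - b * q.1) / y' -
      ((d * d.-1)%:R * (v.2 / y) * (w.2 / y) + d%:R * (q.2 / y))) <= 3 * step_error * B.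
Proof.
move=> aB hv hw h1 h2; have /andP[xy ry] := Vz; have y0 := in_V_gt0.
have y'0 : 0 < nc y' := lt_le_trans y0 le_nc_step.
have yn : y != 0 by rewrite -nc_gt0.
have yn' : y' != 0 by rewrite -nc_gt0.
have B0 : 0 <= B by have := le_trans (nc_ge0 _) h1; rewrite pmulr_lge0.
have a0 : 0 <= a by have := le_trans (nc_ge0 _) hv; rewrite pmulr_lge0.
have -> : (P^`()^`().[y] * v.2 * w.2 + P^`().[y] * q.2 - b * q.1) / y' -
      ((d * d.-1)%:R * (v.2 / y) * (w.2 / y) + d%:R * (q.2 / y)) =
  ((y ^+ 2 * P^`()^`().[y] - (d * d.-1)%:R * y') * (v.2 / y * (w.2 / y)) +
   ((y * P^`().[y] - d%:R * y') * (q.2 / y) - b * q.1)) / y'.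
  by field; rewrite yn yn'.
rewrite (ncM _ y'^-1) ncV ler_pdivrMr //.
apply: (le_trans (ncD _ _)); rewrite (ncM _ (_ / _ * _)).
have := ncB ((y * P^`().[y] - d%:R * y') * (q.2 / y)) (b * q.1).
rewrite (ncM _ (_ / _)) (ncM b).
have e1 := tame_d1 T in_V_ge1 xy; have e2 := tame_d2 T in_V_ge1 xy.
have vw : nc (v.2 / y * (w.2 / y)) <= B.
  rewrite ncM; apply: le_trans aB; rewrite expr2 ler_pM ?nc_ge0 //; exact: nc_quot_le.
have t0 : nc (y ^+ 2 * P^`()^`().[y] - (d * d.-1)%:R * y') *
    nc (v.2 / y * (w.2 / y)) <= step_error * nc y' * B.
  by rewrite ler_pM ?nc_ge0 // (le_trans e2 step_error_pow).
have t1 : nc (y * P^`().[y] - d%:R * y') * nc (q.2 / y) <= step_error * nc y' * B.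
  by rewrite ler_pM ?nc_ge0 ?nc_quot_le // (le_trans e1 step_error_pow).
have t2 : nc b * nc q.1 <= step_error * nc y' * B.
  apply: (@le_trans _ _ (C * (B * nc y))).
    by rewrite ler_pM ?nc_ge0 // (tame_b T).
  by rewrite mulrCA mulrC ler_wpM2r // step_error_lin.
lra.
Qed.

End Step.

(** Increases from 1 to 2, and thereby absorbs the factors $1 + $ [step_error] in the
    inductive bounds below. *)
Definition slack k : R := 2 - 1 / 2 ^+ k.

Lemma slack_bounds k : 1 <= slack k <= 2.
Proof.
have h : 1 / 2 ^+ k <= 1 :> R.
  by rewrite ler_pdivrMr ?exprn_gt0 // mul1r exprn_ege1 // ler1n.
have := @div_pow2_ge0 R 1 k ler01; rewrite /slack; lra.
Qed.

Lemma slack_step k (e : R) : 0 <= e -> e <= 1 / 12 / 2 ^+ k ->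
  (1 + e) * slack k <= slack k.+1.
Proof.
move=> e0 he; have /andP[s1 s2] := slack_bounds k.
have : e * slack k <= e * 2 by rewrite ler_wpM2l.
rewrite /slack half_powS in s1 s2 *; have : 1 / 12 / 2 ^+ k = 1 / 2 ^+ k / 12 :> R by ring.
lra.
Qed.

Section Seq.
Variables (d : nat -> nat) (P : nat -> {poly R[i]}) (b : nat -> R[i]).
Hypothesis T : forall k, tame c C (d k) (P k) (b k).
Local Notation o := (orb P b).
Local Notation do := (dorb P b).
Local Notation ddo := (ddorb P b).
Local Notation D := (degprod R d).
Variable z : CC R.
Hypothesis Vz : in_V z.

Lemma in_V_orb k : in_V (o k z).
Proof. by elim: k => [|k IH] //; exact: in_V_step. Qed.

Lemma orb_growth k : 2 ^+ k * D k * rho <= nc (o k z).2.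
Proof.
elim: k => [|k IH].
  by rewrite expr0 degprod0 !mul1r; have /andP[] := Vz.
apply: le_trans (in_V_growth (T k) (in_V_orb k)).
have -> : 2 ^+ k.+1 * D k.+1 * rho = 2 * (d k)%:R * (2 ^+ k * D k * rho).
  by rewrite exprS degprodS; ring.
by rewrite ler_wpM2l // mulr_ge0.
Qed.

Lemma orb_error k : step_error (o k z) <= 1 / 12 / 2 ^+ k / D k.
Proof.
have y0 := in_V_gt0 (in_V_orb k); have D0 := degprod_gt0 T k.
have r0 := rho_gt0 c_gt0 c_le1 C_ge1.
rewrite /step_error ler_pdivrMr //.
have -> : C / c = 1 / 12 / 2 ^+ k / D k * (2 ^+ k * D k * rho).
  by rewrite /escape_radius; field; rewrite !gt_eqF ?exprn_gt0.
by rewrite ler_wpM2l ?orb_growth // !divr_ge0 ?exprn_ge0 // ltW.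
Qed.

Lemma orb_error_pow k : step_error (o k z) <= 1 / 12 / 2 ^+ k.
Proof.
have D0 := degprod_gt0 T k.
apply: (le_trans (orb_error k)); rewrite ler_pdivrMr // ler_peMr //.
by apply: le_trans (pow2_le_degprod T k); rewrite exprn_ege1 // ler1n.
Qed.

Lemma deg_ge2 k : 2 <= (d k)%:R :> R.
Proof. by rewrite ler_nat (tame_gt1 (T k)). Qed.

(** The derivative of the logarithm of the second coordinate grows no faster than the
    product of the degrees. *)
Lemma dorb_bound v (A : R) k : nc v.1 <= A * nc z.2 -> nc v.2 <= A * nc z.2 ->
  nc (do k z v).1 <= A * slack k * D k * nc (o k z).2 /\
  nc (do k z v).2 <= A * slack k * D k * nc (o k z).2.
Proof.
move=> h1 h2; have A0 : 0 <= A.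
  by have := le_trans (nc_ge0 _) h1; rewrite pmulr_lge0 // in_V_gt0.
elim: k => [|k [IH1 IH2]].
  by rewrite /slack expr0 degprod0 divr1 mulr1 (_ : 2 - 1 = 1) ?mulr1 //; lra.
have Vk := in_V_orb k; have y0 := in_V_gt0 Vk; have D0 := degprod_gt0 T k.
have hy := le_nc_step (T k) Vk; have d2 := deg_ge2 k.
have s0 := step_error_ge0 (o k z).
have /andP[sk1 sk2] := slack_bounds k.
set a := A * slack k * D k in IH1 IH2.
have a0 : 0 <= a by rewrite !mulr_ge0 ?(ltW D0) //; lra.
have key : (d k)%:R * (1 + step_error (o k z)) * a <= A * slack k.+1 * D k.+1.
  have -> : (d k)%:R * (1 + step_error (o k z)) * a =
    (A * D k.+1) * ((1 + step_error (o k z)) * slack k) by rewrite degprodS /a; ring.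
  rewrite [leRHS]mulrAC ler_wpM2l ?mulr_ge0 ?(ltW (degprod_gt0 T _)) //.
  exact: slack_step (orb_error_pow k).
have dea : (d k)%:R * a + 2 * step_error (o k z) * a <= (d k)%:R * (1 + step_error (o k z)) * a.
  have : 2 * (step_error (o k z) * a) <= (d k)%:R * (step_error (o k z) * a).
    by rewrite ler_wpM2r // mulr_ge0.
  lra.
split.
  apply: (le_trans IH2); rewrite ler_pM ?nc_ge0 //.
  apply: le_trans key; apply: le_trans dea.
  have : 2 * a <= (d k)%:R * a by rewrite ler_wpM2r.
  have : 0 <= 2 * step_error (o k z) * a by rewrite mulr_ge0 // mulr_ge0.
  lra.
have y'0 : 0 < nc (o k.+1 z).2 := lt_le_trans y0 hy.
apply: (@le_trans _ _ (((d k)%:R * a + 2 * step_error (o k z) * a) * nc (o k.+1 z).2)).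
  rewrite -ler_pdivrMr // -ncV -ncM.
  have := first_order (T k) Vk IH1 IH2 => hf.
  have h4 : nc ((d k)%:R * ((do k z v).2 / (o k z).2)) <= (d k)%:R * a.
    by rewrite ncM nc_nat ler_wpM2l // nc_quot_le.
  have := ncD ((do k.+1 z v).2 / (o k.+1 z).2 - (d k)%:R * ((do k z v).2 / (o k z).2))
    ((d k)%:R * ((do k z v).2 / (o k z).2)).
  rewrite subrK => h5; apply: (le_trans h5); rewrite addrC; exact: lerD.
by rewrite ler_wpM2r ?nc_ge0 // (le_trans dea).
Qed.

Lemma ddorb_bound v w q (A B : R) k : 4 * A ^+ 2 <= B ->
  nc v.1 <= A * nc z.2 -> nc v.2 <= A * nc z.2 ->
  nc w.1 <= A * nc z.2 -> nc w.2 <= A * nc z.2 ->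
  nc q.1 <= B * nc z.2 -> nc q.2 <= B * nc z.2 ->
  nc (ddo k z v w q).1 <= B * slack k * D k ^+ 2 * nc (o k z).2 /\
  nc (ddo k z v w q).2 <= B * slack k * D k ^+ 2 * nc (o k z).2.
Proof.
move=> AB v1 v2 w1 w2 h1 h2; have B0 : 0 <= B.
  by have := le_trans (nc_ge0 _) h1; rewrite pmulr_lge0 // in_V_gt0.
have A0 : 0 <= A.
  by have := le_trans (nc_ge0 _) v1; rewrite pmulr_lge0 // in_V_gt0.
elim: k => [|k [IH1 IH2]].
  by rewrite /slack expr0 degprod0 divr1 expr1n mulr1 (_ : 2 - 1 = 1) ?mulr1 //; lra.
have Vk := in_V_orb k; have y0 := in_V_gt0 Vk; have D0 := degprod_gt0 T k.
have hy := le_nc_step (T k) Vk; have d2 := deg_ge2 k.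
have s0 := step_error_ge0 (o k z).
have /andP[sk1 sk2] := slack_bounds k.
set a := B * slack k * D k ^+ 2 in IH1 IH2.
have a0 : 0 <= a by rewrite !mulr_ge0 ?exprn_ge0 ?(ltW D0) //; lra.
have [_ bv] := dorb_bound k v1 v2; have [_ bw] := dorb_bound k w1 w2.
set e := A * slack k * D k in bv bw.
have e0 : 0 <= e by rewrite !mulr_ge0 ?(ltW D0) //; lra.
have ea : e ^+ 2 <= a.
  rewrite /e /a !exprMn ler_wpM2r ?exprn_ge0 ?(ltW D0) //.
  apply: (@le_trans _ _ (A ^+ 2 * 4)).
    rewrite ler_wpM2l ?exprn_ge0 //; nra.
  rewrite mulrC; apply: (le_trans AB); rewrite ler_peMr //.
have key : (d k)%:R ^+ 2 * (1 + step_error (o k z)) * a <= B * slack k.+1 * D k.+1 ^+ 2.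
  have -> : (d k)%:R ^+ 2 * (1 + step_error (o k z)) * a =
    (B * D k.+1 ^+ 2) * ((1 + step_error (o k z)) * slack k).
    by rewrite degprodS /a; ring.
  rewrite [leRHS]mulrAC ler_wpM2l ?mulr_ge0 ?exprn_ge0 ?(ltW (degprod_gt0 T _)) //.
  exact: slack_step (orb_error_pow k).
have d4 : 4 <= (d k)%:R ^+ 2 :> R by nra.
have dea : (d k)%:R ^+ 2 * a + 3 * step_error (o k z) * a <=
    (d k)%:R ^+ 2 * (1 + step_error (o k z)) * a.
  have : 4 * (step_error (o k z) * a) <= (d k)%:R ^+ 2 * (step_error (o k z) * a).
    by rewrite ler_wpM2r // mulr_ge0.
  have : 0 <= step_error (o k z) * a by rewrite mulr_ge0.
  lra.
split.
  apply: (le_trans IH2); rewrite ler_pM ?nc_ge0 //.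
  apply: le_trans key; apply: le_trans dea.
  have : 4 * a <= (d k)%:R ^+ 2 * a by rewrite ler_wpM2r.
  have : 0 <= 3 * step_error (o k z) * a by rewrite mulr_ge0 // mulr_ge0.
  lra.
have y'0 : 0 < nc (o k.+1 z).2 := lt_le_trans y0 hy.
apply: (@le_trans _ _ (((d k)%:R ^+ 2 * a + 3 * step_error (o k z) * a) * nc (o k.+1 z).2)).
  rewrite -ler_pdivrMr // -ncV -ncM.
  have hf := second_order (T k) Vk ea bv bw IH1 IH2.
  have h4 : nc ((d k * (d k).-1)%:R * ((do k z v).2 / (o k z).2) *
      ((do k z w).2 / (o k z).2) + (d k)%:R * ((ddo k z v w q).2 / (o k z).2))
      <= (d k)%:R ^+ 2 * a.
    apply: (le_trans (ncD _ _)); rewrite -mulrA (ncM (_ * _)%:R) (ncM (d k)%:R) !nc_nat.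
    have q1 := nc_quot_le Vk bv; have q2 := nc_quot_le Vk bw; have q3 := nc_quot_le Vk IH2.
    have q4 : nc ((do k z v).2 / (o k z).2 * ((do k z w).2 / (o k z).2)) <= a.
      by rewrite ncM; apply: le_trans ea; rewrite expr2 ler_pM ?nc_ge0.
    have -> : (d k)%:R ^+ 2 * a = (d k * (d k).-1)%:R * a + (d k)%:R * a.
      rewrite -mulrDl -natrX -natrD; congr (_%:R * _).
      by rewrite -mulnSr (ltn_predK (tame_gt1 (T k))) mulnn.
    by apply: lerD; rewrite ler_wpM2l.
  have := ncD ((ddo k.+1 z v w q).2 / (o k.+1 z).2 - ((d k * (d k).-1)%:R *
    ((do k z v).2 / (o k z).2) * ((do k z w).2 / (o k z).2) +
    (d k)%:R * ((ddo k z v w q).2 / (o k z).2)))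
    ((d k * (d k).-1)%:R * ((do k z v).2 / (o k z).2) *
     ((do k z w).2 / (o k z).2) + (d k)%:R * ((ddo k z v w q).2 / (o k z).2)).
  rewrite subrK => h5; apply: (le_trans h5); rewrite addrC; exact: lerD.
by rewrite ler_wpM2r ?nc_ge0 // (le_trans dea).
Qed.

(** Divided by the product of degrees, the logarithmic derivatives change by less and
    less: the increments inherit the decay of [step_error]. *)
Lemma dlog_step v (A : R) k : nc v.1 <= A * nc z.2 -> nc v.2 <= A * nc z.2 ->
  nc ((do k.+1 z v).2 / (o k.+1 z).2 - (d k)%:R * ((do k z v).2 / (o k z).2))
    / D k.+1 <= A / 2 ^+ k.+1.
Proof.
move=> h1 h2; have A0 : 0 <= A.
  by have := le_trans (nc_ge0 _) h1; rewrite pmulr_lge0 // in_V_gt0.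
have [b1 b2] := dorb_bound k h1 h2; have Vk := in_V_orb k.
have hf := first_order (T k) Vk b1 b2.
have D0 := degprod_gt0 T k; have D1 := degprod_gt0 T k.+1.
rewrite ler_pdivrMr //; apply: (le_trans hf).
have /andP[sk1 sk2] := slack_bounds k; have s0 := step_error_ge0 (o k z).
have se := orb_error_pow k; have d2 := deg_ge2 k.
have AD : 0 <= A * D k by rewrite mulr_ge0 // ltW.
have e1 : A * slack k * D k <= 2 * (A * D k).
  by rewrite mulrAC mulrC ler_wpM2r.
have e2 : 2 * step_error (o k z) * (A * slack k * D k) <=
    2 * (1 / 12 / 2 ^+ k) * (2 * (A * D k)).
  apply: ler_pM => //; first by rewrite mulr_ge0.
    by rewrite !mulr_ge0 ?(ltW D0) //; lra.
  by rewrite ler_wpM2l.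
apply: (le_trans e2); rewrite degprodS half_powS.
have -> : A / 2 ^+ k / 2 * (D k * (d k)%:R) = (A * D k) / 2 ^+ k * ((d k)%:R / 2) by ring.
have -> : 2 * (1 / 12 / 2 ^+ k) * (2 * (A * D k)) = (A * D k) / 2 ^+ k * (1 / 3) by field; rewrite expf_neq0.
by rewrite ler_wpM2l ?div_pow2_ge0 //; lra.
Qed.

(** The second derivative of the logarithm is the difference of two terms of order
    $D_k^2$, and the parts of order $D_k^2$ of their increments cancel: what remains is
    of order [step_error] times $D_k^2$, with [step_error] itself of order $1/D_k$
    ([orb_error]). *)
Lemma ddlog_step v w q (A B : R) k : 4 * A ^+ 2 <= B ->
  nc v.1 <= A * nc z.2 -> nc v.2 <= A * nc z.2 ->
  nc w.1 <= A * nc z.2 -> nc w.2 <= A * nc z.2 ->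
  nc q.1 <= B * nc z.2 -> nc q.2 <= B * nc z.2 ->
  nc (((ddo k.+1 z v w q).2 / (o k.+1 z).2 -
      (do k.+1 z v).2 / (o k.+1 z).2 * ((do k.+1 z w).2 / (o k.+1 z).2)) -
    (d k)%:R * ((ddo k z v w q).2 / (o k z).2 -
      (do k z v).2 / (o k z).2 * ((do k z w).2 / (o k z).2)))
    / D k.+1 <= 2 * B / 2 ^+ k.+1.
Proof.
move=> AB v1 v2 w1 w2 h1 h2; have B0 : 0 <= B.
  by have := le_trans (nc_ge0 _) h1; rewrite pmulr_lge0 // in_V_gt0.
have A0 : 0 <= A.
  by have := le_trans (nc_ge0 _) v1; rewrite pmulr_lge0 // in_V_gt0.
have [bv1 bv2] := dorb_bound k v1 v2; have [bw1 bw2] := dorb_bound k w1 w2.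
have [bq1 bq2] := ddorb_bound k AB v1 v2 w1 w2 h1 h2.
have Vk := in_V_orb k; have D0 := degprod_gt0 T k; have D1 := degprod_gt0 T k.+1.
have /andP[sk1 sk2] := slack_bounds k; have s0 := step_error_ge0 (o k z).
have se := orb_error k; have sp := orb_error_pow k; have d2 := deg_ge2 k.
set a := B * slack k * D k ^+ 2 in bq1 bq2.
set e := A * slack k * D k in bv1 bv2 bw1 bw2.
have e0 : 0 <= e by rewrite !mulr_ge0 ?(ltW D0) //; lra.
have a0 : 0 <= a by rewrite !mulr_ge0 ?exprn_ge0 ?(ltW D0) //; lra.
have ea : e ^+ 2 <= a.
  rewrite /e /a !exprMn ler_wpM2r ?exprn_ge0 ?(ltW D0) //.
  apply: (@le_trans _ _ (A ^+ 2 * 4)).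
    rewrite ler_wpM2l ?exprn_ge0 //; nra.
  rewrite mulrC; apply: (le_trans AB); rewrite ler_peMr //.
have f1 := first_order (T k) Vk bv1 bv2; have f2 := first_order (T k) Vk bw1 bw2.
have f3 := second_order (T k) Vk ea bv2 bw2 bq1 bq2.
have qv := nc_quot_le Vk bv2; have qw := nc_quot_le Vk bw2.
set s := step_error (o k z) in s0 se sp f1 f2 f3.
set av' := (do k.+1 z v).2 / (o k.+1 z).2.
set aw' := (do k.+1 z w).2 / (o k.+1 z).2.
set av := (do k z v).2 / (o k z).2 in f1 f3 qv *.
set aw := (do k z w).2 / (o k z).2 in f2 f3 qw *.
set be' := (ddo k.+1 z v w q).2 / (o k.+1 z).2.
set be := (ddo k z v w q).2 / (o k z).2 in f3 *.
have {}f1 : nc (av' - (d k)%:R * av) <= 2 * s * e := f1.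
have {}f2 : nc (aw' - (d k)%:R * aw) <= 2 * s * e := f2.
have {}f3 : nc (be' - ((d k * (d k).-1)%:R * av * aw + (d k)%:R * be)) <= 3 * s * a := f3.
have dd : (d k * (d k).-1)%:R = (d k)%:R * (d k)%:R - (d k)%:R :> R[i].
  by rewrite -subn1 mulnBr muln1 natrB ?natrM // leq_pmulr // ltnW // (tame_gt1 (T k)).
have -> : be' - av' * aw' - (d k)%:R * (be - av * aw) =
   (be' - ((d k * (d k).-1)%:R * av * aw + (d k)%:R * be)) -
   ((d k)%:R * av * (aw' - (d k)%:R * aw) + (av' - (d k)%:R * av) * ((d k)%:R * aw) +
    (av' - (d k)%:R * av) * (aw' - (d k)%:R * aw)).
  by rewrite dd; ring.
set ev := av' - (d k)%:R * av in f1 *; set ew := aw' - (d k)%:R * aw in f2 *.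
set eb := be' - _ in f3 *.
have g1 : nc ((d k)%:R * av * ew) <= (d k)%:R * e * (2 * s * e).
  rewrite (ncM _ ew) (ncM _ av) nc_nat; apply: ler_pM => //.
  - by rewrite mulr_ge0 ?nc_ge0.
  - exact: nc_ge0.
  - by rewrite ler_wpM2l.
have g2 : nc (ev * ((d k)%:R * aw)) <= 2 * s * e * ((d k)%:R * e).
  rewrite ncM ler_pM ?nc_ge0 // ncM nc_nat; by rewrite ler_wpM2l.
have g3 : nc (ev * ew) <= 2 * s * e * (2 * s * e) by rewrite ncM ler_pM ?nc_ge0.
have t1 := ncB eb ((d k)%:R * av * ew + ev * ((d k)%:R * aw) + ev * ew).
have t2 := ncD ((d k)%:R * av * ew + ev * ((d k)%:R * aw)) (ev * ew).
have t3 := ncD ((d k)%:R * av * ew) (ev * ((d k)%:R * aw)).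
have s12 : s <= 1 / 12.
  apply: (le_trans sp); rewrite ler_pdivrMr ?exprn_gt0 //.
  have : 1 <= (2 : R) ^+ k by rewrite exprn_ege1 // ler1n.
  lra.
have sea : s * e ^+ 2 <= s * a by rewrite ler_wpM2l.
have sa0 : 0 <= s * a by rewrite mulr_ge0.
have dsea : (d k)%:R * (s * e ^+ 2) <= (d k)%:R * (s * a) by rewrite ler_wpM2l.
have ssea : s * (s * e ^+ 2) <= 1 / 12 * (s * a).
  by rewrite ler_pM // mulr_ge0 // exprn_ge0.
have dsa : 2 * (s * a) <= (d k)%:R * (s * a) by rewrite ler_wpM2r.
rewrite ler_pdivrMr //.
apply: (@le_trans _ _ (6 * (d k)%:R * (s * a))).
  apply: (le_trans t1); rewrite !expr2 in sea dsea ssea; lra.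
have h5 : s * a <= 1 / 12 / 2 ^+ k / D k * (B * 2 * D k ^+ 2).
  rewrite ler_pM // /a ler_wpM2r ?exprn_ge0 ?(ltW D0) // ler_wpM2l //.
have h6 : 6 * (d k)%:R * (s * a) <=
    6 * (d k)%:R * (1 / 12 / 2 ^+ k / D k * (B * 2 * D k ^+ 2)).
  by rewrite ler_wpM2l // mulr_ge0.
apply: (le_trans h6); rewrite degprodS half_powS le_eqVlt; apply/orP; left; apply/eqP.
by field; rewrite expf_neq0 //= gt_eqF.
Qed.

End Seq.
End Constants.
End OrbitDerivatives.

(** * Pluriharmonicity of the Green function *)

Section GreenPluriharmonic.
Variable R : realType.
Implicit Types (x y : R[i]) (z v w : CC R).
Local Notation nc := (@ComplexField.Normc.normc R).

Definition shiftn (X : Type) k0 (f : nat -> X) : nat -> X := fun n => f (k0 + n)%N.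

Section Shift.
Variables (d : nat -> nat) (P : nat -> {poly R[i]}) (b : nat -> R[i]) (k0 : nat).

Lemma orb_shift n z : orb P b (k0 + n) z = orb (shiftn k0 P) (shiftn k0 b) n (orb P b k0 z).
Proof. by elim: n => [|n IH]; rewrite ?addn0 // addnS /= IH. Qed.

Lemma dorb_shift n z v : dorb P b (k0 + n) z v =
  dorb (shiftn k0 P) (shiftn k0 b) n (orb P b k0 z) (dorb P b k0 z v).
Proof. by elim: n => [|n IH]; rewrite ?addn0 // addnS /= IH orb_shift. Qed.

Lemma ddorb_shift n z v w : ddorb P b (k0 + n) z v w 0 =
  ddorb (shiftn k0 P) (shiftn k0 b) n (orb P b k0 z) (dorb P b k0 z v)
    (dorb P b k0 z w) (ddorb P b k0 z v w 0).
Proof.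
by elim: n => [|n IH]; rewrite ?addn0 // addnS /= IH orb_shift !dorb_shift.
Qed.

Lemma degprod_shift n : degprod R d (k0 + n) = degprod R d k0 * degprod R (shiftn k0 d) n.
Proof.
elim: n => [|n IH]; first by rewrite addn0 degprod0 mulr1.
by rewrite addnS !degprodS IH mulrA.
Qed.

End Shift.

(** Turns the complex increments of [dlog_step] and [ddlog_step] into increments of
    the real parts divided by the degrees. *)
Lemma Re_div_step x y (D d : R) : 0 < D -> 0 < d ->
  `|complex.Re x / (D * d) - complex.Re y / D| <= nc (x - d%:C%C * y) / (D * d).
Proof.
move=> D0 d0; have -> : complex.Re x / (D * d) - complex.Re y / D =
    complex.Re (x - d%:C%C * y) / (D * d).
  case: (x) (y) => [x1 x2] [y1 y2] /=; rewrite mul0r subr0; field.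
  by rewrite !gt_eqF.
have Dd : 0 <= (D * d)^-1 by rewrite invr_ge0 mulr_ge0 // ltW.
by rewrite normrM [X in _ * X]ger0_norm // ler_wpM2r // nc_Re.
Qed.

Lemma near_nc_le (X : topologicalType) (f : X -> R[i]) (z0 : X) x : f @ z0 --> x ->
  \forall z \near z0, nc (f z) <= nc x + 1.
Proof.
move=> /(cvg_ncP (nbhs_filter z0)) /(_ 1 ltr01); apply: filterS => z h.
by rewrite -[f z](subrK x) addrC (le_trans (ncD _ _)) // lerD2l ltW.
Qed.

Lemma near_segment z v (Q : CC R -> Prop) : (\forall z' \near z, Q z') ->
  exists2 dl : R, 0 < dl & forall s : R, `|s| < dl -> Q (z + s%:C%C *: v).
Proof.
move=> hQ; have := @line_continuous R (CC R) z v 0.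
rewrite /prop_for /continuous_at rmorph0 scale0r addr0 => /(_ _ hQ).
move=> /nbhs_ballP[dl /= dl0 hdl]; exists dl => // s hs; apply: hdl.
by rewrite /ball /= sub0r normrN.
Qed.

Lemma near_uniform_continuous (X : topologicalType) (f : nat -> X -> R) (F : X -> R) (z0 : X) (A : R) k0 :
  (\forall z \near z0, forall k, (k0 <= k)%N -> `|F z - f k z| <= A / 2 ^+ k) ->
  (forall k, (k0 <= k)%N -> {for z0, continuous (f k)}) ->
  {for z0, continuous F}.
Proof.
move=> hF hf; apply/(cvg_distP (nbhs_filter z0)) => e e0.
have e3 : 0 < e / 3 by rewrite divr_gt0.
have [k1 hk1] := pow2_small A e3.
pose k := maxn k0 k1; have kk0 : (k0 <= k)%N := leq_maxl _ _.
have Ak := hk1 k (leq_maxr _ _).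
have hc := proj1 (cvg_distP (nbhs_filter z0) _ _) (hf k kk0) _ e3.
have F0 := nbhs_singleton hF k kk0.
apply: filterS2 hF hc => z /(_ k kk0) h1 h2.
have -> : F z - F z0 = (F z - f k z) + (f k z - f k z0) - (F z0 - f k z0) by ring.
apply: (le_lt_trans (ler_normB _ _)).
have := ler_normD (F z - f k z) (f k z - f k z0); lra.
Qed.

(** The backward maps become elementary steps after the exchange of coordinates. *)
Definition coords (s : bool) z : CC R := if s then z else (z.2, z.1).

Lemma coordsK s : involutive (coords s).
Proof. by case: s => // -[]. Qed.

Lemma coords_line s z v (a : R[i]) : coords s (z + a *: v) = coords s z + a *: coords s v.
Proof. by case: s. Qed.

Lemma coords_scale s v (a : R[i]) : coords s (a *: v) = a *: coords s v.
Proof. by case: s. Qed.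

Lemma continuous_coords s : continuous (coords s).
Proof.
case: s => z /=; first exact: cvg_id.
by apply: (@cvg_pair _ _ _ _ (nbhs z.2) (nbhs z.1)); [exact: cvg_snd|exact: cvg_fst].
Qed.

Section Green.
Variables (c C : R).
Hypotheses (c_gt0 : 0 < c) (c_le1 : c <= 1) (C_ge1 : 1 <= C).
Local Notation rho := (escape_radius c C).
Variables (d : nat -> nat) (P : nat -> {poly R[i]}) (b : nat -> R[i]).
Hypothesis T : forall k, tame c C (d k) (P k) (b k).
Local Notation o := (orb P b).
Local Notation do := (dorb P b).
Local Notation ddo := (ddorb P b).
Local Notation D := (degprod R d).
Local Notation green := (green c C d P b).
Local Notation potential := (potential c C d P b).

Definition dlog k v z : R := dlog_approx P b (D k) k v z.
Definition ddlog k v w z : R := ddlog_approx P b (D k) k v w z.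
Definition dgreen v z : R := limn (fun k => dlog k v z).
Definition ddgreen v w z : R := limn (fun k => ddlog k v w z).

Lemma in_V_in_W z : in_V c C z -> in_W c C z.
Proof.
by move=> /andP[h1 _]; rewrite /in_W (le_trans h1) // /size2 le_max lexx.
Qed.

(** The time is taken one step after a passage above [rho]: both inequalities are then
    strict, hence stable under perturbation of the point. *)
Lemma green_gt0_in_V z : 0 < green z -> exists k0,
  nc (o k0 z).1 < nc (o k0 z).2 /\ rho < nc (o k0 z).2.
Proof.
move=> g0; have [k1 W1] := eventually_W c_gt0 c_le1 C_ge1 T z.
have [k kk1 hk] : exists2 k, (k1 <= k)%N & rho < nc (o k z).2.
  apply: contrapT => hn; move: g0.
  suff -> : green z = 0 by rewrite ltxx.
  apply: (green_eq0 c_gt0 c_le1 C_ge1 T (B := rho)) => k2.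
  exists (maxn k1 k2); first exact: leq_maxr.
  rewrite /size2 ge_max lexx andbT leNgt; apply/negP => hr; apply: hn.
  by exists (maxn k1 k2) => //; exact: leq_maxl.
have Wk := in_W_orb c_gt0 c_le1 C_ge1 T W1 kk1.
have Vk : in_V c C (o k z).
  by move: Wk; rewrite /in_W /in_V /size2 max_l ?(ltW hk) // => ->.
exists k.+1; have y0 := in_V_gt0 c_gt0 c_le1 C_ge1 Vk.
have := in_V_growth c_gt0 c_le1 C_ge1 (T k) Vk.
have : 2 <= (d k)%:R :> R by rewrite ler_nat (tame_gt1 (T k)).
move=> d2 hg; have h2 : 4 * nc (o k z).2 <= nc (o k.+1 z).2.
  apply: le_trans hg; rewrite ler_wpM2r ?nc_ge0 //; lra.
by rewrite orbS_fst; split; lra.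
Qed.

Lemma near_in_V z0 k : nc (o k z0).1 < nc (o k z0).2 -> rho < nc (o k z0).2 ->
  \forall z \near z0, in_V c C (o k z).
Proof.
move=> h1 h2; have [/(cvg_ncP (nbhs_filter z0)) c1 /(cvg_ncP (nbhs_filter z0)) c2] :=
  cvg_orb P b z0 k.
pose e := Num.min ((nc (o k z0).2 - nc (o k z0).1) / 2) (nc (o k z0).2 - rho).
have e0 : 0 < e by rewrite lt_min; apply/andP; split; lra.
apply: filterS2 (c1 e e0) (c2 e e0) => z /=; rewrite !lt_min => /andP[a1 _] /andP[a2 a3].
have := ncB_ge (o k z).1 (o k z0).1; have := ncB_ge (o k z0).2 (o k z).2.
rewrite ncB_sym => a4 a5; apply/andP; split; lra.
Qed.

(** Near a point of positive value the orbit enters a fixed region of escape at a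
    fixed time; from then on the logarithmic derivatives of the second coordinates
    form geometric sequences, with bounds depending only on the data at that time. *)
Lemma green_local z0 v w : 0 < green z0 -> exists k0 A,
  \forall z \near z0, 0 < green z /\ forall k, (k0 <= k)%N ->
    [/\ (o k z).2 != 0, potential k z = log_approx P b (D k) k z,
        `|dlog k.+1 v z - dlog k v z| <= A / 2 ^+ k.+1 &
        `|ddlog k.+1 v w z - ddlog k v w z| <= A / 2 ^+ k.+1].
Proof.
move=> /green_gt0_in_V[k0 [h1 h2]]; exists k0.
pose A := nc (do k0 z0 v).1 + nc (do k0 z0 v).2 + nc (do k0 z0 w).1 + nc (do k0 z0 w).2 + 1.
pose B := 4 * A ^+ 2 + nc (ddo k0 z0 v w 0).1 + nc (ddo k0 z0 v w 0).2 + 1.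
have A1 : 1 <= A by rewrite /A; have := (nc_ge0 (do k0 z0 v).1, nc_ge0 (do k0 z0 v).2,
  nc_ge0 (do k0 z0 w).1, nc_ge0 (do k0 z0 w).2) => -[[[]]]; lra.
have AB : 4 * A ^+ 2 <= B by rewrite /B; have := (nc_ge0 (ddo k0 z0 v w 0).1,
  nc_ge0 (ddo k0 z0 v w 0).2) => -[]; lra.
have A2 : A <= 4 * A ^+ 2.
  have : A * 1 <= A * A by rewrite ler_wpM2l //; lra.
  rewrite expr2; lra.
exists (2 * B * 2 ^+ k0).
have n1 := near_in_V h1 h2.
have [/near_nc_le n2 /near_nc_le n3] := cvg_dorb P b z0 k0 v.
have [/near_nc_le n4 /near_nc_le n5] := cvg_dorb P b z0 k0 w.
have [/near_nc_le n6 /near_nc_le n7] := cvg_ddorb P b z0 k0 v w.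
apply: filterS2 (filterI n1 (filterI n2 n3)) (filterI (filterI n4 n5) (filterI n6 n7)).
move=> z [Vz [b1 b2]] [[b3 b4] [b5 b6]].
have r1 := rho_ge12 c_gt0 c_le1 C_ge1.
have y1 : 1 <= nc (o k0 z).2 by move: Vz => /andP[_]; lra.
have Av x : nc x <= A -> nc x <= A * nc (o k0 z).2.
  by move=> h; apply: (le_trans h); rewrite ler_peMr //; lra.
have Bv x : nc x <= B -> nc x <= B * nc (o k0 z).2.
  by move=> h; apply: (le_trans h); rewrite ler_peMr //; lra.
have p1 := nc_ge0 (do k0 z0 v).1; have p2 := nc_ge0 (do k0 z0 v).2.
have p3 := nc_ge0 (do k0 z0 w).1; have p4 := nc_ge0 (do k0 z0 w).2.
have p5 := nc_ge0 (ddo k0 z0 v w 0).1; have p6 := nc_ge0 (ddo k0 z0 v w 0).2.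
have {}b1 : nc (do k0 z v).1 <= A * nc (o k0 z).2 by apply: Av; rewrite /A; lra.
have {}b2 : nc (do k0 z v).2 <= A * nc (o k0 z).2 by apply: Av; rewrite /A; lra.
have {}b3 : nc (do k0 z w).1 <= A * nc (o k0 z).2 by apply: Av; rewrite /A; lra.
have {}b4 : nc (do k0 z w).2 <= A * nc (o k0 z).2 by apply: Av; rewrite /A; lra.
have {}b5 : nc (ddo k0 z v w 0).1 <= B * nc (o k0 z).2.
  by apply: Bv; rewrite /B; lra.
have {}b6 : nc (ddo k0 z v w 0).2 <= B * nc (o k0 z).2.
  by apply: Bv; rewrite /B; lra.
have T' n : tame c C (shiftn k0 d n) (shiftn k0 P n) (shiftn k0 b n) := T (k0 + n).
split.
  apply: (green_gt0 c_gt0 c_le1 C_ge1 T (in_V_in_W Vz)).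
  by have /andP[] := Vz.
move=> k kk0; pose n := (k - k0)%N.
have kE : k = (k0 + n)%N by rewrite subnKC.
have Vk : in_V c C (o k z).
  by rewrite kE orb_shift; exact: (in_V_orb c_gt0 c_le1 C_ge1 T' Vz n).
have yk := in_V_gt0 c_gt0 c_le1 C_ge1 Vk.
have Dk := degprod_gt0 T k.
have dk : 0 < (d k)%:R :> R by rewrite ltr0n ltnW // (tame_gt1 (T k)).
have D'n := degprod_gt0 T' n.+1.
have DD : degprod R (shiftn k0 d) n.+1 <= D k.+1.
  rewrite kE -addnS degprod_shift ler_peMl ?(ltW D'n) //.
  by apply: le_trans (pow2_le_degprod T k0); rewrite exprn_ege1 // ler1n.
have fin (X Y : R) : 0 <= X -> Y <= 2 * B -> X / degprod R (shiftn k0 d) n.+1 <= Y / 2 ^+ n.+1 ->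
    X / D k.+1 <= 2 * B * 2 ^+ k0 / 2 ^+ k.+1.
  move=> X0 hY hX; apply: (@le_trans _ _ (X / degprod R (shiftn k0 d) n.+1)).
    by rewrite ler_wpM2l // lef_pV2 ?posrE // (degprod_gt0 T).
  apply: (le_trans hX).
  have -> : 2 * B * 2 ^+ k0 / 2 ^+ k.+1 = 2 * B / 2 ^+ n.+1.
    by rewrite kE -addnS exprD; field; rewrite !expf_neq0.
  by rewrite ler_wpM2r // invr_ge0 exprn_ge0.
split.
- by rewrite -nc_gt0.
- rewrite /potential /log_approx /size2 max_l //.
  by have /andP[] := Vk.
- have := dlog_step c_gt0 c_le1 C_ge1 T' Vz n b1 b2.
  rewrite -!orb_shift -!dorb_shift addnS -kE => hstep.
  rewrite /dlog /dlog_approx degprodS.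
  apply: (le_trans (Re_div_step _ _ Dk dk)); rewrite -degprodS.
  apply: (fin _ A) => //; first exact: nc_ge0.
    have : 0 <= B by lra.
    lra.
  by rewrite rmorph_nat; move: hstep; rewrite /shiftn -kE.
- have := ddlog_step c_gt0 c_le1 C_ge1 T' Vz n AB b1 b2 b3 b4 b5 b6.
  rewrite -!orb_shift -!dorb_shift -!ddorb_shift addnS -kE => hstep.
  rewrite /ddlog /ddlog_approx degprodS.
  apply: (le_trans (Re_div_step _ _ Dk dk)); rewrite -degprodS.
  apply: (fin _ (2 * B)) => //; first exact: nc_ge0.
  rewrite rmorph_nat; move: hstep; rewrite /shiftn -kE.
  have e1 x y y' : x / y' * (y / y') = x * y / y' ^+ 2 :> R[i].
    by rewrite expr2 invfM mulrACA.
  by rewrite !e1.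
Qed.

Lemma green_derivative z0 v : 0 < green z0 ->
  is_derive (0 : R) (1 : R) (fun t : R => green (z0 + t%:C%C *: v)) (dgreen v z0).
Proof.
move=> g0; have [k0 [A hA]] := green_local v v g0.
have [dl dl0 hdl] := near_segment v hA.
pose F' (t : R) := dgreen v (z0 + t%:C%C *: v).
have -> : dgreen v z0 = F' 0 by rewrite /F' rmorph0 scale0r addr0.
apply: (@is_derive_limit R (fun k t => log_approx P b (D k) k (z0 + t%:C%C *: v))
   (fun k t => dlog k v (z0 + t%:C%C *: v))
   (fun t : R => green (z0 + t%:C%C *: v)) F' dl A k0 dl0).
- move=> k s kk0 hs; apply: is_derive_log_approx.
  by have [_ /(_ k kk0)[]] := hdl s hs.
- move=> s hs; have [_ hk] := hdl s hs.
  have hp := potential_cvg c_gt0 c_le1 C_ge1 T (z := z0 + s%:C%C *: v).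
  apply: cvg_trans hp; apply: near_eq_cvg.
  by exists k0 => // k kk0; have [_ -> _ _] := hk k kk0.
- move=> k s kk0 hs; have [_ hk] := hdl s hs.
  by apply: (geo_lim (k0 := k0)) => // j jk0; have [_ _ + _] := hk j jk0.
- move=> k kk0; apply: (@continuous_comp _ _ _ (fun t : R => z0 + t%:C%C *: v)).
    exact: line_continuous.
  rewrite rmorph0 scale0r addr0; apply: continuous_dlog_approx.
  by have [_ /(_ k kk0)[]] := nbhs_singleton hA.
Qed.

Lemma green_derivative2 z0 v w : 0 < green z0 ->
  is_derive (0 : R) (1 : R) (fun t : R => dgreen v (z0 + t%:C%C *: w)) (ddgreen v w z0).
Proof.
move=> g0; have [k0 [A hA]] := green_local v w g0.
have [dl dl0 hdl] := near_segment w hA.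
pose F' (t : R) := ddgreen v w (z0 + t%:C%C *: w).
have -> : ddgreen v w z0 = F' 0 by rewrite /F' rmorph0 scale0r addr0.
apply: (@is_derive_limit R (fun k t => dlog k v (z0 + t%:C%C *: w))
   (fun k t => ddlog k v w (z0 + t%:C%C *: w))
   (fun t : R => dgreen v (z0 + t%:C%C *: w)) F' dl A k0 dl0).
- move=> k s kk0 hs; apply: is_derive_dlog_approx.
  by have [_ /(_ k kk0)[]] := hdl s hs.
- move=> s hs; have [_ hk] := hdl s hs.
  by apply: (geo_cvg (k0 := k0) (A := A)) => // j jk0; have [_ _ + _] := hk j jk0.
- move=> k s kk0 hs; have [_ hk] := hdl s hs.
  by apply: (geo_lim (k0 := k0)) => // j jk0; have [_ _ _ +] := hk j jk0.
- move=> k kk0; apply: (@continuous_comp _ _ _ (fun t : R => z0 + t%:C%C *: w)).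
    exact: line_continuous.
  rewrite rmorph0 scale0r addr0; apply: continuous_ddlog_approx.
  by have [_ /(_ k kk0)[]] := nbhs_singleton hA.
Qed.

Lemma continuous_dgreen z0 v : 0 < green z0 -> {for z0, continuous (dgreen v)}.
Proof.
move=> g0; have [k0 [A hA]] := green_local v v g0.
apply: (@near_uniform_continuous (CC R) (fun k => dlog k v) _ _ A k0).
  apply: filterS hA => z [_ hk] k kk0.
  by apply: (geo_lim (k0 := k0)) => // j jk0; have [_ _ + _] := hk j jk0.
move=> k kk0; apply: continuous_dlog_approx.
by have [_ /(_ k kk0)[]] := nbhs_singleton hA.
Qed.

Lemma continuous_ddgreen z0 v w : 0 < green z0 -> {for z0, continuous (ddgreen v w)}.
Proof.
move=> g0; have [k0 [A hA]] := green_local v w g0.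
apply: (@near_uniform_continuous (CC R) (fun k => ddlog k v w) _ _ A k0).
  apply: filterS hA => z [_ hk] k kk0.
  by apply: (geo_lim (k0 := k0)) => // j jk0; have [_ _ _ +] := hk j jk0.
move=> k kk0; apply: continuous_ddlog_approx.
by have [_ /(_ k kk0)[]] := nbhs_singleton hA.
Qed.

Lemma ddgreen_i z v : 0 < green z ->
  ddgreen ('i%C *: v) ('i%C *: v) z = - ddgreen v v z.
Proof.
move=> g0; have [k0 [A hA]] := green_local v v g0.
have [_ hk] := nbhs_singleton hA.
rewrite /ddgreen -limN; last first.
  by apply: (geo_cvg (k0 := k0) (A := A)) => // j jk0; have [_ _ _ +] := hk j jk0.
by congr (limn _); apply/funext => k; rewrite /ddlog ddlog_approx_i.
Qed.

Lemma open_green_gt0 : open [set z | 0 < green z].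
Proof.
rewrite openE => z /= g0; have [k0 [A hA]] := green_local 0 0 g0.
by rewrite /interior; apply: filterS hA => z' [].
Qed.

Lemma green_pluriharmonic s :
  pluriharmonic_on [set z | 0 < green (coords s z)] (fun z => green (coords s z)).
Proof.
have cc z : {for z, continuous (coords s)} by exact: continuous_coords.
apply: (@pluriharmonic_of_data R _ _ (fun v z => dgreen (coords s v) (coords s z))
  (fun v w z => ddgreen (coords s v) (coords s w) (coords s z))).
- by apply: (open_comp (f := coords s)) open_green_gt0 => z _; exact: cc.
- move=> v z Uz; under [X in is_derive _ _ X]eq_fun do rewrite coords_line.
  exact: green_derivative.
- by move=> v z Uz; apply: (@continuous_comp _ _ _ (coords s)); [exact: cc|exact: continuous_dgreen].
- move=> v w z Uz; under [X in is_derive _ _ X]eq_fun do rewrite coords_line.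
  exact: green_derivative2.
- by move=> v w z Uz; apply: (@continuous_comp _ _ _ (coords s)); [exact: cc|exact: continuous_ddgreen].
- by move=> v z Uz; rewrite coords_scale; exact: ddgreen_i.
Qed.

End Green.
End GreenPluriharmonic.

(** * Plurisubharmonicity and continuity of the Green function *)

Section GreenPlurisubharmonic.
Variable R : realType.
Implicit Types (x y : R[i]) (z u v w : CC R).
Local Notation nc := (@ComplexField.Normc.normc R).

(** The orbit along the complex line $u + xv$, as polynomials in $x$. *)
Fixpoint orbpoly (P : nat -> {poly R[i]}) (b : nat -> R[i]) u v k :
    {poly R[i]} * {poly R[i]} :=
  if k is k'.+1 then
    let Q := orbpoly P b u v k' in (Q.2, P k' \Po Q.2 - b k' *: Q.1)
  else (u.1%:P + v.1 *: 'X, u.2%:P + v.2 *: 'X).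

Lemma horner_orbpoly P b u v k (x : R[i]) :
  (orbpoly P b u v k).1.[x] = (orb P b k (u + x *: v)).1 /\
  (orbpoly P b u v k).2.[x] = (orb P b k (u + x *: v)).2.
Proof.
elim: k => [|k [IH1 IH2]] /=.
  by rewrite !(hornerE, hornerZ, hornerX, hornerC); split; congr (_ + _); exact: mulrC.
split=> //.
by rewrite hornerD hornerN hornerZ horner_comp IH1 IH2.
Qed.

Lemma circle_mean_div k (h : R[i] -> R) (z0 : R[i]) r (D : R) :
  circle_mean k (fun x => h x / D) z0 r = circle_mean k h z0 r / D.
Proof. by rewrite /circle_mean -mulr_suml mulrAC. Qed.

Section Constants.
Variables (c C : R).
Hypotheses (c_gt0 : 0 < c) (c_le1 : c <= 1) (C_ge1 : 1 <= C).
Local Notation rho := (escape_radius c C).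

Section Seq.
Variables (d : nat -> nat) (P : nat -> {poly R[i]}) (b : nat -> R[i]).
Hypothesis T : forall k, tame c C (d k) (P k) (b k).
Local Notation o := (orb P b).
Local Notation D := (degprod R d).
Local Notation green := (green c C d P b).
Local Notation potential := (potential c C d P b).

Lemma green_slice_disc_unif_cont u v : disc_unif_cont (fun x : R[i] => green (u + x *: v)).
Proof.
move=> r e e0; pose V := nc v.1 + nc v.2 + 1.
have [v1 v2] : nc v.1 <= V /\ nc v.2 <= V.
  by rewrite /V; have := (nc_ge0 v.1, nc_ge0 v.2) => -[]; split; lra.
have V0 : 0 < V by rewrite /V; have := (nc_ge0 v.1, nc_ge0 v.2) => -[]; lra.
pose B := nc u.1 + nc u.2 + `|r| * V.
have [tau [A [tau0 A0 hA]]] := green_holder c_gt0 c_le1 C_ge1 B.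
pose t := (e / A) `^ tau^-1; have t0 : 0 < t by rewrite powR_gt0 // divr_gt0.
have At : A * t `^ tau = e.
  rewrite /t -powRrM mulVf ?gt_eqF // powRr1; last by rewrite divr_ge0 // ltW.
  by rewrite mulrC divfK // gt_eqF.
have bd x a a' : nc x <= r -> nc a <= V -> nc a' <= nc u.1 + nc u.2 -> nc (a' + x * a) <= B.
  move=> xr aV a'u; apply: (le_trans (ncD _ _)); rewrite /B lerD // ncM.
  by rewrite ler_pM ?nc_ge0 // (le_trans xr) // ler_norm.
have u1 : nc u.1 <= nc u.1 + nc u.2 by rewrite lerDl nc_ge0.
have u2 : nc u.2 <= nc u.1 + nc u.2 by rewrite lerDr nc_ge0.
exists (t / V); first by rewrite divr_gt0.
move=> x x' xr x'r hx; rewrite -At; apply: (hA d P b T) => //; try exact: bd.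
- rewrite /= opprD addrACA subrr add0r -mulrBl ncM.
  rewrite -[t](@divfK _ V) ?gt_eqF //; exact: ler_pM (nc_ge0 _) (nc_ge0 _) hx v1.
- rewrite /= opprD addrACA subrr add0r -mulrBl ncM.
  rewrite -[t](@divfK _ V) ?gt_eqF //; exact: ler_pM (nc_ge0 _) (nc_ge0 _) hx v2.
Qed.

(** On a disc the potential of a fixed large index is close to the Green function, and
    it is a logarithm of a polynomial cut off at [rho]. *)
Lemma green_slice_dyadic_submean u v : dyadic_submean (fun x : R[i] => green (u + x *: v)).
Proof.
move=> x0 r e r0 e0; have e3 : 0 < e / 3 by rewrite divr_gt0.
pose B := nc u.1 + (nc x0 + r + e) * nc v.1.
have [k0 /(_ k0 (leqnn _))] := @pow2_small R B 1 ltr01.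
rewrite ltr_pdivrMr ?exprn_gt0 // mul1r => /ltW Bk.
have [k1 hk1] := pow2_small (osc_bound c C) e3.
pose k := maxn k0 k1; have kk0 : (k0 <= k)%N := leq_maxl _ _.
have {hk1} osck := hk1 k (leq_maxr _ _).
have near x : nc x <= nc x0 + r + e ->
    `|green (u + x *: v) - potential k (u + x *: v)| <= e / 3.
  move=> hx; apply: le_trans (ltW osck); apply: (potential_rate c_gt0 c_le1 C_ge1 T _ kk0).
  apply: (orb_in_W c_gt0 c_le1 C_ge1 T _ (leqnn k0)); apply: le_trans Bk.
  by rewrite /= (le_trans (ncD _ _)) // lerD2l ncM ler_wpM2r ?nc_ge0.
have D1 : 1 <= D k.
  by apply: le_trans (pow2_le_degprod T k); rewrite exprn_ege1 // ler1n.
have D0 : 0 < D k by lra.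
have [r' [h1 h2 [j0 hj]]] := log_max_submean (orbpoly P b u v k).2 x0
  (rho_gt0 c_gt0 c_le1 C_ge1) r0 e3.
exists r'; split; [done|lra|exists j0 => j /hj {}hj].
have potE x : potential k (u + x *: v) =
    ln (Num.max (nc (orbpoly P b u v k).2.[x]) rho) / D k.
  by rewrite (horner_orbpoly P b u v k x).2.
have m1 : circle_mean j (fun x => potential k (u + x *: v)) x0 r' <=
    circle_mean j (fun x => green (u + x *: v)) x0 r' + e / 3.
  apply: le_circle_mean => t.
  have hx : nc (x0 + r'%:C%C * cis t) <= nc x0 + r + e.
    by rewrite (le_trans (ncD _ _)) // ncM nc_cis mulr1 nc_real ger0_norm; lra.
  by have := near _ hx; rewrite ler_norml => /andP[]; lra.
have m2 : potential k (u + x0 *: v) <=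
    circle_mean j (fun x => potential k (u + x *: v)) x0 r' + e / 3.
  under [X in circle_mean j X]eq_fun do rewrite potE.
  rewrite potE circle_mean_div ler_pdivrMr // mulrDl divfK ?gt_eqF //.
  apply: (le_trans hj); rewrite lerD2l ler_peMr // ltW //.
have hx0 : nc x0 <= nc x0 + r + e by lra.
by have := near _ hx0; rewrite ler_norml => /andP[]; lra.
Qed.

Lemma green_plurisubharmonic s : continuous (fun z => green (coords s z)) ->
  plurisubharmonic (EFin \o (fun z => green (coords s z))).
Proof.
move=> cg; split; first exact: continuous_usc.
move=> u v; have -> : (fun w : R[i] => (EFin \o (fun z => green (coords s z))) (u + w *: v)) =
    EFin \o (fun x : R[i] => green (coords s u + x *: coords s v)).
  by apply/funext => x /=; rewrite coords_line.
apply: dyadic_submean_subharmonic; [exact: green_slice_disc_unif_cont|exact: green_slice_dyadic_submean].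
Qed.

End Seq.

(** Joint continuity in all the data: the potentials are continuous functions of
    finitely many coefficients, and they converge at a rate depending only on the
    size of the starting point. *)
Lemma continuous_green (X : topologicalType) (d : nat -> nat) (n : nat -> nat)
    (P : nat -> X -> {poly R[i]}) (b : nat -> X -> R[i]) (zeta : X -> CC R) (x0 : X) :
  (forall k q, tame c C (d k) (P k q) (b k q)) ->
  (forall k q, (size (P k q) <= n k)%N) ->
  (forall k i, (fun q => (P k q)`_i) @ x0 --> (P k x0)`_i) ->
  (forall k, b k @ x0 --> b k x0) ->
  (fun q => (zeta q).1) @ x0 --> (zeta x0).1 ->
  (fun q => (zeta q).2) @ x0 --> (zeta x0).2 ->
  {for x0, continuous (fun q => green c C d (P^~ q) (b^~ q) (zeta q))}.
Proof.
move=> T sP cP cb cz1 cz2.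
have Fx : Filter (nbhs x0) := nbhs_filter x0.
have co k : ((fun q => (orb (P^~ q) (b^~ q) k (zeta q)).1) @ x0 -->
      (orb (P^~ x0) (b^~ x0) k (zeta x0)).1) /\
    ((fun q => (orb (P^~ q) (b^~ q) k (zeta q)).2) @ x0 -->
      (orb (P^~ x0) (b^~ x0) k (zeta x0)).2).
  elim: k => [|k [IH1 IH2]]; first by split; [exact: cz1|exact: cz2].
  split; first exact: IH2.
  have h1 := @cvg_hornerc R X (nbhs x0) Fx (n k) (P k) (P k x0) _ _ (sP k) (sP k x0)
    (cP k) IH2.
  have h2 := @cvg_mulc R X (nbhs x0) Fx _ _ _ _ (cb k) IH1.
  have h := @cvg_subc R X (nbhs x0) Fx _ _ _ _ h1 h2.
  exact h.
have [k0 /(_ k0 (leqnn _))] := @pow2_small R (nc (zeta x0).1 + 1) 1 ltr01.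
rewrite ltr_pdivrMr ?exprn_gt0 // mul1r => /ltW hk0.
apply: (@near_uniform_continuous _ _
  (fun k q => potential c C d (P^~ q) (b^~ q) k (zeta q)) _ _ (osc_bound c C) k0).
  apply: filterS (near_nc_le cz1) => q hq; apply: (potential_rate c_gt0 c_le1 C_ge1).
    by move=> k; exact: T.
  apply: (orb_in_W c_gt0 c_le1 C_ge1 _ _ (leqnn k0)); first by move=> k; exact: T.
  exact: le_trans hk0.
move=> k _; apply: (@cvgM _ _ _ Fx); last exact: cvg_cst.
have s0 := size2_gt0 c_gt0 c_le1 C_ge1 (orb (P^~ x0) (b^~ x0) k (zeta x0)).
apply: (continuous_cvg _ (continuous_ln s0)).
apply/cvg_distP => e e0; apply: filterS (proj1 (cvg_ncP Fx _ _) (co k).2 e e0) => q.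
exact: le_lt_trans (size2_dist _ _ _ _).
Qed.

End Constants.
End GreenPlurisubharmonic.

(** * Families over a compact parameter space *)

Section Compactness.
Variable R : realType.
Local Notation nc := (@ComplexField.Normc.normc R).

Lemma compact_nc_bounded (X : topologicalType) (S : set X) (f : X -> R[i]) :
  compact S -> continuous f -> exists r : R, forall x, S x -> nc (f x) <= r.
Proof.
move=> cS cf; have cnf : continuous (nc \o f).
  by move=> x; apply: continuous_comp; [exact: cf|exact: continuous_nc].
have := continuous_compact (continuous_subspaceT cnf) cS.
move=> /compact_bounded[r [_ hr]]; exists (r + 1) => x Sx.
have /(_ (nc (f x))) := hr (r + 1) (ltr_pwDr ltr01 (lexx r)).
rewrite /= ger0_norm ?nc_ge0 //; apply.
by exists x.
Qed.

Lemma compact_pair_bounded (S : set (CC R)) : compact S ->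
  exists r : R, forall z, S z -> nc z.1 <= r /\ nc z.2 <= r.
Proof.
move=> cS; have [r1 h1] := compact_nc_bounded cS (fun z => @cvg_fst _ _ _ _ _).
have [r2 h2] := compact_nc_bounded cS (fun z => @cvg_snd _ _ _ _ _).
exists (Num.max r1 r2) => z Sz; rewrite !le_max h1 // h2 // orbT; split=> //.
Qed.

Lemma finite_bound (I : finType) (X : Type) (f : I -> X -> R) :
  (forall i, exists B, forall x, f i x <= B) ->
  exists2 B, 1 <= B & forall i x, f i x <= B.
Proof.
move=> /choice[B hB]; exists (1 + \sum_i `|B i|); first by rewrite lerDl sumr_ge0.
move=> i x; apply: (le_trans (hB i x)); apply: (le_trans (ler_norm _)).
rewrite (bigD1 i) //= addrCA lerDl addr_ge0 // sumr_ge0 //.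
Qed.

Lemma uniform_cvg_dist (I : Type) (F : set_system I) (FF : Filter F) (X : choiceType)
    (S : set X) (f : I -> X -> R) (g : X -> R) :
  (forall e : R, 0 < e -> \forall i \near F, forall x, S x -> `|f i x - g x| < e) ->
  {uniform S, f @ F --> g}.
Proof.
move=> h Q /uniform_nbhs[E [entE EQ]]; move: entE; rewrite -entourage_ballE => -[e /= e0 he].
apply: filterS (h e e0) => i hi; apply: EQ => x Sx; apply: he.
by rewrite /= /ball /= distrC; exact: hi.
Qed.

End Compactness.

Section HenonFamily.
Variable R : realType.
Local Notation nc := (@ComplexField.Normc.normc R).

(** The inverse of an elementary map is conjugate to an elementary map whose
    polynomial is no longer monic. *)
Lemma henon1_inv_coords (P : {poly R[i]}) (b : R[i]) (z : CC R) :
  henon1_inv P b (coords false z) = coords false (henon1 (b^-1 *: P) b^-1 z).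
Proof.
case: z => x y; rewrite /henon1_inv /henon1 /coords /= hornerZ; congr (_, _).
by rewrite mulrBl mulrC [x / b]mulrC.
Qed.

Lemma norm2_coords s (z : CC R) : norm2 (coords s z) = norm2 z.
Proof. by case: s => //; rewrite /norm2 /= addrC. Qed.

Lemma norm2_eq0 (z : CC R) : norm2 z = 0 -> z = 0.
Proof.
case: z => x y h; have := le_norm2_fst (x, y); have := le_norm2_snd (x, y).
rewrite h /=; have := (nc_ge0 x, nc_ge0 y) => -[x0 y0] h1 h2.
have /eqP : nc x = 0 by lra.
have /eqP : nc y = 0 by lra.
by rewrite !nc_eq0 => /eqP -> /eqP ->.
Qed.

Lemma orb_ext (P P' : nat -> {poly R[i]}) (b b' : nat -> R[i]) k z :
  (forall i, (i < k)%N -> P i = P' i /\ b i = b' i) -> orb P b k z = orb P' b' k z.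
Proof.
elim: k => //= k IH h; rewrite IH; last by move=> i /ltnW; exact: h.
by have [-> ->] := h k (ltnSn k).
Qed.

Lemma fiber_iterSr (M : Type) (sigma : M -> M) (F : M -> CC R -> CC R) n l z :
  fiber_iter sigma F n.+1 l z = fiber_iter sigma F n (sigma l) (F l z).
Proof. by elim: n => //= n <- /=; rewrite -iterSr. Qed.

(** * Compositions of elementary maps as orbits *)

Section Factors.
Variables (M : topologicalType) (sigma : M -> M) (m : nat) (m_gt0 : (0 < m)%N).
Variables (dg : 'I_m -> nat) (p : 'I_m -> M -> {poly R[i]}) (a : 'I_m -> M -> R[i]).
Implicit Types (s : bool) (l : M) (z : CC R).

(** The inverse maps are composed in the opposite order. *)
Definition factors s : seq 'I_m := if s then enum 'I_m else rev (enum 'I_m).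
Definition factor s k : 'I_m := nth (Ordinal m_gt0) (factors s) (k %% m).
Definition step_poly s j l : {poly R[i]} := if s then p j l else (a j l)^-1 *: p j l.
Definition step_coef s j l : R[i] := if s then a j l else (a j l)^-1.
(** The $k$-th step is one of the $m$ factors, at the parameter reached after
    $\lfloor k/m \rfloor$ iterates of [sigma]. *)
Definition poly_at s l k := step_poly s (factor s k) (iter (k %/ m) sigma l).
Definition coef_at s l k := step_coef s (factor s k) (iter (k %/ m) sigma l).
Definition deg_at s k := dg (factor s k).

Lemma size_factors s : size (factors s) = m.
Proof. by case: s; rewrite /factors ?size_rev size_enum_ord. Qed.

Lemma foldl_orb s (js : seq 'I_m) l z :
  foldl (fun w j => henon1 (step_poly s j l) (step_coef s j l) w) z js =
  orb (fun k => step_poly s (nth (Ordinal m_gt0) js k) l)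
      (fun k => step_coef s (nth (Ordinal m_gt0) js k) l) (size js) z.
Proof.
elim/last_ind: js => [//|js j IH].
rewrite foldl_rcons size_rcons /= !nth_rcons ltnn eqxx IH.
by congr henon1; apply: orb_ext => i hi; rewrite !nth_rcons hi.
Qed.

Lemma henon_pm_foldl s l z : henon_pm p a s l z = coords s
  (foldl (fun w j => henon1 (step_poly s j l) (step_coef s j l) w) (coords s z) (factors s)).
Proof.
case: s => //=; rewrite /henon_pm /henon_inv /factors foldl_rev.
elim: (enum 'I_m) => [|j js IH] /=; first by case: z.
by rewrite IH henon1_inv_coords.
Qed.

Lemma fiber_iter_orb s n l z : fiber_iter sigma (henon_pm p a s) n l z =
  coords s (orb (poly_at s l) (coef_at s l) (n * m) (coords s z)).
Proof.
elim: n => [|n IH]; first by rewrite mul0n /= coordsK.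
rewrite [LHS]/= IH henon_pm_foldl coordsK foldl_orb size_factors mulSnr orb_shift.
congr coords; apply: orb_ext => i im.
by rewrite /shiftn /poly_at /coef_at /factor modnMDl modn_small // divnMDl // divn_small // addn0.
Qed.

Lemma degprod_period s n :
  degprod R (deg_at s) (n * m) = (\prod_(j < m) dg j)%:R ^+ n.
Proof.
elim: n => [|n IH]; first by rewrite mul0n degprod0 expr0.
rewrite mulSnr degprod_shift IH exprSr; congr (_ * _).
rewrite natr_prod /degprod /shiftn.
rewrite (eq_bigr (fun i : 'I_m => (dg (nth (Ordinal m_gt0) (factors s) i))%:R)); last first.
  by move=> i _; rewrite /deg_at /factor modnMDl modn_small.
rewrite -(big_mkord xpredT (fun i => (dg (nth (Ordinal m_gt0) (factors s) i))%:R)).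
rewrite -{1}(size_factors s) -(big_nth (Ordinal m_gt0) xpredT (fun j => (dg j)%:R)).
rewrite -big_enum /=; apply: perm_big.
by rewrite /factors; case: (s); rewrite ?perm_rev.
Qed.

Hypothesis dg_ge2 : forall j, (2 <= dg j)%N.
Hypothesis p_monic : forall j l, p j l \is monic.
Hypothesis p_size : forall j l, size (p j l) = (dg j).+1.
Hypothesis p_cont : forall j k, continuous (fun l : M => (p j l)`_k : R[i]).
Hypothesis a_cont : forall j, continuous (a j).
Hypothesis a_neq0 : forall j l, a j l != 0.

Lemma size_step_poly s j l : size (step_poly s j l) = (dg j).+1.
Proof. by case: s; rewrite /step_poly ?size_scale ?invr_eq0. Qed.

Lemma continuous_step_coef s j : continuous (step_coef s j).
Proof.
case: s => l; first exact: a_cont.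
have h := @cvg_invc R M (nbhs l) (nbhs_filter l) _ _ (a_neq0 j l) (@a_cont j l).
exact h.
Qed.

Lemma continuous_step_poly s j i : continuous (fun l => (step_poly s j l)`_i : R[i]).
Proof.
case: s => l; first exact: p_cont.
have h1 := @cvg_invc R M (nbhs l) (nbhs_filter l) _ _ (a_neq0 j l) (@a_cont j l).
have h := @cvg_mulc R M (nbhs l) (nbhs_filter l) _ _ _ _ h1 (@p_cont j i l).
rewrite /step_poly; under eq_fun do rewrite coefZ.
by move: h; rewrite -coefZ.
Qed.

(** Compactness of the parameter space enters here.  The leading coefficients
    are 1 or the inverse of [a], and bounds for [a] bound the latter from below. *)
Lemma uniform_tame : compact [set: M] -> exists c C : R, [/\ 0 < c, c <= 1, 1 <= C &
  forall s j l, tame c C (dg j) (step_poly s j l) (step_coef s j l)].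
Proof.
move=> cM; pose N := \max_j dg j.
have dN j : (dg j <= N)%N by exact: leq_bigmax.
have [B1 B11 hB1] : exists2 B : R, 1 <= B & forall (i : bool * 'I_m * 'I_N.+1) l,
    nc (step_poly i.1.1 i.1.2 l)`_i.2 <= B.
  apply: finite_bound => -[[s j] i] /=.
  have [r hr] := compact_nc_bounded cM (@continuous_step_poly s j i).
  by exists r => l; exact: hr.
have [B2 B21 hB2] : exists2 B : R, 1 <= B & forall (i : bool * 'I_m) l,
    nc (step_coef i.1 i.2 l) <= B.
  apply: finite_bound => -[s j] /=.
  have [r hr] := compact_nc_bounded cM (@continuous_step_coef s j).
  by exists r => l; exact: hr.
pose B := B1 + B2; have B_ge1 : 1 <= B by rewrite /B; lra.
have B0 : 0 < B by lra.
have N2 : (2 <= N)%N by apply: leq_trans (dN (Ordinal m_gt0)).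
(* The constants of [tame_degree], for the cap [N] of all the degrees. *)
exists (B^-1 / 2), ((N%:R + 2) ^+ 3 * B); split.
- by rewrite divr_gt0 // invr_gt0.
- have : B^-1 <= 1 by rewrite invf_le1.
  have : 0 < B^-1 by rewrite invr_gt0.
  lra.
- have : 1 <= (N%:R + 2) ^+ 3 :> R.
    by rewrite exprn_ege1 //; have := ler0n R N; lra.
  by move=> h; rewrite mulr_ege1.
move=> s j l; apply: tame_degree => //.
- by rewrite invr_gt0.
- by rewrite invf_le1.
- by rewrite dg_ge2 dN.
- exact: size_step_poly.
- move=> i; have [iN|Ni] := ltnP i N.+1.
    by have := hB1 (s, j, Ordinal iN) l; rewrite /= /B; lra.
  rewrite nth_default ?nc0 ?(ltW B0) // size_step_poly.
  by apply: leq_trans Ni; rewrite ltnS.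
- case: s; rewrite /step_poly.
    by rewrite (monicP (p_monic j l)) nc1 invf_le1.
  rewrite lead_coefZ (monicP (p_monic j l)) mulr1 ncV lef_pV2 ?posrE ?nc_gt0 //.
  by have := hB2 (true, j) l; rewrite /= /step_coef /B; lra.
- by have := hB2 (s, j) l; rewrite /= /B; lra.
Qed.

End Factors.
End HenonFamily.

(** * The forward and backward Green functions *)

Section Green.
Variables (R : realType) (M : metricType R) (sigma : M -> M).
Hypothesis csigma : continuous sigma.
Variables (m : nat) (m_gt0 : (0 < m)%N).
Variables (dg : 'I_m -> nat) (p : 'I_m -> M -> {poly R[i]}) (a : 'I_m -> M -> R[i]).
Hypothesis p_size : forall j l, size (p j l) = (dg j).+1.
Hypothesis p_cont : forall j k, continuous (fun l : M => (p j l)`_k : R[i]).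
Hypothesis a_cont : forall j, continuous (a j).
Hypothesis a_neq0 : forall j l, a j l != 0.
Variables (c C : R).
Hypotheses (c_gt0 : 0 < c) (c_le1 : c <= 1) (C_ge1 : 1 <= C).
Hypothesis T : forall s j l, tame c C (dg j) (step_poly p a s j l) (step_coef a s j l).
Implicit Types (s : bool) (l : M) (z : CC R).
Local Notation nc := (@ComplexField.Normc.normc R).
Local Notation rho := (escape_radius c C).
Local Notation Ps s l := (poly_at sigma m_gt0 p a s l).
Local Notation bs s l := (coef_at sigma m_gt0 a s l).
Local Notation ds s := (deg_at m_gt0 dg s).
Local Notation Hpm s := (henon_pm p a s).
Local Notation Gn s := (green_approx sigma (Hpm s) (\prod_(j < m) dg j)%N).

Definition green_pm s l z : R := green c C (ds s) (Ps s l) (bs s l) (coords s z).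

Lemma tame_at s l k : tame c C (ds s k) (Ps s l k) (bs s l k).
Proof. exact: T. Qed.

Let in_W_late s l r k0 k z : r <= 2 ^+ k0 -> (k0 <= k)%N -> nc z.1 <= r -> nc z.2 <= r ->
  in_W c C (orb (Ps s l) (bs s l) k (coords s z)).
Proof.
move=> rk kk z1 z2; apply: (orb_in_W c_gt0 c_le1 C_ge1 (tame_at s l) _ kk).
by apply: le_trans rk; case: s.
Qed.

(** The index from which the estimate holds depends on the size of the point only,
    and the constant on [c] and [C]: hence the uniformity in the parameter. *)
Lemma green_approx_rate s r : exists k0 A, forall n l z, (k0 <= n)%N ->
  nc z.1 <= r -> nc z.2 <= r -> `|Gn s n l z - green_pm s l z| <= A / 2 ^+ n.
Proof.
have [k0 /(_ k0 (leqnn _))] := @pow2_small R r 1 ltr01.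
rewrite ltr_pdivrMr ?exprn_gt0 // mul1r => /ltW rk.
exists k0, (2 * ln rho + osc_bound c C) => n l z kn z1 z2.
have nm : (n <= n * m)%N by rewrite leq_pmulr.
have W := in_W_late s l rk kn z1 z2.
have W' := in_W_late s l rk (leq_trans kn nm) z1 z2.
have h1 := potential_rate c_gt0 c_le1 C_ge1 (tame_at s l) W nm.
have h2 := potential_logp c_gt0 c_le1 C_ge1 (tame_at s l) W'.
have osc0 := osc_bound_ge0 c_gt0 c_le1 C_ge1.
have lr : 0 <= ln rho by rewrite ln_ge0 //; have := rho_ge12 c_gt0 c_le1 C_ge1; lra.
apply: (@le_trans _ _ ((2 * ln rho + osc_bound c C) / 2 ^+ (n * m))); last first.
  rewrite ler_wpM2l // ?lef_pV2 ?posrE ?exprn_gt0 //; first by lra.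
  by rewrite ler_weXn2l // ler1n.
have -> : Gn s n l z = (degprod R (ds s) (n * m))^-1 *
    logp (norm2 (orb (Ps s l) (bs s l) (n * m) (coords s z))).
  by rewrite /green_approx (fiber_iter_orb _ m_gt0) norm2_coords degprod_period.
move: h1 h2; rewrite /green_pm; set g := green _ _ _ _ _ _; set q := potential _ _ _ _ _ _ _.
set u := _^-1 * _ => h1 h2.
have -> : u - g = (u - q) - (g - q) by ring.
by apply: (le_trans (ler_normB _ _)); rewrite mulrDl; lra.
Qed.

Lemma green_approx_cvg s l z : (fun n => Gn s n l z) @ \oo --> green_pm s l z.
Proof.
pose r := Num.max (nc z.1) (nc z.2).
have [k0 [A h]] := green_approx_rate s r.
apply/(cvg_distP eventually_filter) => e e0; have [k1 h1] := pow2_small A e0.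
exists (maxn k0 k1) => // n /=; rewrite geq_max => /andP[n0 n1].
by apply: le_lt_trans (h1 n n1); apply: h; rewrite // /r le_max lexx ?orbT.
Qed.

Lemma prod_degree_gt0 (l : M) : 0 < (\prod_(j < m) dg j)%:R :> R.
Proof.
rewrite ltr0n prodn_gt0 // => j; exact: ltnW (tame_gt1 (T true j l)).
Qed.

Lemma green_pm_functional s l z :
  (\prod_(j < m) dg j)%:R * green_pm s l z = green_pm s (sigma l) (Hpm s l z).
Proof.
have d0 := prod_degree_gt0 l.
have h1 : (fun n => (\prod_(j < m) dg j)%:R * Gn s n.+1 l z) @ \oo -->
    (\prod_(j < m) dg j)%:R * green_pm s l z.
  apply: cvgM; first exact: cvg_cst.
  have h := @green_approx_cvg s l z.
  by move: h; rewrite -cvg_shiftS.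
have h2 := @green_approx_cvg s (sigma l) (Hpm s l z).
apply: (cvg_unique _ h1); first exact: norm_hausdorff.
have -> : (fun n => (\prod_(j < m) dg j)%:R * Gn s n.+1 l z) =
    (fun n => Gn s n (sigma l) (Hpm s l z)); last exact: h2.
apply/funext => n; rewrite /green_approx fiber_iterSr exprS invfM !mulrA divff ?mul1r //.
by rewrite gt_eqF.
Qed.

(** The orbit of a point is either bounded or passes, beyond the time at which
    all bounded starting points are in the forward region, through a point with a
    large second coordinate. *)
Lemma green_pm_eq0 s l z : green_pm s l z = 0 <-> bounded_orbits sigma (Hpm s) l z.
Proof.
have r0 := rho_gt0 c_gt0 c_le1 C_ge1.
split=> [g0|[B hB]].
  have [k0 hk0] := eventually_W c_gt0 c_le1 C_ge1 (tame_at s l) (coords s z).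
  exists (2 * rho + \sum_(i < k0) norm2 (fiber_iter sigma (Hpm s) i l z)) => n.
  have [nk|kn] := ltnP n k0.
    rewrite (bigD1 (Ordinal nk)) //= addrCA lerDl addr_ge0 //; first by lra.
    by rewrite sumr_ge0 // => i _; exact: sqrtr_ge0.
  have knm : (k0 <= n * m)%N by rewrite (leq_trans kn) // leq_pmulr.
  have W := in_W_orb c_gt0 c_le1 C_ge1 (tame_at s l) hk0 knm.
  have small : nc (orb (Ps s l) (bs s l) (n * m) (coords s z)).2 <= rho.
    rewrite leNgt; apply/negP => big.
    have := green_gt0 c_gt0 c_le1 C_ge1 (tame_at s l) W (ltW big).
    by rewrite -/(green_pm s l z) g0 ltxx.
  rewrite (fiber_iter_orb _ m_gt0) norm2_coords.
  apply: (@le_trans _ _ (2 * rho)); last first.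
    by rewrite lerDl sumr_ge0 // => i _; exact: sqrtr_ge0.
  apply: norm2_le => //; move: W; rewrite /in_W /size2 max_r //.
apply: (green_eq0 c_gt0 c_le1 C_ge1 (tame_at s l) (B := Num.max B rho)) => k0.
exists (k0 * m)%N; first by rewrite leq_pmulr.
rewrite /size2 ge_max !le_max lexx orbT andbT; apply/orP; left.
apply: le_trans (hB k0); rewrite (fiber_iter_orb _ m_gt0) norm2_coords.
exact: le_norm2_snd.
Qed.

Lemma green_pm_ge0 s l z : 0 <= green_pm s l z.
Proof. exact: (green_ge0 c_gt0 c_le1 C_ge1 (tame_at s l)). Qed.

Lemma setC_bounded_orbits s l :
  ~` bounded_orbits sigma (Hpm s) l = [set z | 0 < green_pm s l z].
Proof.
apply/seteqP; split => z /= h.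
  rewrite lt_neqAle green_pm_ge0 andbT eq_sym; apply/eqP => g0; apply: h.
  exact/green_pm_eq0.
by move=> /green_pm_eq0 g0; move: h; rewrite g0 ltxx.
Qed.

Lemma continuous_green_pm s (q : M * CC R) :
  {for q, continuous (fun q : M * CC R => green_pm s q.1 q.2)}.
Proof.
have Fq : Filter (nbhs q) := nbhs_filter q.
have ci k : (fun x : M * CC R => iter k sigma x.1) @ q --> iter k sigma q.1.
  elim: k => [|k IH]; first exact: cvg_fst.
  by apply: (continuous_cvg _ (@csigma _)).
apply: (@continuous_green R c C c_gt0 c_le1 C_ge1 _ (ds s) (fun k => (ds s k).+1)
  (fun k x => Ps s x.1 k) (fun k x => bs s x.1 k) (fun x => coords s x.2) q).
- by move=> k x; exact: tame_at.
- by move=> k x; rewrite /poly_at (size_step_poly p_size a_neq0).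
- move=> k i; have hc := continuous_step_poly p_cont a_cont a_neq0.
  have h := cvg_comp _ _ (ci (k %/ m)%N) (hc s (factor m_gt0 s k) i _); exact h.
- move=> k; have hc := continuous_step_coef a_cont a_neq0.
  have h := cvg_comp _ _ (ci (k %/ m)%N) (hc s (factor m_gt0 s k) _); exact h.
- have h : coords s x.2 @[x --> q] --> coords s q.2.
    by apply: (continuous_cvg _ (@continuous_coords _ _ _)); exact: cvg_snd.
  exact: (continuous_cvg _ (@cvg_fst _ _ _ _ _) h).
- have h : coords s x.2 @[x --> q] --> coords s q.2.
    by apply: (continuous_cvg _ (@continuous_coords _ _ _)); exact: cvg_snd.
  exact: (continuous_cvg _ (@cvg_snd _ _ _ _ _) h).
Qed.

Lemma continuous_green_pm_snd s l : continuous (green_pm s l).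
Proof.
move=> z; have h : (fun z' => (l, z')) @ z --> (l, z).
  by apply: (@cvg_pair _ _ _ _ (nbhs l) (nbhs z)); [exact: cvg_cst|exact: cvg_id].
exact: (continuous_cvg _ (@continuous_green_pm s (l, z)) h).
Qed.

Lemma green_approx_uniform s (S : set (CC R)) : compact S ->
  {uniform [set: M] `*` S, (fun n (q : M * CC R) => Gn s n q.1 q.2) @ \oo -->
    (fun q : M * CC R => green_pm s q.1 q.2)}.
Proof.
move=> /compact_pair_bounded[r hr]; have [k0 [A h]] := green_approx_rate s r.
apply: uniform_cvg_dist => e e0; have [k1 h1] := pow2_small A e0.
exists (maxn k0 k1) => // n /=; rewrite geq_max => /andP[n0 n1] [l z] [_ /= Sz].
by have [z1 z2] := hr z Sz; exact: le_lt_trans (h _ _ _ n0 z1 z2) (h1 n n1).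
Qed.

Lemma green_approx_compact s l : {family compact, (fun n => Gn s n l) @ \oo --> green_pm s l}.
Proof.
apply/fam_cvgP => S /compact_pair_bounded[r hr]; have [k0 [A h]] := green_approx_rate s r.
apply: uniform_cvg_dist => e e0; have [k1 h1] := pow2_small A e0.
exists (maxn k0 k1) => // n /=; rewrite geq_max => /andP[n0 n1] z Sz.
by have [z1 z2] := hr z Sz; exact: le_lt_trans (h _ _ _ n0 z1 z2) (h1 n n1).
Qed.

(** Joint continuity is uniform along compact sets of points. *)
Lemma green_pm_param s (l0 : M) : {family compact, green_pm s l @[l --> l0] --> green_pm s l0}.
Proof.
apply/fam_cvgP => S cS; apply: uniform_cvg_dist => e e0.
have e2 : 0 < e / 2 by rewrite divr_gt0.
have /compact_near_coveringP := cS.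
move=> /(_ M (nbhs l0) (fun l z => `|green_pm s l z - green_pm s l0 z| < e) _).
apply => z Sz.
have := proj1 (cvg_distP (nbhs_filter (l0, z)) _ _) (@continuous_green_pm s (l0, z)) _ e2.
move=> [[U V] /= [hU hV] hUV]; exists (V, U); first by split.
move=> [z' l] /= [Vz' Ul].
have h1 := hUV (l, z') (conj Ul Vz').
have h2 := hUV (l0, z') (conj (nbhs_singleton hU) Vz').
move: h1 h2 => /=; set x := green_pm s l z'; set y := green_pm s l0 z'.
set w := green_pm s l0 z => h1 h2.
have -> : x - y = (x - w) - (y - w) by ring.
apply: (le_lt_trans (ler_normB _ _)); lra.
Qed.

Lemma green_pm_holder (S : set (CC R)) : compact S -> exists tau A : R, 0 < tau /\ 0 < A /\
  forall l z z', S z -> S z' ->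
    `|green_pm true l z - green_pm true l z'| <= A * norm2 (z - z') `^ tau.
Proof.
move=> /compact_pair_bounded[r hr].
have [tau [A [tau0 A0 hA]]] := green_holder c_gt0 c_le1 C_ge1 r.
exists tau, A; split=> //; split=> // l z z' Sz Sz'.
have [z1 z2] := hr z Sz; have [w1 w2] := hr z' Sz'.
have [/norm2_eq0 /eqP|nz] := eqVneq (norm2 (z - z')) 0.
  rewrite subr_eq0 => /eqP ->; rewrite subrr normr0 mulr_ge0 ?powR_ge0 //; exact: ltW.
apply: (hA _ _ _ (tame_at true l)) => //.
- by rewrite lt_neqAle eq_sym nz sqrtr_ge0.
- exact: (le_norm2_fst (z - z')).
- exact: (le_norm2_snd (z - z')).
Qed.

End Green.

Theorem proposition1p1 (R : realType) (M : metricType R)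
    (cptM : compact [set: M])
    (sigma : M -> M) (csigma : continuous sigma)
    (m : nat) (m_gt0 : (0 < m)%N)
    (dg : 'I_m -> nat) (dg_ge2 : forall j, (2 <= dg j)%N)
    (p : 'I_m -> M -> {poly R[i]})
    (p_monic : forall j l, p j l \is monic)
    (p_size : forall j l, size (p j l) = (dg j).+1)
    (p_cont : forall j k, continuous (fun l : M => (p j l)`_k : R[i]))
    (a : 'I_m -> M -> R[i])
    (a_cont : forall j, continuous (a j))
    (a_neq0 : forall j l, a j l != 0) :
  let d := (\prod_(j < m) dg j)%N in
  let Hpm := henon_pm p a in
  let K (s : bool) := bounded_orbits sigma (Hpm s) in
  let Gn (s : bool) := green_approx sigma (Hpm s) d in
  exists G : bool -> M -> CC R -> R,
    (forall s : bool,
      (forall l : M,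
        [/\ {family compact, (fun n => Gn s n l) @ \oo --> G s l},
            continuous (G s l),
            forall z, d%:R * G s l z = G s (sigma l) (Hpm s l z),
            (forall z, ~ K s l z -> 0 < G s l z) /\
              pluriharmonic_on (~` K s l) (G s l)
          & plurisubharmonic (EFin \o G s l) /\
              (forall z, G s l z = 0 <-> K s l z)]) /\
      (forall S : set (CC R), compact S ->
        {uniform [set: M] `*` S,
          (fun n (q : M * CC R) => Gn s n q.1 q.2) @ \oo -->
          (fun q : M * CC R => G s q.1 q.2)}) /\
      (forall l0 : M, {family compact, G s l @[l --> l0] --> G s l0})) /\
    ((forall l, exists l', sigma l' = l) ->
      forall S : set (CC R), compact S ->
        exists tau C : R, 0 < tau /\ 0 < C /\
          forall (l : M) (z z' : CC R), S z -> S z' ->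
            `|G true l z - G true l z'| <= C * norm2 (z - z') `^ tau).
Proof.
move=> d Hpm K Gn.
have [c [C [c0 c1 C1 T]]] := uniform_tame m_gt0 dg_ge2 p_monic p_size p_cont a_cont a_neq0 cptM.
exists (green_pm sigma m_gt0 dg p a c C); split; last first.
  move=> _ S cS; exact: (green_pm_holder sigma m_gt0 c0 c1 C1 T cS).
move=> s; split; last split.
- move=> l.
  have cont : continuous (green_pm sigma m_gt0 dg p a c C s l).
    exact: (continuous_green_pm_snd csigma p_size p_cont a_cont a_neq0 c0 c1 C1 T).
  have escape := setC_bounded_orbits sigma m_gt0 c0 c1 C1 T s l.
  split.
  + exact: (green_approx_compact c0 c1 C1 T).
  + exact: cont.
  + by move=> z; exact: (green_pm_functional sigma m_gt0 c0 c1 C1 T).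
  + split; first by move=> z nK; have : (~` K s l) z := nK; rewrite /K escape.
    rewrite /K escape; apply: (green_pluriharmonic c0 c1 C1); exact: (tame_at sigma m_gt0 T).
  + split; last by move=> z; exact: (green_pm_eq0 sigma m_gt0 c0 c1 C1 T).
    by apply: (green_plurisubharmonic c0 c1 C1 _ cont); exact: (tame_at sigma m_gt0 T).
- by move=> S cS; exact: (green_approx_uniform c0 c1 C1 T cS).
- by move=> l0; exact: (green_pm_param csigma p_size p_cont a_cont a_neq0 c0 c1 C1 T).
Qed.
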